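(* In the min-max time-to-reach-$E$ game defined in the context, there is a Universal Line (UL) given by $$\mathcal U=\{(r,\theta)\mid 0\le r\le 1,\ \theta=0\},$$ on which $L$'s equilibrium control strategy is to head directly to the center of the lake and $M$ does not move, i.e. $$\cos\psi_{UL}=-1,\qquad \omega_{UL}=0.$$
   Context: The Lady $L$ swims with speed $\mu$ in a circular lake of radius $1$; the Man $M$ moves with maximum speed $1$ along the perimeter. The state is $(r,\theta)$, where $r\in[0,1]$ is $L$'s distance from the center and $\theta$ is the angle of $L$ relative to $M$; by reflection symmetry $\theta$ is taken in $[0,\pi]$ without loss of generality. The dynamics are $$\dot r=\mu\cos\psi,\qquad \dot\theta=\frac{\mu}{r}\sin\psi-\omega,$$ with $L$ controlling $\psi\in[-\pi,\pi]$ and $M$ controlling $\omega\in[-1,1]$. Throughout $\mu_{\rm crit}<\mu<1$, where $\mu_{\rm crit}\approx0.21723$ is the value of $\mu$ at which $\pi-\sqrt{1/\mu^2-1}+\cos^{-1}\mu$ vanishes. The game is played below the barrier curve $B(r)=\pi-\sqrt{r^2/\mu^2-1}+\cos^{-1}(\mu/r)$, $r\in[\mu,1]$, i.e. on states with $\theta<B(r)$ whenever $r>\mu$. $L$ minimizes and $M$ maximizes the time for the state to reach the antipodal point $E=(\mu,\pi)$; equilibrium means saddle point of this zero-sum differential game. When $L$ reaches the center $r=0$, play continues from $(0,\pi)$ along the line $\theta=\pi$. A Universal Line is a line in the state space which is itself an equilibrium trajectory and has tributary equilibrium trajectories, which do not enter it tangentially. *)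

(* Defs.v *)
(* MathComp-Analysis. *)
From HB Require Import structures.
From mathcomp Require Import all_boot all_order all_algebra.
From mathcomp Require Import all_classical all_reals all_analysis.
Set Implicit Arguments.
Unset Strict Implicit.
Unset Printing Implicit Defensive.
Import Order.TTheory GRing.Theory Num.Theory.
Import numFieldNormedType.Exports.
Local Open Scope classical_set_scope.
Local Open Scope ring_scope.

Section LadyInTheLake.
Context {R : realType}.
Implicit Types (mu t T V : R) (x : R * R) (psi omega r th : R -> R).

Definition is_mu_crit (m : R) : Prop :=
  0 < m < 1 /\ pi - Num.sqrt (m^-1 ^+ 2 - 1) + acos m = 0.

Definition barrier mu (rho : R) : R :=
  pi - Num.sqrt (rho ^+ 2 / mu ^+ 2 - 1) + acos (mu / rho).

Definition state_space mu : set (R * R) :=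
  [set x | [/\ 0 <= x.1 <= 1, 0 <= x.2 <= pi & mu < x.1 -> x.2 < barrier mu x.1]].

Definition E mu : R * R := (mu, pi).

(* Along a motion the angle [th] is a real-valued lift, so that the dynamics
   need no reflection rule; [acos (cos a)] is the representative in [0, pi] of
   the angle [a] modulo 2 pi and modulo reflection. *)
Definition state r th t : R * R := (r t, acos (cos (th t))).

Definition L_control : set (R -> R) :=
  [set psi : R -> R | measurable_fun setT psi /\ forall t, - pi <= psi t <= pi].

Definition M_control : set (R -> R) :=
  [set omega : R -> R | measurable_fun setT omega /\ forall t, -1 <= omega t <= 1].

(* Caratheodory solutions on [0, T], starting at [x], of
     r' = mu cos psi,  th' = (mu / r) sin psi - omega.
   The second equation is singular at the center: it is imposed on the time
   intervals on which r > 0, and whenever L is at the center the motion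
   continues from (0, pi), i.e. the right limit of the angle is pi.  The value
   of [th] at the very instant when r = 0 carries no information. *)
Definition trajectory mu x psi omega T r th : Prop :=
  [/\ r 0 = x.1 /\ th 0 = x.2,
      forall t, 0 <= t <= T ->
        r t = x.1 + (\int[lebesgue_measure]_(s in `[0, t]) (mu * cos (psi s)))%R,
      forall a b, 0 <= a -> a <= b -> b <= T ->
        (forall s, a <= s <= b -> 0 < r s) ->
        th b = th a +
          (\int[lebesgue_measure]_(s in `[a, b])
             (mu / r s * sin (psi s) - omega s))%R
    & forall t, 0 <= t < T -> r t = 0 ->
        (\forall s \near t^'+, 0 < r s) /\ th s @[s --> t^'+] --> (pi : R)].

(* The game is still being played at every time before T: the state is below
   the barrier, L is in the lake, and E has not been reached. *)
Definition play mu x psi omega T r th : Prop :=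
  [/\ 0 <= T, trajectory mu x psi omega T r th
    & forall t, 0 <= t < T ->
        state_space mu (state r th t) /\ state r th t <> E mu].

Definition crosses_barrier mu T r th : Prop :=
  mu < r T /\ barrier mu (r T) <= (state r th T).2.

(* Nonanticipative strategies (Varaiya, Roxin, Elliott-Kalton): maps from the
   controls of the opponent (in [A]) to one's own controls (in [B]). *)
Definition ae_eq_on t (f g : R -> R) : Prop :=
  {ae (@lebesgue_measure R), forall s, 0 <= s <= t -> f s = g s}.

Definition strategy (A B : set (R -> R)) (sigma : (R -> R) -> (R -> R)) : Prop :=
  (forall f, A f -> B (sigma f)) /\
  (forall f g t, A f -> A g -> 0 <= t ->
     ae_eq_on t f g -> ae_eq_on t (sigma f) (sigma g)).

Definition L_strategy := strategy M_control L_control.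
Definition M_strategy := strategy L_control M_control.

(* Only states below the barrier belong to the game.  Keeping the state there
   is up to M: a control of M that lets L through the barrier is not admissible
   against [alpha], and a strategy of M must never let L through.  Keeping
   r <= 1 is up to L. *)
Definition L_guarantees mu x (alpha : (R -> R) -> (R -> R)) V : Prop :=
  forall omega, M_control omega ->
    exists T r th, play mu x (alpha omega) omega T r th /\
      ((state r th T = E mu /\ T <= V) \/ crosses_barrier mu T r th).

Definition M_guarantees mu x (beta : (R -> R) -> (R -> R)) V : Prop :=
  forall psi, L_control psi ->
    forall T r th, play mu x psi (beta psi) T r th ->
      ~ crosses_barrier mu T r th /\ (state r th T = E mu -> V <= T).

Definition saddle_point mu x alpha beta V : Prop :=
  [/\ L_strategy alpha, M_strategy beta,
      L_guarantees mu x alpha V & M_guarantees mu x beta V].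

(* The outcome of a saddle point: (psi, omega) is a pair of controls produced
   by the two strategies in response to each other, and E is reached at time T,
   the value of the game at [x].  The last clause is the equilibrium motion
   after a passage through the center, along the line th = pi. *)
Definition equilibrium_play mu x psi omega T r th : Prop :=
  [/\ state_space mu x, L_control psi /\ M_control omega,
      exists alpha beta, [/\ saddle_point mu x alpha beta T,
        ae_eq_on T (alpha omega) psi & ae_eq_on T (beta psi) omega],
      play mu x psi omega T r th /\ state r th T = E mu
    & forall t0 t, 0 <= t0 -> t0 < t -> t <= T -> r t0 = 0 -> th t = pi].

Definition left_velocity (f : R -> R) t (v : R) : Prop :=
  h^-1 * (f (t + h) - f t) @[h --> 0^'-] --> v.

Definition right_velocity (f : R -> R) t (v : R) : Prop :=
  h^-1 * (f (t + h) - f t) @[h --> 0^'+] --> v.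

(* At time t the velocity of arrival is not parallel to that of departure. *)
Definition nontangential_at r th t : Prop :=
  exists vr vth wr wth,
    [/\ left_velocity (fun s => (state r th s).1) t vr,
        left_velocity (fun s => (state r th s).2) t vth,
        right_velocity (fun s => (state r th s).1) t wr,
        right_velocity (fun s => (state r th s).2) t wth
      & vr * wth != vth * wr].

(* An equilibrium trajectory that starts off U, reaches U for the first time at
   the point p, not tangentially, and then moves along U. *)
Definition tributary_at mu (U : set (R * R)) (p : R * R) : Prop :=
  exists x psi omega T r th,
    equilibrium_play mu x psi omega T r th /\
    exists t1 t2,
      [/\ 0 < t1 /\ t1 < t2 <= T,
          forall t, 0 <= t < t1 -> ~ U (state r th t),
          state r th t1 = p,
          forall t, t1 <= t <= t2 -> U (state r th t)
        & nontangential_at r th t1].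

(* U is traversed by an equilibrium trajectory, and tributaries enter it at
   each of its points other than its two ends. *)
Definition universal_line mu (U : set (R * R)) : Prop :=
  exists x psi omega T r th,
    equilibrium_play mu x psi omega T r th /\
    exists tau,
      [/\ 0 < tau <= T,
          {within `[0, tau], continuous r} /\ {within `[0, tau], continuous th},
          state r th @` `[0, tau] = U
        & forall t, 0 < t < tau -> tributary_at mu U (state r th t)].

Definition UL : set (R * R) := [set x | 0 <= x.1 <= 1 /\ x.2 = 0].

End LadyInTheLake.

(* Main.v *)
(* In the coordinates k = r / mu and y = th - pi, L starts at k0 = r0 / mu.

   L guarantees the time k0 + pi / 2 by swimming to the center, which takes k0,
   and then staying antipodal to M (sin psi = k omega): k grows at the rate
   sqrt (1 - k^2 omega^2) >= sqrt (1 - k^2), hence at least like sin.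

   M guarantees it, from states with th small, by running away from the antipodal
   line y = 0 as soon as |th| >= k.  While M runs, with C = cos y and S = |sin y|, the quantities
     k (C cos (e - t) - S sin (e - t)) + (e - t)  and
     (k (C cos u - S sin u) - sin u cos u) / cos^2 u,  u = t - e,
   are nonincreasing in t whatever L does.  Applied from the last time at which
   |th| <= k, the first one gives k C <= 0 at a time e >= k0; from then on the
   second one shows that k = C = 1 cannot occur before e + pi / 2.  A third
   quantity of this kind, sin D for D the angular distance to the barrier, is
   nondecreasing near the barrier and keeps L from crossing it.

   M's law has to be discontinuous on y = 0 only, so that his answer to a control
   of L can be selected as the maximal solution of a differential equation. *)
Require Import Defs.
From HB Require Import structures.
From mathcomp Require Import all_boot all_order all_algebra.
From mathcomp Require Import all_classical all_reals all_analysis.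
From mathcomp Require Import measurable_realfun ring lra.
Set Implicit Arguments.
Unset Strict Implicit.
Unset Printing Implicit Defensive.
Import Order.TTheory GRing.Theory Num.Theory.
Import numFieldNormedType.Exports.
Local Open Scope classical_set_scope.
Local Open Scope ring_scope.

(** In the plane with polar coordinates k and y, L moves with unit speed, and the three quantities
    owe their monotonicity to Cauchy-Schwarz applied to her unit velocity, whatever her control. Two
    demands on M conflict: he must stand still at th = 0 and run at full speed as soon as |th| >= k.
    The zone in which his law is softened therefore has a width that shrinks with the radius.
    Tributaries come from a delay. During an initial time h, M moves at full speed in the direction
    that decreases th; this costs him nothing, because |th| <= k still holds at time h. If L swims
    straight inward, th reaches 0 at time h with velocity (-mu, -1), and the motion goes on with
    velocity (-mu, 0). The case h = 0 gives the line itself. A strategy of M has to answer every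
    measurable control of L, including those that no play realises. So it is computed from psi
    alone: the radius and L's share of the angle are integrals of psi, and only M's own share solves
    a differential equation. At the center that equation has several solutions, as M may run either
    way; the maximal one, omega = -1 throughout, is the one for which the two strategies answer each
    other. *)

HB.lock Definition intg {R : realType} (f : R -> R) (a b : R) : R :=
  (\int[@lebesgue_measure R]_(s in `[a, b]) f s)%R.

(** * Integrals of bounded measurable functions *)

Section BoundedIntegrands.
Context {R : realType}.
Implicit Types (f g F x y X Y : R -> R) (a b s t c K : R).

Definition bmeas a b f : Prop :=
  measurable_fun `[a, b] f /\ exists K, forall s, a <= s <= b -> `|f s| <= K.

Lemma bmeasS a b a' b' f : a <= a' -> b' <= b -> bmeas a b f -> bmeas a' b' f.
Proof.
move=> aa bb [mf [K Kf]]; split.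
  apply: measurable_funS mf => // s /=; rewrite !in_itv/= => /andP[h1 h2].
  by rewrite (le_trans aa)//= (le_trans h2).
by exists K => s /andP[h1 h2]; apply: Kf; rewrite (le_trans aa)//= (le_trans h2).
Qed.

Lemma bmeas_integrable a b f : bmeas a b f ->
  (@lebesgue_measure R).-integrable `[a, b] (EFin \o f).
Proof.
move=> [mf [K Kf]]; apply: measurable_bounded_integrable => //.
  by rewrite /= lebesgue_measure_itv/=; case: ifP => // _; rewrite ltry.
exists (`|K|); split; first by rewrite num_real.
move=> M KM s /=; rewrite in_itv/= => /Kf h; rewrite (le_trans h)// ltW//.
by rewrite (le_lt_trans (ler_norm K)).
Qed.

Lemma intg_ext a b f g : (forall s, a <= s <= b -> f s = g s) ->
  intg f a b = intg g a b.
Proof.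
by move=> fg; rewrite intg.unlock; apply: eq_Rintegral => s; rewrite inE/= in_itv/= => /fg.
Qed.

Lemma intg_ae a b f g : measurable_fun `[a, b] f -> measurable_fun `[a, b] g ->
  {ae (@lebesgue_measure R), forall s, a <= s <= b -> f s = g s} ->
  intg f a b = intg g a b.
Proof.
move=> mf mg fg; rewrite intg.unlock /Rintegral; congr fine.
apply: ae_eq_integral => //; [exact/measurable_EFinP..|].
move: fg; apply: filterS. exact: (ae_filter_ringOfSetsType (@lebesgue_measure R)).
by move=> s h /=; rewrite in_itv/= => /h ->.
Qed.

Lemma intg_empty a b f : b <= a -> intg f a b = 0.
Proof.
rewrite le_eqVlt => /predU1P[->|ba]; rewrite intg.unlock.
  by rewrite set_itv1 Rintegral_set1.
by rewrite set_itv_ge ?Rintegral_set0// bnd_simp -ltNge.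
Qed.

Lemma intgD a b f g : bmeas a b f -> bmeas a b g ->
  intg (fun s => f s + g s) a b = intg f a b + intg g a b.
Proof. by move=> hf hg; rewrite intg.unlock RintegralD//; exact: bmeas_integrable. Qed.

Lemma intgZ a b c f : bmeas a b f -> intg (fun s => c * f s) a b = c * intg f a b.
Proof. by move=> hf; rewrite intg.unlock RintegralZl//; exact: bmeas_integrable. Qed.

Lemma intg_cst a b c : a <= b -> intg (fun=> c) a b = c * (b - a).
Proof.
move=> ab; rewrite intg.unlock Rintegral_cst//= lebesgue_measure_itv/= lte_fin.
by move: ab; rewrite le_eqVlt => /predU1P[->|->]//; rewrite ltxx subrr.
Qed.

Lemma intg_cat a m b f : a <= m -> m <= b -> bmeas a b f ->
  intg f a b = intg f a m + intg f m b.
Proof.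
move=> am mb hf; apply/eqP; rewrite addrC -subr_eq; apply/eqP.
have i1 := bmeas_integrable hf.
rewrite intg.unlock (@Rintegral_itvB R f (BLeft a) (BRight b) m) ?bnd_simp//.
rewrite Rintegral_itv_obnd_cbnd//.
apply: integrableS i1 => // s /=; rewrite !in_itv/= => /andP[h1 ->].
by rewrite (le_trans am)// ltW.
Qed.

Lemma le_intg a b f g : bmeas a b f -> bmeas a b g ->
  (forall s, a <= s <= b -> f s <= g s) -> intg f a b <= intg g a b.
Proof.
by move=> hf hg fg; rewrite intg.unlock; apply: le_Rintegral => //; exact: bmeas_integrable.
Qed.

(** Endpoints are left out because the controls used later are defined by cases and differ from
    their formulas at the switching times. *)
Lemma intg_ext_oo a b f g : bmeas a b f -> bmeas a b g ->
  (forall s, a < s < b -> f s = g s) -> intg f a b = intg g a b.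
Proof.
have oo u : bmeas a b u -> intg u a b =
    (\int[@lebesgue_measure R]_(s in `]a, b[) u s)%R.
  move=> /bmeas_integrable hu; rewrite intg.unlock -Rintegral_itv_obnd_cbnd.
    rewrite -Rintegral_itv_bndo_bndc//.
    apply: integrableS hu => // s /=; rewrite !in_itv/= => /andP[h1 h2].
    by rewrite !ltW.
  apply: integrableS hu => // s /=; rewrite !in_itv/= => /andP[h1 ->].
  by rewrite ltW.
move=> /oo -> /oo -> fg; apply: eq_Rintegral => s.
by rewrite inE/= in_itv/= => /fg.
Qed.

Lemma bmeas_cst a b c : bmeas a b (fun=> c).
Proof. by split; [exact: measurable_cst | exists `|c|]. Qed.

Lemma bmeasD a b f g : bmeas a b f -> bmeas a b g -> bmeas a b (fun s => f s + g s).
Proof.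
move=> [mf [K Kf]] [mg [M Mg]]; split; first exact: measurable_funD.
exists (K + M) => s sab; rewrite (le_trans (ler_normD _ _))// lerD// ?Kf ?Mg//.
Qed.

Lemma bmeasM a b f g : bmeas a b f -> bmeas a b g -> bmeas a b (fun s => f s * g s).
Proof.
move=> [mf [K Kf]] [mg [M Mg]]; split; first exact: measurable_funM.
exists (K * M) => s sab; rewrite normrM ler_pM// ?Kf ?Mg//.
Qed.

Lemma bmeasN a b f : bmeas a b f -> bmeas a b (fun s => - f s).
Proof.
move=> [mf [K Kf]]; split; first exact: measurableT_comp.
by exists K => s sab; rewrite normrN Kf.
Qed.

Lemma bmeas_norm a b f : bmeas a b f -> bmeas a b (fun s => `|f s|).
Proof.
move=> [mf [K Kf]]; split; first exact: measurableT_comp.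
by exists K => s sab; rewrite normr_id Kf.
Qed.

Lemma bmeas_ext a b f g : (forall s, a <= s <= b -> f s = g s) ->
  bmeas a b f -> bmeas a b g.
Proof.
move=> fg [mf [K Kf]]; split.
  by apply: eq_measurable_fun mf => s; rewrite inE/= in_itv/= => /fg.
by exists K => s sab; rewrite -fg// Kf.
Qed.

Lemma intg_norm a b f K : a <= b -> measurable_fun `[a, b] f ->
  (forall s, a <= s <= b -> `|f s| <= K) -> `|intg f a b| <= K * (b - a).
Proof.
move=> ab mf Kf; have hf : bmeas a b f by split=> //; exists K.
have : `|intg f a b| <= intg (fun s => `|f s|) a b.
  rewrite intg.unlock; apply: le_normr_Rintegral => //; exact: bmeas_integrable.
move=> /le_trans; apply; rewrite -intg_cst//; apply: le_intg => //.
  exact: bmeas_norm.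
exact: bmeas_cst.
Qed.

Lemma intg_dct a b (fn : nat -> R -> R) f K :
  (forall n, measurable_fun `[a, b] (fn n)) -> measurable_fun `[a, b] f ->
  (forall n s, a <= s <= b -> `|fn n s| <= K) ->
  (forall s, a <= s <= b -> fn n s @[n --> \oo] --> f s) ->
  intg (fn n) a b @[n --> \oo] --> intg f a b.
Proof.
move=> mfn mf Kfn cfn.
have Kf s : a <= s <= b -> `|f s| <= K.
  move=> sab; have /cvg_norm cn := cfn s sab.
  by apply: (cvgr_to_le cn); apply: nearW => n; exact: Kfn.
have ifn n : lebesgue_measure.-integrable `[a, b] (EFin \o fn n).
  by apply: bmeas_integrable; split=> //; exists K => s; exact: Kfn.
have i_f : lebesgue_measure.-integrable `[a, b] (EFin \o f).
  by apply: bmeas_integrable; split=> //; exists K => s; exact: Kf.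
rewrite intg.unlock /Rintegral; apply: fine_cvg; rewrite fineK; last first.
  exact: integrable_fin_num.
have mfn' n : measurable_fun `[a, b] (EFin \o fn n).
  exact/measurable_EFinP.
have mf' : measurable_fun `[a, b] (EFin \o f) by exact/measurable_EFinP.
have cv : \forall s \ae (@lebesgue_measure R), `[a, b]%classic s ->
    (EFin \o fn n) s @[n --> \oo] --> (EFin \o f) s.
  apply: aeW => s /=; rewrite in_itv/= => sab; apply: cvg_EFin; last exact: cfn.
  exact: nearW.
have iK : (@lebesgue_measure R).-integrable `[a, b] (EFin \o (fun=> K)).
  by apply: bmeas_integrable; exact: bmeas_cst.
have dom : \forall s \ae (@lebesgue_measure R), forall n, `[a, b]%classic s ->
    (`|(EFin \o fn n) s| <= (EFin \o (fun=> K)) s)%E.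
  by apply: aeW => s n /=; rewrite in_itv/= => sab; rewrite lee_fin; exact: Kfn.
by have [] := @dominated_convergence _ _ _ (@lebesgue_measure R) _
  (measurable_itv _) _ _ _ mfn' mf' cv iK dom.
Qed.

End BoundedIntegrands.

(** * Absolutely continuous functions *)

Section AbsolutelyContinuous.
Context {R : realType}.
Implicit Types (f g F x y X Y : R -> R) (a b s t c K : R).

(* [X] is the primitive on [a, b] of the bounded measurable [x]; replaces
   almost everywhere differentiability. *)
Definition acd a b X x : Prop :=
  bmeas a b x /\ forall s t, a <= s -> s <= t -> t <= b -> X t - X s = intg x s t.

Lemma acdS a b a' b' X x : a <= a' -> b' <= b -> acd a b X x -> acd a' b' X x.
Proof.
move=> aa bb [hx hX]; split; first exact: bmeasS hx.
by move=> s t as_ st tb; apply: hX => //; [exact: le_trans as_|exact: le_trans bb].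
Qed.

Lemma acd_lip a b X x : acd a b X x -> exists2 K, 0 <= K &
  forall s t, a <= s <= b -> a <= t <= b -> `|X t - X s| <= K * `|t - s|.
Proof.
move=> [[mx [K Kx]] hX]; exists `|K| => //.
have key s t : a <= s -> s <= t -> t <= b -> `|X t - X s| <= `|K| * `|t - s|.
  move=> as_ st tb; rewrite hX// (ger0_norm (_ : 0 <= t - s)) ?subr_ge0//.
  apply: intg_norm => //.
    apply: measurable_funS mx => // u /=; rewrite !in_itv/= => /andP[h1 h2].
    by rewrite (le_trans as_)//= (le_trans h2).
  move=> u /andP[h1 h2]; rewrite (le_trans (Kx _ _)) ?ler_norm//.
  by rewrite (le_trans as_)//= (le_trans h2).
move=> s t /andP[s1 s2] /andP[t1 t2]; have [st|ts] := leP s t; first exact: key.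
by rewrite distrC (distrC t); apply: key => //; exact: ltW.
Qed.

(** Composition with [clamp a b] extends a function on [a, b] to the whole line, so that continuity
    and first or last hitting times need no subspace topology. It also serves as a truncation of
    values. *)
Definition clamp a b t : R := Num.max a (Num.min b t).

Lemma clampK a b t : a <= t <= b -> clamp a b t = t.
Proof. by move=> /andP[h1 h2]; rewrite /clamp min_r// max_r. Qed.

Lemma clamp_in a b t : a <= b -> a <= clamp a b t <= b.
Proof. by move=> ab; rewrite /clamp le_max lexx/= ge_max ab/= ge_min lexx. Qed.

Lemma clamp_lip a b t s : a <= b -> `|clamp a b t - clamp a b s| <= `|t - s|.
Proof.
move=> ab; wlog st : s t / s <= t.
  by move=> h; case/orP: (le_total s t) => /h//; rewrite distrC (distrC t).
rewrite (ger0_norm (_ : 0 <= t - s)) ?subr_ge0// /clamp.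
case: (leP b t) => ?; case: (leP b s) => ?; rewrite ?(max_r ab) ?subrr ?normr0 ?subr_ge0//.
- by case: (leP a s) => ?; rewrite ger0_norm; lra.
- lra.
- by case: (leP a s) => ?; case: (leP a t) => ?; rewrite ger0_norm; lra.
Qed.

Lemma lip_continuous X K : (forall s t, `|X t - X s| <= K * `|t - s|) ->
  continuous X.
Proof.
move=> hX s; apply/cvgrPdist_lt => e e0; near=> t.
have : `|X s - X t| <= (`|K| + 1) * `|s - t|.
  by rewrite (le_trans (hX _ _))// ler_wpM2r// (le_trans (ler_norm K))// lerDl.
move=> /le_lt_trans; apply; rewrite mulrC -ltr_pdivlMr; last first.
  by rewrite ltr_wpDl.
near: t; apply: cvgr_dist_lt; last by rewrite divr_gt0// ltr_wpDl.
exact: cvg_id.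
Unshelve. all: by end_near. Qed.

Lemma acd_clamp_continuous a b X x : a <= b -> acd a b X x ->
  continuous (fun t => X (clamp a b t)).
Proof.
move=> ab /acd_lip[K K0 hK]; apply: (@lip_continuous _ K) => s t.
rewrite (le_trans (hK _ _ _ _)) ?clamp_in// ler_wpM2l//; exact: clamp_lip.
Qed.

Lemma acd_bmeas a b X x : acd a b X x -> bmeas a b X.
Proof.
move=> hX; have [ab|ba] := leP a b; last first.
  split; last by exists 0 => s /andP[h1 h2]; have := le_trans h1 h2; lra.
  by rewrite set_itv_ge; [exact: measurable_fun_set0|rewrite bnd_simp -ltNge].
apply: (@bmeas_ext _ _ _ (fun t => X (clamp a b t))).
  by move=> s sab; rewrite clampK.
split.
  apply: measurable_funTS; apply: continuous_measurable_fun.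
  exact: acd_clamp_continuous hX.
have [K K0 hK] := acd_lip hX; exists (`|X a| + K * (b - a)) => s sab.
rewrite clampK// -[X s](subrK (X a)) addrC (le_trans (ler_normD _ _))// lerD//.
rewrite (le_trans (hK _ _ _ _))// ?lexx// ler_wpM2l//.
by case/andP: sab => h1 h2; rewrite ger0_norm ?subr_ge0// lerB.
Qed.

Lemma first_hit a b X : a <= b -> continuous X -> (exists2 t, a <= t <= b & X t <= 0) ->
  exists T, [/\ a <= T <= b, X T <= 0 & forall t, a <= t -> t < T -> 0 < X t].
Proof.
move=> ab cX [t0 t0I Xt0]; pose S := [set t | a <= t <= b /\ X t <= 0].
have S0 : S !=set0 by exists t0.
have lbS : has_lbound S by exists a => t [/andP[]].
have hS : has_inf S by [].
have aT : a <= inf S by apply: lb_le_inf => // t [/andP[]].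
have Tb : inf S <= b.
  by apply: (le_trans (ge_inf lbS (_ : S t0))) => //; case/andP: t0I.
exists (inf S); split; first by rewrite aT.
- rewrite leNgt; apply/negP => XT.
  have := cX (inf S) => /cvgr_gt /(_ _ XT) /nbhs_ballP[e /= e0 he].
  have [s Ss sT] := inf_adherent e0 hS.
  have sS : inf S <= s by exact: ge_inf.
  have : 0 < X s.
    by apply: he; rewrite /ball/= ler0_norm ?subr_le0//; lra.
  by case: Ss => _ ? ?; lra.
- move=> t at_ tT; rewrite ltNge; apply/negP => Xt.
  have : S t by split => //; rewrite at_ (le_trans (ltW tT)).
  by move/(ge_inf lbS); lra.
Qed.

Lemma last_hit a b X : a <= b -> continuous X -> (exists2 t, a <= t <= b & X t <= 0) ->
  exists T, [/\ a <= T <= b, X T <= 0 & forall t, T < t -> t <= b -> 0 < X t].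
Proof.
move=> ab cX [t0 /andP[at0 t0b] Xt0].
have cX' : continuous (fun t => X (- t)).
  by move=> t; apply: continuous_comp; [exact: opp_continuous|exact: cX].
have [] := @first_hit (- b) (- a) (fun t => X (- t)) _ cX' _.
- by rewrite lerN2.
- by exists (- t0); rewrite ?opprK// !lerN2 t0b.
move=> T [/andP[h1 h2] XT hT]; exists (- T); split => //.
  by apply/andP; split; lra.
by move=> t Tt tb; have := hT (- t); rewrite opprK; apply; lra.
Qed.

(** Cutting [a, b] into n + 1 equal pieces bounds the total increment by K (b - a)^2 / (n + 1), for
    every n. *)
Lemma quad_cst a b X K : a <= b ->
  (forall s t, a <= s -> s <= t -> t <= b -> `|X t - X s| <= K * (t - s) ^+ 2) ->
  X b = X a.
Proof.
move=> ab hX; apply/eqP; rewrite -subr_eq0 -normr_le0.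
have key n : `|X b - X a| <= K * (b - a) ^+ 2 / n.+1%:R.
  pose h := (b - a) / n.+1%:R.
  have h0 : 0 <= h by rewrite divr_ge0// subr_ge0.
  have hn : h * n.+1%:R = b - a by rewrite /h divfK.
  have ind i : (i <= n.+1)%N -> `|X (a + h * i%:R) - X a| <= K * h ^+ 2 * i%:R.
    elim: i => [_|i IH lti]; first by rewrite mulr0 addr0 subrr normr0 mulr0.
    have e : X (a + h * i.+1%:R) - X a =
      (X (a + h * i.+1%:R) - X (a + h * i%:R)) + (X (a + h * i%:R) - X a) by ring.
    rewrite e (_ : K * h ^+ 2 * i.+1%:R = K * h ^+ 2 + K * h ^+ 2 * i%:R); last first.
      by rewrite -natr1; ring.
    rewrite (le_trans (ler_normD _ _))// lerD ?IH 1?ltnW//.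
    rewrite (le_trans (hX _ _ _ _ _))//.
    - by rewrite lerDl mulr_ge0.
    - by rewrite -natr1 mulrDr mulr1 addrA lerDl.
    - have : h * i.+1%:R <= b - a by rewrite -hn ler_wpM2l// ler_nat.
      lra.
    - by rewrite -natr1 (_ : a + h * (i%:R + 1) - (a + h * i%:R) = h)//; ring.
  have := ind n.+1 (leqnn _); rewrite hn (_ : a + (b - a) = b); last by ring.
  move=> /le_trans; apply.
  by rewrite -hn (_ : K * (h * n.+1%:R) ^+ 2 / n.+1%:R = K * h ^+ 2 * n.+1%:R)//; field.
apply/ler_addgt0Pr => e e0; rewrite add0r.
pose M := K * (b - a) ^+ 2.
have [n hn] : exists n : nat, M / e < n%:R.
  exists (Num.bound `|M / e|); rewrite (le_lt_trans (ler_norm _))//.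
  exact: archi_boundP.
rewrite (le_trans (key n))// -/M ler_pdivrMr// mulrC -ler_pdivrMr// ltW//.
by rewrite (lt_le_trans hn)// ler_nat.
Qed.

Lemma acd_cst a b c : acd a b (fun=> c) (fun=> 0).
Proof.
split; first exact: bmeas_cst.
by move=> s t _ st _; rewrite subrr intg_cst// mul0r.
Qed.

Lemma acd_id a b : acd a b (fun t => t) (fun=> 1).
Proof.
split; first exact: bmeas_cst.
by move=> s t _ st _; rewrite intg_cst// mul1r.
Qed.

Lemma acdD a b X Y x y : acd a b X x -> acd a b Y y ->
  acd a b (fun t => X t + Y t) (fun t => x t + y t).
Proof.
move=> [hx hX] [hy hY]; split; first exact: bmeasD.
move=> s t as_ st tb; rewrite intgD; last 2 first.
- exact: bmeasS hx.
- exact: bmeasS hy.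
by rewrite -hX// -hY//; ring.
Qed.

Lemma acdZ a b c X x : acd a b X x -> acd a b (fun t => c * X t) (fun t => c * x t).
Proof.
move=> [hx hX]; split; first exact: bmeasM (bmeas_cst _ _ _) hx.
by move=> s t as_ st tb; rewrite intgZ -?hX ?mulrBr//; exact: bmeasS hx.
Qed.

Lemma acd_ext a b X Y x y : (forall t, a <= t <= b -> X t = Y t) ->
  (forall t, a <= t <= b -> x t = y t) -> acd a b X x -> acd a b Y y.
Proof.
move=> XY xy [hx hX]; split; first exact: bmeas_ext hx.
move=> s t as_ st tb.
have sab : a <= s <= b by rewrite as_ (le_trans st).
have tab : a <= t <= b by rewrite tb (le_trans as_).
rewrite -XY// -XY// hX//; apply: intg_ext => u /andP[su ut]; apply: xy.
by rewrite (le_trans as_ su) (le_trans ut tb).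
Qed.

Lemma acdN a b X x : acd a b X x -> acd a b (fun t => - X t) (fun t => - x t).
Proof.
by move=> /(acdZ (-1)); apply: acd_ext => t _; rewrite mulN1r.
Qed.

Lemma acdB a b X Y x y : acd a b X x -> acd a b Y y ->
  acd a b (fun t => X t - Y t) (fun t => x t - y t).
Proof. by move=> hX hY; exact: acdD hX (acdN hY). Qed.

Lemma acd_primitive a b x : bmeas a b x -> acd a b (intg x a) x.
Proof.
move=> hx; split=> // s t as_ st tb.
have hs : bmeas a t x by exact: bmeasS hx.
by rewrite (intg_cat as_ st hs) addrC addKr.
Qed.

Lemma acd_le a b X x : a <= b -> acd a b X x ->
  (forall t, a <= t <= b -> x t <= 0) -> X b <= X a.
Proof.
move=> ab [hx hX] x0; rewrite -subr_le0 hX//.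
rewrite (le_trans (le_intg hx (bmeas_cst _ _ 0) _))//.
by rewrite intg_cst// mul0r.
Qed.

(** The integral formula has to be checked only up to a quadratic error: the defect
    [Z t - intg z s t] then has quadratic increments, hence is constant. The product and chain rules
    rest on this. *)
Lemma acd_quad a b Z z K : bmeas a b z ->
  (forall s t, a <= s -> s <= t -> t <= b ->
    `|Z t - Z s - intg z s t| <= K * (t - s) ^+ 2) ->
  acd a b Z z.
Proof.
move=> hz hZ; split=> // s t as_ st tb; apply/eqP.
rewrite -subr_eq0 -addrAC subr_eq0; apply/eqP.
have hs : bmeas s b z by exact: bmeasS hz.
suff : Z t - intg z s t = Z s - intg z s s by rewrite (intg_empty _ (lexx s)) subr0.
apply: (@quad_cst s t (fun u => Z u - intg z s u) K) => // u v su uv vt.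
have hu : bmeas s v z by apply: bmeasS hs => //; exact: le_trans vt tb.
rewrite (intg_cat su uv hu).
rewrite (_ : _ - _ - _ = Z v - Z u - intg z u v); last by ring.
by apply: hZ => //; [exact: le_trans su|exact: le_trans tb].
Qed.

Lemma acdM a b X Y x y : acd a b X x -> acd a b Y y ->
  acd a b (fun t => X t * Y t) (fun t => x t * Y t + X t * y t).
Proof.
move=> hX hY; have bX := acd_bmeas hX; have bY := acd_bmeas hY.
have [KX KX0 LX] := acd_lip hX; have [KY KY0 LY] := acd_lip hY.
have [hx eX] := hX; have [hy eY] := hY.
have [_ [Mx Mx1]] := hx; have [_ [My My1]] := hy.
have bz : bmeas a b (fun t => x t * Y t + X t * y t).
  by apply: bmeasD; exact: bmeasM.
apply: (@acd_quad _ _ _ _ (Mx * KY + KX * My)) => // s t as_ st tb.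
have S u : s <= u <= t -> a <= u <= b.
  by move=> /andP[h1 h2]; rewrite (le_trans as_ h1) (le_trans h2 tb).
have sab : a <= s <= b by apply: S; rewrite lexx.
have tab : a <= t <= b by apply: S; rewrite lexx andbT.
have hxs : bmeas s t x by exact: bmeasS hx.
have hys : bmeas s t y by exact: bmeasS hy.
have e : X t * Y t - X s * Y s - intg (fun t => x t * Y t + X t * y t) s t =
    intg (fun u => x u * (Y t - Y u) + (X s - X u) * y u) s t.
  have -> : X t * Y t - X s * Y s = Y t * (X t - X s) + X s * (Y t - Y s) by ring.
  rewrite eX// eY// -intgZ// -intgZ//.
  rewrite -intgD; [|exact: bmeasM (bmeas_cst _ _ _) hxs|
    exact: bmeasM (bmeas_cst _ _ _) hys].
  rewrite -mulN1r -intgZ; last exact: bmeasS bz.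
  rewrite -intgD; last 2 first.
  - by apply: bmeasD; exact: bmeasM (bmeas_cst _ _ _) _.
  - by apply: bmeasM (bmeas_cst _ _ _) _; exact: bmeasS bz.
  by apply: intg_ext => u _; ring.
have bXs := bmeasS as_ tb bX; have bYs := bmeasS as_ tb bY.
rewrite e (_ : _ * (t - s) ^+ 2 = (Mx * KY + KX * My) * (t - s) * (t - s)); last by ring.
apply: intg_norm => //.
  by apply: measurable_funD; apply: measurable_funM; try (by case: hxs); try (by case: hys);
    apply: measurable_funB => //; [case: bYs|case: bXs].
move=> u /[dup] uu /S uab; rewrite (le_trans (ler_normD _ _))// [leRHS]mulrDl lerD//.
  rewrite normrM -mulrA ler_pM// ?Mx1// (le_trans (LY _ _ _ _))// ler_wpM2l//.
  by case/andP: uu => ? ?; rewrite ger0_norm ?subr_ge0// lerB.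
rewrite normrM mulrAC ler_pM// ?My1//.
rewrite (le_trans (LX _ _ _ _))// ler_wpM2l// distrC.
by case/andP: uu => ? ?; rewrite ger0_norm ?subr_ge0// lerB.
Qed.

(** Regularity C^{1,1}: a first-order expansion with a uniform quadratic remainder, of the kind that
    [acd_quad] absorbs. *)
Definition taylor (D : set R) F f : Prop := exists K, forall p q, D p -> D q ->
  `|F q - F p - f p * (q - p)| <= K * (q - p) ^+ 2.

(** Adding the expansions at p and at q cancels the values of F and leaves (f q - f p) (q - p). *)
Lemma taylor_lip (D : set R) F f : taylor D F f -> exists2 K, 0 <= K &
  forall p q, D p -> D q -> `|f q - f p| <= K * `|q - p|.
Proof.
move=> [K hK]; exists (`|K| *+ 2) => [|p q Dp Dq]; first by rewrite mulrn_wge0.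
have [->|pq] := eqVneq p q; first by rewrite !subrr !normr0 mulr0.
have d0 : 0 < `|q - p| by rewrite normr_gt0 subr_eq0 eq_sym.
rewrite -(ler_pM2r d0) -normrM.
have K1 z : K * z ^+ 2 <= `|K| * z ^+ 2.
  by rewrite ler_wpM2r ?sqr_ge0// ler_norm.
have h1 := le_trans (hK p q Dp Dq) (K1 _).
have h2 := le_trans (hK q p Dq Dp) (K1 _).
have -> : (f q - f p) * (q - p) =
  (F q - F p - f p * (q - p)) + (F p - F q - f q * (p - q)) by ring.
have -> : `|K| *+ 2 * `|q - p| * `|q - p| = `|K| * (q - p) ^+ 2 + `|K| * (p - q) ^+ 2.
  rewrite -(real_normK (num_real (q - p))) -(real_normK (num_real (p - q))).
  by rewrite (distrC p); ring.
by rewrite (le_trans (ler_normD _ _))// lerD.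
Qed.

Lemma acd_comp (D : set R) a b X x F f : taylor D F f ->
  (forall t, a <= t <= b -> D (X t)) -> acd a b X x ->
  acd a b (fun t => F (X t)) (fun t => f (X t) * x t).
Proof.
move=> hT hD hX; have [L L0 hL] := taylor_lip hT; have [K hK] := hT.
have [M M0 hM] := acd_lip hX; have [hx eX] := hX; have [_ [N hN]] := hx.
have lipf s t : a <= s <= b -> a <= t <= b ->
    `|f (X t) - f (X s)| <= L * M * `|t - s|.
  move=> sab tab; rewrite (le_trans (hL _ _ _ _)) -?mulrA ?ler_wpM2l//; auto.
have [ab|ba] := leP a b; last first.
  split; last by move=> s t s1 s2 s3; have := le_trans s1 (le_trans s2 s3); lra.
  split; last by exists 0 => s /andP[s1 s2]; have := le_trans s1 s2; lra.
  by rewrite set_itv_ge; [exact: measurable_fun_set0|rewrite bnd_simp -ltNge].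
have bf : bmeas a b (fun t => f (X t)).
  apply: (@bmeas_ext _ _ _ (fun t => f (X (clamp a b t)))).
    by move=> s sab; rewrite clampK.
  split.
    apply: measurable_funTS; apply: continuous_measurable_fun.
    apply: (@lip_continuous _ (L * M)) => s t.
    rewrite (le_trans (lipf _ _ _ _)) ?clamp_in// ler_wpM2l ?mulr_ge0//.
    exact: clamp_lip.
  exists (`|f (X a)| + L * M * (b - a)) => s sab.
  rewrite clampK// -[f (X s)](subrK (f (X a))) addrC (le_trans (ler_normD _ _))//.
  rewrite lerD// (le_trans (lipf _ _ _ _)) ?lexx// ler_wpM2l ?mulr_ge0//.
  by case/andP: sab => h1 h2; rewrite ger0_norm ?subr_ge0// lerB.
have bz : bmeas a b (fun t => f (X t) * x t) by exact: bmeasM.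
apply: (@acd_quad _ _ _ _ (`|K| * M ^+ 2 + L * M * N)) => // s t as_ st tb.
have S u : s <= u <= t -> a <= u <= b.
  by move=> /andP[h1 h2]; rewrite (le_trans as_ h1) (le_trans h2 tb).
have sab : a <= s <= b by apply: S; rewrite lexx.
have tab : a <= t <= b by apply: S; rewrite lexx andbT.
have hxs : bmeas s t x by exact: bmeasS hx.
have bfs : bmeas s t (fun t => f (X t)) by exact: bmeasS bf.
have e : F (X t) - F (X s) - intg (fun t => f (X t) * x t) s t =
    (F (X t) - F (X s) - f (X s) * (X t - X s)) +
    intg (fun u => (f (X s) - f (X u)) * x u) s t.
  rewrite (@intg_ext _ s t (fun u => (f (X s) - f (X u)) * x u)
    (fun u => f (X s) * x u + -1 * (f (X u) * x u))); last by move=> u _; ring.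
  rewrite intgD.
  - rewrite (intgZ (f (X s)) hxs) (intgZ (-1) (bmeasM bfs hxs)) -eX//; ring.
  - exact: bmeasM (bmeas_cst _ _ _) hxs.
  - exact: bmeasM (bmeas_cst _ _ _) (bmeasM bfs hxs).
rewrite e (le_trans (ler_normD _ _))// mulrDl lerD//.
  rewrite (le_trans (hK _ _ (hD _ sab) (hD _ tab)))// -mulrA.
  rewrite (le_trans (_ : _ <= `|K| * (X t - X s) ^+ 2))//.
    by rewrite ler_wpM2r ?sqr_ge0// ler_norm.
  rewrite ler_wpM2l// -real_normK ?num_real// -exprMn ler_sqr ?nnegrE ?mulr_ge0 ?subr_ge0//.
  by rewrite (le_trans (hM _ _ _ _))// ger0_norm// subr_ge0.
rewrite (_ : L * M * N * (t - s) ^+ 2 = L * M * (t - s) * N * (t - s)); last by ring.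
apply: intg_norm => //.
  by apply: measurable_funM; [apply: measurable_funB => //; case: bfs|case: hxs].
move=> u /[dup] uu /S uab; rewrite normrM ler_pM// ?hN//.
rewrite distrC (le_trans (lipf _ _ _ _))// ler_wpM2l ?mulr_ge0//.
by case/andP: uu => ? ?; rewrite ger0_norm ?subr_ge0// lerB.
Qed.

Lemma taylor_derive (m M K : R) F f :
  (forall p, m < p < M -> is_derive p 1 F (f p)) ->
  {within `[m, M], continuous F} ->
  (forall p q, m <= p <= M -> m <= q <= M -> `|f q - f p| <= K * `|q - p|) ->
  taylor `[m, M] F f.
Proof.
move=> dF cF lf; exists K => p q /=; rewrite !in_itv/= => pI qI.
have [->|pq] := eqVneq p q; first by rewrite !subrr mulr0 subr0 normr0 expr0n mulr0.
have key (x y : R) : m <= x <= M -> m <= y <= M -> x < y ->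
    exists2 c, x < c < y & F y - F x = f c * (y - x).
  move=> /andP[mx xM] /andP[my yM] xy.
  have [] := @MVT R F f x y xy.
  - move=> z; rewrite in_itv/= => /andP[xz zy]; apply: dF.
    by rewrite (le_lt_trans mx xz) (lt_le_trans zy yM).
  - apply: continuous_subspaceW cF => z /=; rewrite !in_itv/= => /andP[xz zy].
    by rewrite (le_trans mx xz) (le_trans zy yM).
  - by move=> c; rewrite in_itv/= => xcy e; exists c.
have [c [cp cI] e] : exists2 c, `|c - p| <= `|q - p| /\ m <= c <= M &
    F q - F p = f c * (q - p).
  have [pq'|qp|/eqP] := ltgtP p q; last by rewrite (negbTE pq).
    have [c /andP[pc cq] e] := key _ _ pI qI pq'; exists c => //; split.
      by rewrite !gtr0_norm ?subr_gt0// lerB// ltW.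
    by case/andP: pI qI => mp _ /andP[_ qM]; rewrite (le_trans mp (ltW pc)) (le_trans (ltW cq)).
  have [c /andP[qc cp] e] := key _ _ qI pI qp; exists c.
    split; first by rewrite !ltr0_norm ?subr_lt0// lerN2 lerB// ltW.
    by case/andP: qI pI => mq _ /andP[_ pM]; rewrite (le_trans mq (ltW qc)) (le_trans (ltW cp)).
  by rewrite -(opprB (F p)) e; ring.
rewrite e -mulrBl normrM (_ : K * (q - p) ^+ 2 = K * `|q - p| * `|q - p|); last first.
  by rewrite -mulrA -expr2 real_normK// num_real.
rewrite ler_wpM2r// (le_trans (lf _ _ pI cI))// ler_wpM2l//.
have : 0 <= K * `|q - p| by exact: le_trans (lf _ _ pI qI).
by rewrite pmulr_lge0// normr_gt0 subr_eq0 eq_sym.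
Qed.

End AbsolutelyContinuous.

(** * Chain rules for the elementary functions and for the absolute value *)

Section Calculus.
Context {R : realType}.

Lemma cvg_dist0 (u : nat -> R) (l : R) (v : nat -> R) :
  (\forall n \near \oo, `|u n - l| <= v n) -> v n @[n --> \oo] --> (0 : R) ->
  u n @[n --> \oo] --> l.
Proof.
move=> uv v0; apply: (@squeeze_cvgr _ _ _ _ (fun n => l - v n) (fun n => l + v n)).
- by apply: filterS uv => n; rewrite ler_norml => /andP[h1 h2]; apply/andP; split; lra.
- by rewrite -{2}(subr0 l); apply: cvgB v0; exact: cvg_cst.
- by rewrite -{2}(addr0 l); apply: cvgD v0; exact: cvg_cst.
Qed.

Implicit Types (f F x y X Y S : R -> R) (a b s t c K m M : R).

Lemma derive_lip m M K F f : (forall p, m <= p <= M -> is_derive p 1 F (f p)) ->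
  (forall p, m <= p <= M -> `|f p| <= K) ->
  forall p q, m <= p <= M -> m <= q <= M -> `|F q - F p| <= K * `|q - p|.
Proof.
move=> dF fK p q; wlog pq : p q / p <= q.
  by move=> h pI qI; case/orP: (le_total p q) => /h; [|rewrite distrC (distrC q)]; apply.
move=> /andP[mp _] /andP[_ qM].
have [] := @MVT_segment R F f p q pq.
- move=> z; rewrite in_itv/= => /andP[pz zq]; apply: dF.
  by rewrite (le_trans mp (ltW pz)) (le_trans (ltW zq)).
- apply: derivable_within_continuous => z; rewrite in_itv/= => /andP[pz zq].
  by have [] : is_derive z 1 F (f z) by apply: dF; rewrite (le_trans mp pz) (le_trans zq).
move=> c; rewrite in_itv/= => /andP[pc cq] ->.
rewrite normrM ler_wpM2r// fK//.
by rewrite (le_trans mp pc) (le_trans cq).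
Qed.

Lemma taylor_C2 m M K F f g : (forall p, m <= p <= M -> is_derive p 1 F (f p)) ->
  (forall p, m <= p <= M -> is_derive p 1 f (g p)) ->
  (forall p, m <= p <= M -> `|g p| <= K) -> taylor `[m, M] F f.
Proof.
move=> dF df gK; apply: (@taylor_derive _ m M K).
- by move=> p /andP[/ltW mp /ltW pM]; apply: dF; rewrite mp.
- apply: derivable_within_continuous => z; rewrite in_itv/= => zI.
  by have [] : is_derive z 1 F (f z) by exact: dF.
- exact: derive_lip df gK.
Qed.

Lemma acd_comp_bounded a b X x F f : (forall N, taylor `[- N, N] F f) ->
  acd a b X x -> acd a b (fun t => F (X t)) (fun t => f (X t) * x t).
Proof.
move=> hT hX; have [_ [N hN]] := acd_bmeas hX.
apply: acd_comp (hT N) _ hX => t /hN; rewrite /= in_itv/=.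
by rewrite ler_norml.
Qed.

Lemma acd_sin a b X x : acd a b X x ->
  acd a b (fun t => sin (X t)) (fun t => cos (X t) * x t).
Proof.
apply: (@acd_comp_bounded _ _ _ _ (@sin R) (@cos R)) => N.
apply: (@taylor_C2 _ _ 1 _ _ (fun p => - sin p)).
by move=> p _; rewrite normrN sin_max.
Qed.

Lemma acd_cos a b X x : acd a b X x ->
  acd a b (fun t => cos (X t)) (fun t => - sin (X t) * x t).
Proof.
apply: (@acd_comp_bounded _ _ _ _ (@cos R) (fun p => - sin p)) => N.
apply: (@taylor_C2 _ _ 1 _ _ (fun p => - cos p)).
by move=> p _; rewrite normrN cos_max.
Qed.

Lemma acd_exp a b X x : acd a b X x ->
  acd a b (fun t => expR (X t)) (fun t => expR (X t) * x t).
Proof.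
apply: (@acd_comp_bounded _ _ _ _ (@expR R) (@expR R)) => N.
apply: (@taylor_C2 _ _ (expR N) _ _ (@expR R)).
by move=> p /andP[_ pN]; rewrite ger0_norm ?expR_ge0// ler_expR.
Qed.

Lemma taylor_inv m : 0 < m ->
  taylor [set p | m <= p] (fun p : R => p^-1) (fun p => - p ^- 2).
Proof.
move=> m0; exists (m ^- 3) => p q /= mp mq.
have p0 := lt_le_trans m0 mp; have q0 := lt_le_trans m0 mq.
have -> : q^-1 - p^-1 - - p ^- 2 * (q - p) = (q - p) ^+ 2 * (p ^- 2 * q^-1).
  by field; rewrite !gt_eqF.
rewrite normrM ger0_norm ?sqr_ge0// mulrC ler_wpM2r ?sqr_ge0//.
rewrite ger0_norm ?mulr_ge0 ?invr_ge0 ?exprn_ge0 ?(ltW p0) ?(ltW q0)//.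
rewrite -invfM lef_pV2 ?posrE ?mulr_gt0 ?exprn_gt0//.
by rewrite exprSr ler_pM ?exprn_ge0 ?(ltW m0)// ler_pXn2r// nnegrE ltW.
Qed.

Lemma acd_inv a b m X x : 0 < m -> (forall t, a <= t <= b -> m <= X t) ->
  acd a b X x -> acd a b (fun t => (X t)^-1) (fun t => - (X t) ^- 2 * x t).
Proof.
move=> m0 mX; apply: (@acd_comp R _ _ _ _ _ (fun p : R => p^-1) (fun p => - p ^- 2)).
  exact: taylor_inv m0.
exact: mX.
Qed.

Lemma taylor_sqrt m : 0 < m ->
  taylor [set p | m <= p] (@Num.sqrt R) (fun p => (2 * Num.sqrt p)^-1).
Proof.
move=> m0; exists ((2 * Num.sqrt m * m)^-1) => p q /= mp mq.
have p0 := lt_le_trans m0 mp; have q0 := lt_le_trans m0 mq.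
have sm : 0 < Num.sqrt m by rewrite sqrtr_gt0.
have A0 : 0 < Num.sqrt p by rewrite sqrtr_gt0.
have B0 : 0 < Num.sqrt q by rewrite sqrtr_gt0.
have smp : Num.sqrt m <= Num.sqrt p by rewrite ler_wsqrtr.
have A2 := sqr_sqrtr (ltW p0); have B2 := sqr_sqrtr (ltW q0).
move: A0 B0 A2 B2 smp; set A := Num.sqrt p; set B := Num.sqrt q => A0 B0 A2 B2 smp.
have -> : B - A - (2 * A)^-1 * (q - p) =
    - ((q - p) ^+ 2 * (2 * A * (A + B) ^+ 2)^-1).
  by rewrite -A2 -B2; field; rewrite !gt_eqF// addr_gt0.
rewrite normrN normrM ger0_norm ?sqr_ge0// mulrC ler_wpM2r ?sqr_ge0//.
have AB : 0 < 2 * A * (A + B) ^+ 2 by rewrite mulr_gt0 ?exprn_gt0 ?mulr_gt0 ?addr_gt0.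
have S0 : 0 < 2 * Num.sqrt m * m by rewrite mulr_gt0// mulr_gt0.
rewrite ger0_norm ?invr_ge0 ?(ltW AB)// lef_pV2//.
have h1 : 2 * Num.sqrt m <= 2 * A by rewrite ler_wpM2l.
have h2 : m <= (A + B) ^+ 2.
  rewrite (le_trans mp)// -A2 ler_pXn2r ?nnegrE ?addr_ge0 ?(ltW A0) ?(ltW B0)//.
  by rewrite lerDl ltW.
by apply: ler_pM => //; exact: ltW.
Qed.

Lemma acd_sqrt a b m X x : 0 < m -> (forall t, a <= t <= b -> m <= X t) ->
  acd a b X x ->
  acd a b (fun t => Num.sqrt (X t)) (fun t => (2 * Num.sqrt (X t))^-1 * x t).
Proof.
move=> m0 mX; apply: (@acd_comp R _ _ _ _ _ (@Num.sqrt R)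
  (fun p => (2 * Num.sqrt p)^-1)).
  exact: taylor_sqrt m0.
exact: mX.
Qed.

(** The value at 0 is 1 and not 0. This makes the function right continuous, as the Picard iteration
    from above requires, gives [sgr z * sgr z = 1] without exception, and decides which way M runs
    from y = 0. *)
Definition sgr (z : R) : R := if 0 <= z then 1 else -1.

Let sq (d z : R) := Num.sqrt (z ^+ 2 + d ^+ 2).

Let sq_gt0 d z : 0 < d -> 0 < sq d z.
Proof. by move=> d0; rewrite sqrtr_gt0 ltr_wpDl ?sqr_ge0// exprn_gt0. Qed.

Let sq2 d z : sq d z ^+ 2 = z ^+ 2 + d ^+ 2.
Proof. by rewrite sqr_sqrtr// addr_ge0 ?sqr_ge0. Qed.

Let sq_ge d z : `|z| <= sq d z.
Proof. by rewrite -sqrtr_sqr ler_sqrt ?addr_ge0 ?sqr_ge0// lerDl sqr_ge0. Qed.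

Let sq_le d z : 0 <= d -> sq d z <= `|z| + d.
Proof.
move=> d0; rewrite -(@ger0_norm _ (`|z| + d)) ?addr_ge0// -sqrtr_sqr.
rewrite ler_sqrt ?sqr_ge0// sqrrD real_normK ?num_real//.
by rewrite lerD2r lerDl mulrn_wge0// mulr_ge0.
Qed.

Let sq_taylor d e : 0 < d ->
  taylor setT (fun z => sq d (z + e)) (fun z => (z + e) / sq d (z + e)).
Proof.
move=> d0; exists (d^-1) => p0 q0 _ _.
have -> : q0 - p0 = (q0 + e) - (p0 + e) by ring.
move: (q0 + e) (p0 + e) => {p0 q0} q p.
have A0 := sq_gt0 p d0; have B0 := sq_gt0 q d0.
have A2 := sq2 d p; have B2 := sq2 d q.
have Ad : d <= sq d p.
  by rewrite -[leLHS](ger0_norm (ltW d0)) -sqrtr_sqr ler_sqrt ?addr_ge0 ?sqr_ge0//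
    lerDr sqr_ge0.
set A := sq d p in A0 A2 Ad *; set B := sq d q in B0 B2 *.
have -> : B - A - p / A * (q - p) = (A * B - d ^+ 2 - p * q) * A^-1.
  rewrite -[X in (_ - X - _) * _]/(d ^+ 2) (_ : d ^+ 2 = A ^+ 2 - p ^+ 2); last by rewrite A2; ring.
  by field; rewrite gt_eqF.
have e1 : A * B - d ^+ 2 - p * q = ((q - p) ^+ 2 - (B - A) ^+ 2) / 2.
  rewrite (_ : (B - A) ^+ 2 = A ^+ 2 + B ^+ 2 - 2 * (A * B)); last by ring.
  by rewrite A2 B2; field.
have e2 : 0 <= A * B - d ^+ 2 - p * q.
  have : (d ^+ 2 + p * q) ^+ 2 <= (A * B) ^+ 2.
    rewrite exprMn A2 B2 -subr_ge0.
    rewrite (_ : _ - _ = d ^+ 2 * (q - p) ^+ 2); last by ring.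
    by rewrite mulr_ge0 ?sqr_ge0.
  rewrite -ler_sqrt ?sqr_ge0// !sqrtr_sqr (ger0_norm (mulr_ge0 (ltW A0) (ltW B0))).
  by move=> /(le_trans (ler_norm _)); lra.
rewrite normrM (ger0_norm e2) ger0_norm ?invr_ge0 ?(ltW A0)// mulrC.
apply: ler_pM => //; first by rewrite invr_ge0 ltW.
  by rewrite lef_pV2 ?posrE.
by rewrite e1; have := sqr_ge0 (B - A); have := sqr_ge0 (q - p); lra.
Qed.

Let sq_deriv_le d z : 0 < d -> `|z / sq d z| <= 1.
Proof.
move=> d0; have s0 := sq_gt0 z d0.
by rewrite normrM normfV (gtr0_norm s0) ler_pdivrMr// mul1r sq_ge.
Qed.

Let sq_deriv_near d z : 0 < d -> z != 0 -> `|z / sq d z - z / `|z| | <= d / `|z|.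
Proof.
move=> d0 z0; have s0 := sq_gt0 z d0; have n0 : 0 < `|z| by rewrite normr_gt0.
have -> : z / sq d z - z / `|z| = z / `|z| * ((`|z| - sq d z) / sq d z).
  by field; rewrite normr_eq0 z0 gt_eqF.
rewrite normrM normrM normfV normr_id divff ?gt_eqF// mul1r normrM normfV.
rewrite (gtr0_norm s0) ler_pM ?invr_ge0 ?(ltW s0)//.
  rewrite ler0_norm ?subr_le0 ?sq_ge// opprB lerBlDl; exact/sq_le/ltW.
by rewrite lef_pV2 ?posrE// sq_ge.
Qed.

(* Smoothings of the absolute value whose derivatives converge everywhere to
   [sgr], so that nothing has to be said about the zeros of [S]. *)
Lemma acd_abs a b S x : acd a b S x ->
  acd a b (fun t => `|S t|) (fun t => sgr (S t) * x t).
Proof.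
move=> hS; have [hs _] := hS.
pose e n : R := n.+1%:R^-1; pose d n : R := e n * e n.
have e0 n : 0 < e n by rewrite invr_gt0.
have d0 n : 0 < d n by rewrite mulr_gt0.
have ce : e n @[n --> \oo] --> (0 : R) by exact: cvg_harmonic.
have cd : d n @[n --> \oo] --> (0 : R) by rewrite -(mulr0 0); exact: cvgM.
(* The shift [e n] dominates the smoothing parameter [d n], its square. Hence at z = 0 too the
   derivative tends to 1, the value of [sgr] there. *)
pose F n z := sq (d n) (z + e n).
pose f n z := (z + e n) / sq (d n) (z + e n).
have hF n : acd a b (fun t => F n (S t)) (fun t => f n (S t) * x t).
  exact: acd_comp (sq_taylor _ (d0 n)) _ hS.
have cF z : F n z @[n --> \oo] --> `|z|.
  apply: (@squeeze_cvgr _ _ _ _ (fun n => `|z + e n|) (fun n => `|z + e n| + d n)).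
  - by apply: nearW => n; rewrite sq_ge sq_le// ltW.
  - by rewrite -{2}(addr0 z); apply: cvg_norm; apply: cvgD ce; exact: cvg_cst.
  - rewrite -(addr0 `|z|) -{2}(addr0 z).
    by apply: cvgD cd; apply: cvg_norm; apply: cvgD ce; exact: cvg_cst.
have cf z : f n z @[n --> \oo] --> sgr z.
  rewrite /sgr; case: ifPn => [z0|]; last rewrite -ltNge => z0.
  - apply: (@cvg_dist0 _ _ e) ce; apply: nearW => n.
    have ze : 0 < z + e n by rewrite ltr_wpDl.
    have := sq_deriv_near (d0 n) (lt0r_neq0 ze).
    rewrite (gtr0_norm ze) divff ?gt_eqF// => /le_trans; apply.
    by rewrite ler_pdivrMr// /d ler_wpM2l ?(ltW (e0 n))// lerDr.
  - apply: (@cvg_dist0 _ _ (fun n => d n / (- z / 2))).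
      near=> n; have zn : e n < - z / 2.
        by near: n; apply: (cvgr_lt _ ce); rewrite divr_gt0// oppr_gt0.
      have ze : z + e n < 0 by lra.
      have := sq_deriv_near (d0 n) (ltr0_neq0 ze).
      have e1 : (z + e n) / - (z + e n) = -1 by rewrite invrN mulrN divff ?lt_eqF.
      rewrite (ltr0_norm ze) e1 => /le_trans; apply.
      rewrite ler_wpM2l ?(ltW (d0 n))// lef_pV2 ?posrE ?oppr_gt0 ?divr_gt0 ?oppr_gt0//.
      lra.
    by rewrite -(mul0r (- z / 2)^-1); apply: cvgMl.
have fK n z : `|f n z| <= 1 by exact: sq_deriv_le.
have [ms [N hN]] := hs.
have fnm n : measurable_fun `[a, b] (fun t => f n (S t) * x t) by have [[]] := hF n.
have msg : measurable_fun `[a, b] (fun t => sgr (S t) * x t).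
  apply: (@measurable_fun_cvg _ _ _ _ (fun n t => f n (S t) * x t)) => // t _.
  by apply: cvgMl; exact: cf.
have bN u : `|u| <= 1 -> forall t, a <= t <= b -> `|u * x t| <= N.
  by move=> u1 t /hN tN; rewrite normrM -(mul1r N) ler_pM.
have sg1 z : `|sgr z| <= 1 by rewrite /sgr; case: ifP; rewrite ?normrN normr1.
split; first by split=> //; exists N => t; exact: bN.
move=> p q ap pq qb.
have c1 : (fun n => F n (S q) - F n (S p)) @ \oo --> `|S q| - `|S p|.
  by apply: cvgB; exact: cF.
rewrite -(cvg_lim (@Rhausdorff R) c1).
have -> : (fun n => F n (S q) - F n (S p)) =
    (fun n => intg (fun t => f n (S t) * x t) p q).
  by apply/funext => n; have [_] := hF n; apply.
apply: (cvg_lim (@Rhausdorff R)).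
have sub : `[p, q] `<=` `[a, b].
  by move=> t /=; rewrite !in_itv/= => /andP[pt tq]; rewrite (le_trans ap)//= (le_trans tq).
apply: (@intg_dct _ _ _ _ _ N).
- by move=> n; exact: measurable_funS (fnm n).
- exact: measurable_funS msg.
- by move=> n t /andP[pt tq]; apply: bN => //; rewrite (le_trans ap)//= (le_trans tq).
- by move=> t _; apply: cvgMl; exact: cf.
Unshelve. all: by end_near. Qed.

End Calculus.

(** * Maximal solutions of differential equations *)

Section MaximalSolution.
Context {R : realType}.
Implicit Types (L : R -> R) (G : R -> R -> R) (l b K : R).

Definition wexp L l (t : R) : R := expR (intg L l t).

(* Picard iteration from above for [v' = G s v], [v l = 0]; the integrating
   factor makes it monotone when only [G s v + L s * v] is nondecreasing in [v]. *)
Fixpoint picard K L G l (n : nat) (t : R) : R :=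
  if n is m.+1 then
    (wexp L l t)^-1 *
    intg (fun s => wexp L l s *
      (G s (picard K L G l m s) + L s * picard K L G l m s)) l t
  else K * (t - l).

Definition maxsol K L G l (t : R) : R :=
  lim (picard K L G l n t @[n --> \oo]).

Lemma picard_ext K L L' G G' l t n :
  (forall s, l <= s <= t -> L s = L' s) ->
  (forall s y, l <= s <= t -> G s y = G' s y) ->
  forall s, l <= s <= t -> picard K L G l n s = picard K L' G' l n s.
Proof.
move=> LL GG.
have we s : l <= s <= t -> wexp L l s = wexp L' l s.
  move=> /andP[ls st]; rewrite /wexp; congr expR; apply: intg_ext => u /andP[lu us].
  by apply: LL; rewrite lu (le_trans us).
elim: n => // n IH s /[dup] sI /andP[ls st] /=; rewrite we//; congr (_ * _).
apply: intg_ext => u /andP[lu us].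
have uI : l <= u <= t by rewrite lu (le_trans us).
by rewrite we// IH// GG// LL.
Qed.

Lemma maxsol_ext K L L' G G' l t :
  (forall s, l <= s <= t -> L s = L' s) ->
  (forall s y, l <= s <= t -> G s y = G' s y) ->
  forall s, l <= s <= t -> maxsol K L G l s = maxsol K L' G' l s.
Proof.
move=> LL GG s sI; rewrite /maxsol.
suff -> : picard K L G l ^~ s = picard K L' G' l ^~ s by [].
by apply/funext => n; exact: (picard_ext _ _ LL GG sI).
Qed.

(** The iterates decrease to their limit, so continuity of [G] from the right suffices; and
    [L s * y] only has to compensate the decrease of [G] in y, so that upward jumps are allowed. *)
Record picard_hyp K L G l b : Prop := PicardHyp {
  ph_le : l <= b;
  ph_K : 0 <= K;
  ph_L : bmeas l b L;
  ph_L0 : forall s, l <= s <= b -> 0 <= L s;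
  ph_bnd : forall s y, l <= s <= b -> `|G s y| <= K;
  ph_mono : forall s y z, l <= s <= b -> y <= z -> G s y + L s * y <= G s z + L s * z;
  ph_rc : forall s y (u : nat -> R), l <= s <= b -> (forall n, y <= u n) ->
    u n @[n --> \oo] --> y -> G s (u n) @[n --> \oo] --> G s y;
  ph_meas : forall v : R -> R, measurable_fun `[l, b] v ->
    measurable_fun `[l, b] (fun s => G s (v s)) }.

Section Solve.
Variables (K : R) (L : R -> R) (G : R -> R -> R) (l b : R).
Hypothesis H : picard_hyp K L G l b.
Let e := wexp L l.
Let p := picard K L G l.

Let e_gt0 t : 0 < e t. Proof. exact: expR_gt0. Qed.

Let Lacd : acd l b (intg L l) L.
Proof. exact: acd_primitive (ph_L H). Qed.

Let eacd : acd l b e (fun t => e t * L t).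
Proof. exact: acd_exp Lacd. Qed.

Let eb : bmeas l b e. Proof. exact: acd_bmeas eacd. Qed.

(** The initial iterate K (t - l) is a fixed point of the step in which [G] is replaced by its bound
    [K]. Therefore the first step goes down and every iterate stays between -K (t - l) and K (t -
    l). *)
Let linb t : l <= t <= b ->
  intg (fun s => e s * (K + L s * (K * (s - l)))) l t = e t * (K * (t - l)).
Proof.
move=> /andP[lt tb].
have h : acd l b (fun s => e s * (K * (s - l)))
    (fun s => e s * (K + L s * (K * (s - l)))).
  have h1 := acdM eacd (acdZ K (acdB (acd_id l b) (acd_cst l b l))).
  by apply: acd_ext h1 => // s _ /=; ring.
have [_ /(_ l t)] := h; rewrite lexx lt tb => <- //.
by rewrite subrr !mulr0 subr0.
Qed.

Let linbm : bmeas l b (fun s => e s * (K + L s * (K * (s - l)))).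
Proof.
apply: bmeasM eb _; apply: bmeasD (bmeas_cst _ _ _) _; apply: bmeasM (ph_L H) _.
by apply: acd_bmeas (acdZ K (acdB (acd_id l b) (acd_cst l b l))).
Qed.

Let gb (v : R -> R) : bmeas l b v -> bmeas l b (fun s => e s * (G s (v s) + L s * v s)).
Proof.
move=> hv; apply: bmeasM eb _; apply: bmeasD; last exact: bmeasM (ph_L H) hv.
split; first by apply: ph_meas H _ _; case: hv.
by exists K => s sI; exact: ph_bnd H _ _ sI.
Qed.

Let stepb (v : R -> R) : bmeas l b v ->
  (forall t, l <= t <= b -> `|v t| <= K * (t - l)) ->
  forall t, l <= t <= b ->
    `|(e t)^-1 * intg (fun s => e s * (G s (v s) + L s * v s)) l t| <= K * (t - l).
Proof.
move=> hv vK t /[dup] tI /andP[lt tb].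
rewrite normrM normfV (gtr0_norm (e_gt0 t)) mulrC ler_pdivrMr// mulrC -linb//.
have S s : l <= s <= t -> l <= s <= b.
  by move=> /andP[-> st]; rewrite (le_trans st).
have pt s : l <= s <= t ->
    `|e s * (G s (v s) + L s * v s)| <= e s * (K + L s * (K * (s - l))).
  move=> /S sI; rewrite normrM (gtr0_norm (e_gt0 s)) ler_wpM2l ?(ltW (e_gt0 s))//.
  rewrite (le_trans (ler_normD _ _))// lerD ?(ph_bnd H)// normrM.
  by rewrite (ger0_norm (ph_L0 H sI)) ler_wpM2l ?(ph_L0 H)// vK.
have b1 : bmeas l t (fun s => e s * (G s (v s) + L s * v s)).
  exact: bmeasS (lexx _) tb (gb hv).
have b2 := bmeasS (lexx _) tb linbm.
rewrite ler_norml; apply/andP; split.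
  rewrite -mulN1r -intgZ//; apply: le_intg => //.
    exact: bmeasM (bmeas_cst _ _ _) b2.
  by move=> s /pt; rewrite ler_norml mulN1r => /andP[].
by apply: le_intg => // s /pt; rewrite ler_norml => /andP[].
Qed.

Let stepacd (v : R -> R) : bmeas l b v ->
  bmeas l b (fun t => (e t)^-1 * intg (fun s => e s * (G s (v s) + L s * v s)) l t).
Proof.
move=> hv; apply: bmeasM; last exact: acd_bmeas (acd_primitive (gb hv)).
have : acd l b (fun t => expR (- intg L l t)) (fun t => expR (- intg L l t) * - L t).
  exact: acd_exp (acdN Lacd).
by move=> /acd_bmeas; apply: bmeas_ext => s _; rewrite expRN.
Qed.

Let p_spec n : bmeas l b (p n) /\ forall t, l <= t <= b -> `|p n t| <= K * (t - l).
Proof.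
elim: n => [|n [IH1 IH2]]; last first.
  by split; [exact: stepacd IH1|exact: stepb IH1 IH2].
split; first exact: acd_bmeas (acdZ K (acdB (acd_id l b) (acd_cst l b l))).
by move=> t /andP[lt _]; rewrite /p/= ger0_norm// mulr_ge0 ?(ph_K H)// subr_ge0.
Qed.

Let p_dec n t : l <= t <= b -> p n.+1 t <= p n t.
Proof.
elim: n t => [|n IH] t tI.
  have [_ /(_ _ tI)] := p_spec 1; rewrite /p => /(le_trans (ler_norm _)).
  by move=> /le_trans; apply.
rewrite /p /= -/p; rewrite ler_wpM2l ?invr_ge0 ?(ltW (e_gt0 t))//.
case/andP: tI => lt tb.
have S s : l <= s <= t -> l <= s <= b.
  by move=> /andP[-> st]; rewrite (le_trans st).
apply: le_intg.
- exact: bmeasS (lexx _) tb (gb (p_spec n.+1).1).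
- exact: bmeasS (lexx _) tb (gb (p_spec n).1).
- move=> s /S sI; rewrite ler_wpM2l ?(ltW (e_gt0 s))//.
  apply: (ph_mono H sI).
  exact: (IH _ sI).
Qed.

Let v := maxsol K L G l.

Let p_cvg t : l <= t <= b -> p n t @[n --> \oo] --> v t.
Proof.
move=> tI; apply: nonincreasing_is_cvgn.
  by apply/nonincreasing_seqP => n; exact: p_dec.
exists (- (K * (t - l))) => _ [n _ <-].
by have [_ /(_ _ tI)] := p_spec n; rewrite ler_norml => /andP[].
Qed.

Let v_le t n : l <= t <= b -> v t <= p n t.
Proof.
move=> tI; apply: (cvgr_to_le (p_cvg tI)); exists n => // m /= nm.
elim: m nm => [|m IH]; first by rewrite leqn0 => /eqP ->.
rewrite leq_eqVlt => /predU1P[->//|]; rewrite ltnS => /IH.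
by move=> /(le_trans (p_dec _ tI)).
Qed.

Let v_bnd t : l <= t <= b -> `|v t| <= K * (t - l).
Proof.
move=> tI; apply: (cvgr_to_le (cvg_norm (p_cvg tI))); apply: nearW => n.
by have [_ /(_ _ tI)] := p_spec n.
Qed.

Let v_bm : bmeas l b v.
Proof.
split.
  apply: (@measurable_fun_cvg _ _ _ _ p); first by move=> n; have [[]] := p_spec n.
  by move=> t; rewrite /= in_itv/=; exact: p_cvg.
exists (K * (b - l)) => s /[dup] /v_bnd h /andP[ls sb]; rewrite (le_trans h)//.
by rewrite ler_wpM2l ?(ph_K H)// lerB.
Qed.

(** Dominated convergence in the iteration. The integrands converge because every iterate lies above
    the limit, where [ph_rc] applies. *)
Let v_fix t : l <= t <= b ->
  e t * v t = intg (fun s => e s * (G s (v s) + L s * v s)) l t.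
Proof.
move=> /[dup] tI /andP[lt tb].
have S s : l <= s <= t -> l <= s <= b.
  by move=> /andP[-> st]; rewrite (le_trans st).
have [_ [N hN]] := eb; have [_ [M hM]] := ph_L H.
have c1 : intg (fun s => e s * (G s (p n s) + L s * p n s)) l t @[n --> \oo] -->
    intg (fun s => e s * (G s (v s) + L s * v s)) l t.
  apply: (@intg_dct _ _ _ _ _ (N * (K + M * (K * (b - l))))).
  - by move=> n; have [] := bmeasS (lexx _) tb (gb (p_spec n).1).
  - by have [] := bmeasS (lexx _) tb (gb v_bm).
  - move=> n s /S sI; rewrite normrM ler_pM ?hN//.
    rewrite (le_trans (ler_normD _ _))// lerD ?(ph_bnd H)// normrM ler_pM ?hM//.
    have [_ /(_ _ sI) /le_trans] := p_spec n; apply.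
    by rewrite ler_wpM2l ?(ph_K H)// lerB//; case/andP: sI.
  - move=> s /S sI; apply: cvgMr; apply: cvgD; last by apply: cvgMr; exact: p_cvg.
    by apply: (ph_rc H sI) => [n|]; [exact: v_le|exact: p_cvg].
have c2 : e t * p n.+1 t @[n --> \oo] --> e t * v t.
  by apply: cvgMr; rewrite (cvg_shiftS (p ^~ t)); exact: p_cvg.
rewrite -(cvg_lim (@Rhausdorff R) c1) -(cvg_lim (@Rhausdorff R) c2).
suff -> : (fun n => e t * p n.+1 t) =
  (fun n => intg (fun s => e s * (G s (p n s) + L s * p n s)) l t) by [].
by apply/funext => n; rewrite /p /= mulrA divff ?mul1r// gt_eqF.
Qed.

Lemma maxsol_acd : acd l b v (fun s => G s (v s)).
Proof.
have h1 := acd_primitive (gb v_bm).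
have h2 : acd l b (fun t => expR (- intg L l t)) (fun t => expR (- intg L l t) * - L t).
  exact: acd_exp (acdN Lacd).
apply: acd_ext (acdM h2 h1) => t tI; rewrite -v_fix//.
  by rewrite expRN -/(wexp L l t) -/(e t) mulrA mulVf ?mul1r// gt_eqF.
have e0 : e t != 0 by rewrite gt_eqF.
rewrite expRN -/(wexp L l t) -/(e t); field; exact: e0.
Qed.

Lemma maxsol0 : v l = 0.
Proof.
have lI : l <= l <= b by rewrite lexx (ph_le H).
by have := v_bnd lI; rewrite subrr mulr0 normr_le0 => /eqP.
Qed.

(** When the line of slope [K] is itself a solution, the iteration never leaves its starting
    point. *)
Lemma maxsol_top t : (forall s, l <= s <= b -> G s (K * (s - l)) = K) ->
  l <= t <= b -> v t = K * (t - l).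
Proof.
move=> GK tI.
have pn n s : l <= s <= b -> p n s = K * (s - l).
  elim: n s => // n IH s /[dup] sI /andP[ls sb]; rewrite /p/= -/p.
  rewrite (@intg_ext _ _ _ _ (fun s => e s * (K + L s * (K * (s - l))))).
    by rewrite linb// -/e mulKf// gt_eqF.
  move=> u /andP[lu us]; have uI : l <= u <= b by rewrite lu (le_trans us).
  by rewrite -/p IH// GK.
rewrite /v /maxsol; apply: (cvg_lim (@Rhausdorff R)).
rewrite (_ : (fun n => _) = fun=> K * (t - l)); first exact: cvg_cst.
by apply/funext => n; exact: pn.
Qed.

Lemma picard_bmeas n : bmeas l b (fun s => e s * (G s (p n s) + L s * p n s)).
Proof. exact: gb (p_spec n).1. Qed.

End Solve.

(** This is the source of nonanticipation for L: the selected solution is unaffected by a change of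
    the opponent's control on a null set. *)
Lemma maxsol_ae K L G G' l b : picard_hyp K L G l b -> picard_hyp K L G' l b ->
  {ae @lebesgue_measure R, forall s, l <= s <= b -> forall y, G s y = G' s y} ->
  forall s, l <= s <= b -> maxsol K L G l s = maxsol K L G' l s.
Proof.
move=> H H' GG s sI; rewrite /maxsol.
suff -> : picard K L G l ^~ s = picard K L G' l ^~ s by [].
apply/funext => n; elim: n s sI => // n IH s /[dup] sI /andP[ls sb] /=.
congr (_ * _); apply: intg_ae.
- by have [] := bmeasS (lexx l) sb (picard_bmeas H n).
- by have [] := bmeasS (lexx l) sb (picard_bmeas H' n).
move: GG; apply: filterS; first exact: (ae_filter_ringOfSetsType (@lebesgue_measure R)).
move=> u h /andP[lu us]; have uI : l <= u <= b by rewrite lu (le_trans us).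
by rewrite h// IH.
Qed.

End MaximalSolution.

(** * The antipodal pursuit *)

Section AntipodalPursuit.
Context {R : realType}.
Implicit Types (w X Y x y : R -> R) (l b s t : R).

Lemma clamp_mono (a b s t : R) : s <= t -> clamp a b s <= clamp a b t.
Proof.
move=> st; rewrite /clamp ge_max le_max lexx/= le_max; apply/orP; right.
by rewrite le_min !ge_min lexx st orbT.
Qed.

(** The square of the positive part is C^{1,1}, which the positive part is not; it is the test
    function of the comparison principle. *)
Lemma taylor_sqrpos : taylor setT (fun p : R => Num.max p 0 ^+ 2)
  (fun p => 2 * Num.max p 0).
Proof.
exists 1 => p q _ _; rewrite mul1r.
case: (leP p 0) => p0; case: (leP q 0) => q0.
- by rewrite expr0n/= subrr mulr0 mul0r subr0 normr0 sqr_ge0.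
- have h : p * q <= 0 by rewrite mulr_le0_ge0// ltW.
  have := sqr_ge0 p.
  rewrite (_ : _ - _ = q ^+ 2) ?ger0_norm ?sqr_ge0//; [nra|ring].
- have h : p * q <= 0 by rewrite mulr_ge0_le0// ltW.
  have := sqr_ge0 p; have := sqr_ge0 q => q2 p2.
  rewrite (_ : _ - _ = p ^+ 2 - 2 * (p * q)); last by ring.
  by rewrite ger0_norm; nra.
- rewrite (_ : _ - _ = (q - p) ^+ 2) ?ger0_norm ?sqr_ge0//; ring.
Qed.

(** The square of the positive part of X - Y is nonincreasing. No Lipschitz condition enters, and
    the rates are compared only where X exceeds Y; both facts matter for the square-root rate
    below. *)
Lemma acd_compare l b X Y x y : l <= b -> acd l b X x -> acd l b Y y -> X l <= Y l ->
  (forall s, l <= s <= b -> Y s < X s -> x s <= y s) -> X b <= Y b.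
Proof.
move=> lb hX hY l0 xy.
have hD := acd_comp taylor_sqrpos (fun _ _ => I) (acdB hX hY).
have := acd_le lb hD _; rewrite (max_r (_ : X l - Y l <= 0)) ?subr_le0// expr0n/=.
have h : forall t, l <= t <= b -> 2 * Num.max (X t - Y t) 0 * (x t - y t) <= 0.
  move=> t tI; case: (leP (X t - Y t) 0) => D0; first by rewrite mulr0 mul0r.
  by rewrite pmulr_rle0 ?mulr_gt0// subr_le0 xy// -subr_gt0.
move=> /(_ h); case: (leP (X b - Y b) 0) => [|D0 D2]; first by rewrite subr_le0.
have := exprn_gt0 2 D0; lra.
Qed.

(** For c = 0 and y in [0, 1], the radial speed, in units of mu, left to L after she has spent sin
    psi = y omega on staying antipodal. A positive c keeps the root away from 0, where it is not
    Lipschitz. *)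
Definition antirate (c : R) w (s y : R) : R :=
  Num.sqrt (1 + c - clamp 0 1 y ^+ 2 * w s ^+ 2).

Lemma antirate_cont c w s : continuous (antirate c w s).
Proof.
move=> y; apply: continuous_comp; last exact: sqrt_continuous.
apply: cvgB; first exact: cvg_cst.
apply: cvgM; last exact: cvg_cst.
have cc : continuous (clamp 0 1 : R -> R).
  by apply: (@lip_continuous _ _ 1) => p q; rewrite mul1r; apply: clamp_lip.
by apply: cvgM; exact: cc.
Qed.

Lemma sqr_le1 (p : R) : `|p| <= 1 -> p ^+ 2 <= 1.
Proof. by move=> p1; rewrite -real_normK ?num_real// expr_le1. Qed.

Lemma clamp01 (y : R) : 0 <= clamp 0 1 y <= 1.
Proof. by apply: clamp_in. Qed.

Lemma antirate_arg (c y : R) w s : 0 <= c -> `|w s| <= 1 ->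
  c <= 1 + c - clamp 0 1 y ^+ 2 * w s ^+ 2 <= 1 + c.
Proof.
move=> c0 ws; have /andP[q0 q1] := clamp01 y.
have h1 : 0 <= clamp 0 1 y ^+ 2 * w s ^+ 2 by rewrite mulr_ge0 ?sqr_ge0.
have h2 : clamp 0 1 y ^+ 2 * w s ^+ 2 <= 1.
  by apply: mulr_ile1; rewrite ?sqr_ge0//; [rewrite expr_le1|exact: sqr_le1].
by apply/andP; split; lra.
Qed.

Lemma antirate_noninc (c y z : R) w s : y <= z -> antirate c w s z <= antirate c w s y.
Proof.
move=> yz; apply: ler_wsqrtr; rewrite lerD2l lerN2 ler_wpM2r ?sqr_ge0//.
have /andP[q0 _] := clamp01 y; have /andP[q1 _] := clamp01 z.
by rewrite ler_pXn2r// ?nnegrE//; exact: clamp_mono.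
Qed.

Lemma antirate_bnd (c y : R) w s : 0 <= c <= 1 -> `|w s| <= 1 -> `|antirate c w s y| <= 2.
Proof.
move=> /andP[c0 c1] ws; have /andP[h1 h2] := antirate_arg y c0 ws.
rewrite ger0_norm ?sqrtr_ge0// -[leRHS](ger0_norm (_ : 0 <= 2))// -sqrtr_sqr.
by rewrite ler_sqrt ?sqr_ge0//; nra.
Qed.

Lemma antirate_meas (D : set R) (c : R) w (v : R -> R) :
  measurable_fun D w -> measurable_fun D v ->
  measurable_fun D (fun s => antirate c w s (v s)).
Proof.
move=> mw mv; apply: (@measurableT_comp _ _ _ _ _ _ (@Num.sqrt R)).
  by apply: continuous_measurable_fun; exact: sqrt_continuous.
apply: measurable_funB => //; apply: measurable_funM; apply: measurable_funX => //.
apply: (@measurableT_comp _ _ _ _ _ _ (clamp 0 1 : R -> R)) => //.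
apply: continuous_measurable_fun.
by apply: (@lip_continuous _ _ 1) => p q; rewrite mul1r; apply: clamp_lip.
Qed.

Section Solution.
Variables (w : R -> R) (l : R).
Hypotheses (mw : measurable_fun setT w) (w1 : forall s, `|w s| <= 1).

Let c n : R := n.+1%:R^-1.

Let c01 n : 0 < c n <= 1.
Proof. by rewrite invr_gt0 ltr0n invf_le1 ?ltr0n// ler1n. Qed.

(** The constant 2 bounds the regularised rate, and n + 1 = 1 / c n is a Lipschitz constant of it in
    y. *)
Definition regpursuit n : R -> R :=
  maxsol 2 (fun=> n.+1%:R) (antirate (c n) w) l.

Lemma regpursuit_hyp n b : l <= b -> picard_hyp 2 (fun=> n.+1%:R) (antirate n.+1%:R^-1 w) l b.
Proof.
rewrite -/(c n); have /andP[c0 c1] := c01 n.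
move=> lb; split=> //.
- exact: bmeas_cst.
- by move=> s y _; apply: antirate_bnd => //; rewrite ltW.
- move=> s y z _ yz.
  have /andP[qy0 qy1] := clamp01 y; have /andP[qz0 qz1] := clamp01 z.
  have qyz := clamp_mono 0 1 yz.
  have qd : clamp 0 1 z - clamp 0 1 y <= z - y.
    have := clamp_lip z y (@ler01 R); rewrite !ger0_norm ?subr_ge0//.
  have /andP[ay _] := antirate_arg y (ltW c0) (w1 s).
  have /andP[az _] := antirate_arg z (ltW c0) (w1 s).
  (* Since c n <= 1, each root is at least sqrt (c n) >= c n. This bounds p + q from below in p^2 -
     q^2 = (p - q) (p + q). *)
  have cs : c n ^+ 2 <= c n by rewrite expr2 ger_pMr.
  have sc u : c n <= 1 + c n - clamp 0 1 u ^+ 2 * w s ^+ 2 -> c n <= antirate (c n) w s u.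
    move=> h; rewrite -[leLHS](ger0_norm (ltW c0)) -sqrtr_sqr ler_wsqrtr//.
    exact: le_trans h.
  have A := sc _ ay; have B := sc _ az.
  have A2 : antirate (c n) w s y ^+ 2 = 1 + c n - clamp 0 1 y ^+ 2 * w s ^+ 2.
    by rewrite sqr_sqrtr// (le_trans (ltW c0)).
  have B2 : antirate (c n) w s z ^+ 2 = 1 + c n - clamp 0 1 z ^+ 2 * w s ^+ 2.
    by rewrite sqr_sqrtr// (le_trans (ltW c0)).
  have AB := antirate_noninc (c n) w s yz.
  move: A B A2 B2 AB; set p := antirate _ _ _ y; set q := antirate _ _ _ z => A B A2 B2 AB.
  suff : p - q <= n.+1%:R * (z - y) by rewrite mulrBr; lra.
  have -> : n.+1%:R = (c n)^-1 by rewrite invrK.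
  rewrite mulrC ler_pdivlMr//.
  have w2 := sqr_le1 (w1 s).
  have w20 := sqr_ge0 (w s).
  have d0 : 0 <= clamp 0 1 z ^+ 2 - clamp 0 1 y ^+ 2.
    by rewrite subr_ge0 ler_pXn2r ?nnegrE.
  have d1 : p ^+ 2 - q ^+ 2 <= 2 * (z - y).
    rewrite A2 B2 (_ : _ - _ = (clamp 0 1 z ^+ 2 - clamp 0 1 y ^+ 2) * w s ^+ 2); last by ring.
    rewrite (le_trans (ler_piMr d0 w2))//.
    by rewrite subr_sqr mulrC ler_pM// ?subr_ge0//; lra.
  have : (p - q) * (c n + c n) <= p ^+ 2 - q ^+ 2.
    by rewrite subr_sqr ler_wpM2l ?subr_ge0// lerD.
  lra.
- move=> s y u _ _ uy.
  by apply: continuous_cvg uy; exact: antirate_cont.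
- by move=> v mv; apply: antirate_meas => //; exact: measurable_funTS.
Qed.

(** The limit equation is not Lipschitz where k |omega| = 1. A decreasing limit of regularised
    solutions exists for every control and depends on the past of [w] only. *)
Definition pursuit (t : R) : R := lim (regpursuit n t @[n --> \oo]).

Let reg_acd n b : l <= b ->
  acd l b (regpursuit n) (fun s => antirate (c n) w s (regpursuit n s)).
Proof. by move=> lb; exact: maxsol_acd (regpursuit_hyp n lb). Qed.

Let reg0 n t : t <= l -> regpursuit n t = 0.
Proof.
rewrite le_eqVlt => /predU1P[->|tl]; first exact: maxsol0 (regpursuit_hyp n (lexx l)).
rewrite /regpursuit /maxsol; apply: (cvg_lim (@Rhausdorff R)).
rewrite -(cvg_shiftS (fun m => picard 2 _ _ l m t))/=.
by under eq_fun do rewrite intg_empty ?(ltW tl)// mulr0; exact: cvg_cst.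
Qed.

Let reg_ge0 n t : 0 <= regpursuit n t.
Proof.
have [tl|/ltW lt] := leP t l; first by rewrite reg0.
have := acd_le lt (acdN (reg_acd n lt)).
rewrite (reg0 _ (lexx l)) oppr0 oppr_le0; apply.
by move=> s _; rewrite oppr_le0 sqrtr_ge0.
Qed.

Let reg_dec n t : regpursuit n.+1 t <= regpursuit n t.
Proof.
have [tl|/ltW lt] := leP t l; first by rewrite !reg0.
apply: acd_compare lt (reg_acd n.+1 lt) (reg_acd n lt) _ _; first by rewrite !reg0.
move=> s _ /ltW ns; apply: (le_trans (antirate_noninc _ _ _ ns)).
by apply: ler_wsqrtr; rewrite lerD2r lerD2l lef_pV2 ?posrE// ler_nat.
Qed.

Let reg_cvg t : regpursuit n t @[n --> \oo] --> pursuit t.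
Proof.
apply: nonincreasing_is_cvgn.
  by apply/nonincreasing_seqP => n; exact: reg_dec.
by exists 0 => _ [n _ <-]; exact: reg_ge0.
Qed.

Lemma pursuit0 t : t <= l -> pursuit t = 0.
Proof.
move=> tl; apply: (cvg_lim (@Rhausdorff R)).
by under eq_fun do rewrite reg0//; exact: cvg_cst.
Qed.

Lemma pursuit_ge0 t : 0 <= pursuit t.
Proof. by apply: (cvgr_to_ge (@reg_cvg t)); apply: nearW => n; exact: reg_ge0. Qed.

Let reg_meas b n : measurable_fun `[l, b] (regpursuit n).
Proof.
have [lb|bl] := leP l b; last first.
  by rewrite set_itv_ge; [exact: measurable_fun_set0|rewrite bnd_simp -ltNge].
by have [] := acd_bmeas (reg_acd n lb).
Qed.

Let pursuit_meas_itv b : measurable_fun `[l, b] pursuit.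
Proof.
apply: (@measurable_fun_cvg _ _ _ _ regpursuit); first by move=> n; exact: reg_meas.
by move=> t _; exact: reg_cvg.
Qed.

Lemma pursuit_acd b : l <= b ->
  acd l b pursuit (fun s => antirate 0 w s (pursuit s)).
Proof.
move=> lb.
have bnd s : `|antirate 0 w s (pursuit s)| <= 2.
  by apply: antirate_bnd => //; rewrite lexx ler01.
have mr : measurable_fun `[l, b] (fun s => antirate 0 w s (pursuit s)).
  by apply: antirate_meas => //; exact: measurable_funTS.
split; first by split=> //; exists 2.
move=> p q lp pq qb.
have c1 : regpursuit n q - regpursuit n p @[n --> \oo] --> pursuit q - pursuit p.
  by apply: cvgB; exact: reg_cvg.
rewrite -(cvg_lim (@Rhausdorff R) c1).
have -> : (fun n => regpursuit n q - regpursuit n p) =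
    (fun n => intg (fun s => antirate (c n) w s (regpursuit n s)) p q).
  apply/funext => n; have [_] := reg_acd n (le_trans lp pq); apply => //.
apply: (cvg_lim (@Rhausdorff R)).
have sub : `[p, q] `<=` `[l, b].
  by move=> t /=; rewrite !in_itv/= => /andP[pt tq]; rewrite (le_trans lp)//= (le_trans tq).
apply: (@intg_dct _ _ _ _ _ 2).
- move=> n; apply: antirate_meas; first exact: measurable_funTS.
  exact: measurable_funS (@reg_meas b n).
- exact: measurable_funS mr.
- by move=> n s _; apply: antirate_bnd => //; have /andP[/ltW -> ->] := c01 n.
- move=> s _; apply: (@continuous_cvg _ _ _ _ _ _ (@Num.sqrt R)).
    exact: sqrt_continuous.
  apply: cvgB.
    by apply: cvgD; [exact: cvg_cst|exact: cvg_harmonic].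
  apply: cvgM; last exact: cvg_cst.
  have cc : continuous (clamp 0 1 : R -> R).
    by apply: (@lip_continuous _ _ 1) => ? ?; rewrite mul1r; apply: clamp_lip.
  have cq : clamp 0 1 (regpursuit n s) @[n --> \oo] --> clamp 0 1 (pursuit s).
    by apply: continuous_cvg; [exact: cc|exact: reg_cvg].
  by apply: cvgM.
Qed.

Lemma pursuit_meas : measurable_fun setT pursuit.
Proof.
have h n : measurable_fun setT (fun t => pursuit (clamp l (l + n%:R) t)).
  apply: continuous_measurable_fun.
  by apply: acd_clamp_continuous (pursuit_acd _); rewrite lerDl.
apply: (@measurable_fun_cvg _ _ _ _ (fun n t => pursuit (clamp l (l + n%:R) t))) => //.
move=> t _; have [tl|/ltW lt] := leP t l.
  rewrite pursuit0//; rewrite (_ : (fun n => _) = fun=> 0); first exact: cvg_cst.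
  by apply/funext => n; rewrite pursuit0// /clamp ge_max lexx/= ge_min tl orbT.
have e : \forall n \near \oo, pursuit (clamp l (l + n%:R) t) = pursuit t.
  exists (Num.bound (t - l)) => // m /= hm.
  rewrite clampK// lt/= -lerBlDl (le_trans (ltW (archi_boundP _))) ?subr_ge0//.
  by rewrite ler_nat.
exact: cvg_near_cst.
Qed.

(** Wherever the solution lies below sin (t - l), its rate is at least sqrt (1 - k^2), hence at
    least cos (t - l). *)
Lemma pursuit_ge_sin t : l <= t -> t - l <= pi / 2 -> sin (t - l) <= pursuit t.
Proof.
move=> lt tp.
have hs : acd l t (fun s => sin (s - l)) (fun s => cos (s - l) * (1 - 0)).
  exact: acd_sin (acdB (acd_id _ _) (acd_cst _ _ l)).
apply: acd_compare lt hs (pursuit_acd lt) _ _; first by rewrite subrr sin0 pursuit0.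
move=> s /andP[ls st] ks; rewrite subr0 mulr1.
have k0 := pursuit_ge0 s.
have kc : clamp 0 1 (pursuit s) = pursuit s.
  by apply: clampK; rewrite k0 (le_trans (ltW ks))// sin_le1.
rewrite (le_trans (ler_norm _))// -sqrtr_sqr ler_wsqrtr// kc cos2sin2 addr0 lerD2l lerN2.
have w2 := sqr_le1 (w1 s).
rewrite (le_trans (ler_piMr (sqr_ge0 _) w2))//.
by rewrite ler_pXn2r ?nnegrE// ltW// (le_lt_trans k0).
Qed.

Lemma pursuit_max t : (forall s, l <= s <= t -> w s ^+ 2 = 1) -> l <= t ->
  t - l <= pi / 2 -> pursuit t = sin (t - l).
Proof.
move=> w2 lt tp; apply/eqP; rewrite eq_le pursuit_ge_sin// andbT.
have hs : acd l t (fun s => sin (s - l)) (fun s => cos (s - l) * (1 - 0)).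
  exact: acd_sin (acdB (acd_id _ _) (acd_cst _ _ l)).
apply: acd_compare lt (pursuit_acd lt) hs _ _; first by rewrite subrr sin0 pursuit0.
move=> s /andP[ls st] ks; rewrite subr0 mulr1.
have sl0 : 0 <= s - l by rewrite subr_ge0.
have slp : s - l <= pi / 2 by rewrite (le_trans _ tp)// lerB.
have c0 : 0 <= cos (s - l).
  by apply: cos_ge0_pihalf; rewrite slp andbT (le_trans _ sl0)// oppr_le0 divr_ge0// pi_ge0.
have s0 : 0 <= sin (s - l).
  by apply: sin_ge0_pi; rewrite sl0 (le_trans slp)//; have := pi_gt0 R; lra.
rewrite -(ger0_norm c0) -sqrtr_sqr ler_wsqrtr// cos2sin2 w2 ?ls// mulr1 addr0 lerD2l lerN2.
rewrite ler_pXn2r ?nnegrE//; last by have /andP[] := clamp01 (pursuit s).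
rewrite /clamp le_max; apply/orP; right.
by rewrite le_min (ltW ks) sin_le1.
Qed.

End Solution.

Lemma pursuit_ae w w' l t : measurable_fun setT w -> measurable_fun setT w' ->
  (forall s, `|w s| <= 1) -> (forall s, `|w' s| <= 1) ->
  {ae @lebesgue_measure R, forall s, l <= s <= t -> w s = w' s} ->
  forall s, s <= t -> pursuit w l s = pursuit w' l s.
Proof.
move=> mw mw' w1 w1' ww s st; have [sl|/ltW ls] := leP s l.
  by rewrite !pursuit0.
have lt := le_trans ls st.
rewrite /pursuit.
suff -> : regpursuit w l ^~ s = regpursuit w' l ^~ s by [].
apply/funext => n; apply: (maxsol_ae (regpursuit_hyp mw w1 n lt)
  (regpursuit_hyp mw' w1' n lt)); last by rewrite ls.
move: ww; apply: filterS; first exact: (ae_filter_ringOfSetsType (@lebesgue_measure R)).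
by move=> u h /h e y; rewrite /antirate e.
Qed.

End AntipodalPursuit.

(** * The barrier and the monotone quantities *)

Section Barrier.
Context {R : realType}.
Implicit Types (mu m k a b rho c : R).

(* Length of the tangent from a point at distance [k] to the unit circle. *)
Definition tangent k : R := Num.sqrt (k ^+ 2 - 1).

Lemma tangent_ge0 k : 0 <= tangent k. Proof. exact: sqrtr_ge0. Qed.

Lemma sqr_tangent k : 1 <= k -> tangent k ^+ 2 = k ^+ 2 - 1.
Proof. by move=> k1; rewrite sqr_sqrtr// subr_ge0 expr_ge1// (le_trans ler01). Qed.

Lemma tangent1 : tangent 1 = 0.
Proof. by rewrite /tangent expr1n subrr sqrtr0. Qed.

Lemma tangent_lt k k' : 1 <= k -> k < k' -> tangent k < tangent k'.
Proof.
move=> k1 kk; have k0 : 0 <= k by exact: le_trans ler01 k1.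
have k'0 : 0 <= k' by rewrite (le_trans k0)// ltW.
rewrite ltr_sqrt; last by rewrite subr_gt0 expr_gt1// (le_lt_trans k1).
by rewrite ltrD2r ltr_pXn2r.
Qed.

Lemma tangent_gt0 k : 1 < k -> 0 < tangent k.
Proof. by move=> k1; rewrite -tangent1 tangent_lt. Qed.

Lemma cos_atan_tangent k : 1 <= k -> cos (atan (tangent k)) = k^-1.
Proof.
move=> k1; rewrite cos_atan sqr_tangent// addrC subrK sqrtr_sqr ger0_norm//.
by rewrite (le_trans ler01).
Qed.

Lemma sin_atan_tangent k : 1 <= k -> sin (atan (tangent k)) = tangent k / k.
Proof.
move=> k1; have k0 : 0 < k by rewrite (lt_le_trans ltr01).
have := atanK (tangent k); rewrite /tan cos_atan_tangent// invrK => e.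
by rewrite -[in RHS]e mulfK// gt_eqF.
Qed.

Lemma atan_tangent k : 1 <= k -> acos k^-1 = atan (tangent k).
Proof.
move=> k1; rewrite -cos_atan_tangent// cosK// in_itv/=.
apply/andP; split; last by have := atan_ltpi2 (tangent k); have := pi_gt0 R; lra.
by rewrite -[leLHS](@atan0 R) le_atan// tangent_ge0.
Qed.

Lemma sub_atan_lt a b : 0 <= a -> a < b -> a - atan a < b - atan b.
Proof.
move=> a0 ab.
have [] := @MVT R atan (fun x => (1 + x ^+ 2)^-1) a b ab.
  by apply: continuous_subspaceT => x; exact: continuous_atan.
move=> c; rewrite in_itv/= => /andP[ac _] e.
suff : atan b - atan a < b - a by lra.
have c0 : 0 < c ^+ 2 by rewrite exprn_gt0// (le_lt_trans a0).
by rewrite e gtr_pMl ?subr_gt0// invf_lt1; lra.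
Qed.

(** With cos phi = mu / rho, the length [tangent (rho / mu)] is tan phi, and the barrier is pi minus
    the involute function tan phi - phi. All monotonicity of the barrier comes from that of x - atan
    x. *)
Lemma barrierE mu rho : 0 < mu -> mu <= rho ->
  barrier mu rho = pi - (tangent (rho / mu) - atan (tangent (rho / mu))).
Proof.
move=> mu0 mr; have r0 : 0 < rho by exact: lt_le_trans mr.
rewrite /barrier -atan_tangent ?ler_pdivlMr ?mul1r// invf_div /tangent expr_div_n.
by ring.
Qed.

Lemma barrier_lt mu rho rho' : 0 < mu -> mu <= rho -> rho < rho' ->
  barrier mu rho' < barrier mu rho.
Proof.
move=> mu0 mr rr; rewrite !barrierE//; last by rewrite (le_trans mr)// ltW.
rewrite ltrD2l ltrN2 sub_atan_lt ?tangent_ge0// tangent_lt//.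
  by rewrite ler_pdivlMr ?mul1r.
by rewrite ltr_pM2r// invr_gt0.
Qed.

Lemma barrier_le mu rho rho' : 0 < mu -> mu <= rho -> rho <= rho' ->
  barrier mu rho' <= barrier mu rho.
Proof.
by move=> mu0 mr; rewrite le_eqVlt => /predU1P[->//|/(barrier_lt mu0 mr)/ltW].
Qed.

Lemma barrier_mu mu : 0 < mu -> barrier mu mu = pi.
Proof.
move=> mu0; rewrite barrierE// divff ?gt_eqF// tangent1 atan0; lra.
Qed.

(** At radius 1 the barrier vanishes for mu = m, and it increases with mu because [tangent mu^-1]
    decreases. *)
Lemma barrier1_gt0 m mu : is_mu_crit m -> m < mu < 1 -> 0 < barrier mu 1.
Proof.
move=> [/andP[m0 m1] e] /andP[mmu mu1].
have mu0 : 0 < mu by exact: lt_trans mmu.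
have im : 1 <= m^-1 by rewrite invf_ge1// ltW.
have imu : 1 <= mu^-1 by rewrite invf_ge1// ltW.
rewrite barrierE ?ltW// div1r.
have : tangent mu^-1 - atan (tangent mu^-1) < tangent m^-1 - atan (tangent m^-1).
  by rewrite sub_atan_lt ?tangent_ge0// tangent_lt// ltf_pV2 ?posrE.
have := atan_tangent im; rewrite invrK => em.
by move: e; rewrite em -/(tangent m^-1); lra.
Qed.

(* The signed distance to the barrier is D = delta - (tangent k - atan (tangent k))
   with delta = pi - th, and k e^(iD) = e^(i(delta - tangent k)) (1 + i tangent k). *)
Lemma sin_barrier k d : 1 <= k ->
  k * sin (d - (tangent k - atan (tangent k))) =
  sin (d - tangent k) + tangent k * cos (d - tangent k).
Proof.
move=> k1; have k0 : k != 0 by rewrite gt_eqF// (lt_le_trans ltr01).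
rewrite opprB addrA addrAC sinD cos_atan_tangent// sin_atan_tangent//.
by field.
Qed.

Lemma cos_barrier k d : 1 <= k ->
  k * cos (d - (tangent k - atan (tangent k))) =
  cos (d - tangent k) - tangent k * sin (d - tangent k).
Proof.
move=> k1; have k0 : k != 0 by rewrite gt_eqF// (lt_le_trans ltr01).
rewrite opprB addrA addrAC cosD cos_atan_tangent// sin_atan_tangent//.
by field.
Qed.

End Barrier.

(** * Monotone quantities while M runs away from the antipodal line *)

Section Running.
Context {R : realType}.
Implicit Types (psi k y g : R -> R) (a b s t m : R).

Lemma sgr2 (z : R) : sgr z * sgr z = 1.
Proof. by rewrite /sgr; case: ifP => _; rewrite ?mulr1 ?mulrNN ?mulr1. Qed.

Lemma sgr_norm (z : R) : sgr z * z = `|z|.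
Proof.
rewrite /sgr; case: ifPn => [z0|]; first by rewrite mul1r ger0_norm.
by rewrite -ltNge => z0; rewrite mulN1r ltr0_norm.
Qed.

Lemma cauchy2 (p q u v : R) : p ^+ 2 + q ^+ 2 = 1 -> u ^+ 2 + v ^+ 2 = 1 ->
  p * u + q * v <= 1.
Proof. by move=> pq uv; have := sqr_ge0 (p - u); have := sqr_ge0 (q - v); nra. Qed.

Lemma run_cos a b y g : acd a b y (fun s => g s + sgr (sin (y s))) ->
  acd a b (fun s => cos (y s))
    (fun s => - `|sin (y s)| * (sgr (sin (y s)) * g s + 1)).
Proof.
move=> hy; apply: acd_ext (acd_cos hy) => // s _.
rewrite -sgr_norm.
have := sgr2 (sin (y s)); set z := sgr _ => z2.
transitivity (- (z * z) * sin (y s) * g s - z * sin (y s)); last by ring.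
by rewrite z2; ring.
Qed.

Lemma run_sin a b y g : acd a b y (fun s => g s + sgr (sin (y s))) ->
  acd a b (fun s => `|sin (y s)|)
    (fun s => cos (y s) * (sgr (sin (y s)) * g s + 1)).
Proof.
move=> hy; apply: acd_ext (acd_abs (acd_sin hy)) => // s _.
by rewrite -[in RHS](sgr2 (sin (y s))); ring.
Qed.

Section Plane.
Variables (a b : R) (psi k y : R -> R).
Hypothesis ab : a <= b.
Hypothesis k0 : forall s, a <= s <= b -> 0 < k s.
Hypothesis hk : acd a b k (fun s => cos (psi s)).
Hypothesis hy : acd a b y (fun s => sin (psi s) / k s + sgr (sin (y s))).

Let C s := cos (y s).
Let S s := `|sin (y s)|.
Let z s := sgr (sin (y s)).
Let hC := run_cos hy.
Let hS := run_sin hy.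

Let CS s : C s ^+ 2 + S s ^+ 2 = 1.
Proof. by rewrite real_normK ?num_real// cos2Dsin2. Qed.

Let zpsi s : cos (psi s) ^+ 2 + (z s * sin (psi s)) ^+ 2 = 1.
Proof. by rewrite exprMn [z s ^+ 2]sgr2 mul1r cos2Dsin2. Qed.

Let rot (c n p q : R) : c ^+ 2 + n ^+ 2 = 1 -> p ^+ 2 + q ^+ 2 = 1 ->
  (p * c - q * n) ^+ 2 + (q * c + p * n) ^+ 2 = 1.
Proof.
move=> cn pq.
have -> : (p * c - q * n) ^+ 2 + (q * c + p * n) ^+ 2 =
  (p ^+ 2 + q ^+ 2) * (c ^+ 2 + n ^+ 2) by ring.
by rewrite cn pq mul1r.
Qed.

(** While M runs he turns the frame at unit rate, so |y| - s is L's angle in a frame that does not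
    turn. The first term is k cos (|y| + e - s), a Cartesian coordinate of L there; her speed is 1,
    so it grows at most at rate 1, which e - s offsets. *)
Lemma plane_wave (e : R) :
  k b * (C b * cos (e - b) - S b * sin (e - b)) + (e - b) <=
  k a * (C a * cos (e - a) - S a * sin (e - a)) + (e - a).
Proof.
have he : acd a b (fun s => e - s) (fun s => 0 - 1).
  exact: acdB (acd_cst a b e) (acd_id a b).
have h := acdD (acdM hk (acdB (acdM hC (acd_cos he)) (acdM hS (acd_sin he)))) he.
apply: (acd_le ab h) => s sI /=.
have ks := k0 sI; have kn : k s != 0 by rewrite gt_eqF.
have r1 := rot (cos2Dsin2 (e - s)) (CS s).
rewrite -/(C s) -/(S s) -/(z s).
set c1 := cos (e - s) in r1 *; set s1 := sin (e - s) in r1 *.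
have r2 : (C s * c1 - S s * s1) ^+ 2 + (- (S s * c1 + C s * s1)) ^+ 2 = 1.
  by rewrite -r1; ring.
have h1 := cauchy2 (zpsi s) r2.
rewrite [X in X <= 0](_ : _ = cos (psi s) * (C s * c1 - S s * s1) +
  z s * sin (psi s) * - (S s * c1 + C s * s1) - 1); last by field.
by lra.
Qed.

(** Put u = s - e. The numerator vanishes along L's best motion k = sin u, y = 0. Here the angle |y|
    + u turns at twice M's rate; the factor 1 / cos^2 u is the integrating factor that cancels the
    part of the resulting term in C, and what remains of it is -2 k S / cos u, of the right sign. *)
Lemma rotating_wave (e : R) : 0 <= a - e -> b - e < pi / 2 ->
  (k b * (C b * cos (b - e) - S b * sin (b - e)) - sin (b - e) * cos (b - e))
    * ((cos (b - e))^-1 * (cos (b - e))^-1) <=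
  (k a * (C a * cos (a - e) - S a * sin (a - e)) - sin (a - e) * cos (a - e))
    * ((cos (a - e))^-1 * (cos (a - e))^-1).
Proof.
move=> ae be.
have pi0 := pi_gt0 R.
have cb : 0 < cos (b - e).
  by apply: cos_gt0_pihalf; apply/andP; split; have := ab; lra.
have he : acd a b (fun s => s - e) (fun s => 1 - 0).
  exact: acdB (acd_id a b) (acd_cst a b e).
have cm s : a <= s <= b -> cos (b - e) <= cos (s - e).
  move=> /andP[as_ sb]; rewrite leNgt ltr_cos ?in_itv/=; last 2 first.
  - by apply/andP; split; lra.
  - by apply/andP; split; lra.
  by rewrite -leNgt lerD2r.
have hcos := acd_cos he.
have hI := acd_inv cb cm hcos.
have h := acdM (acdB (acdM hk (acdB (acdM hC hcos) (acdM hS (acd_sin he))))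
  (acdM (acd_sin he) hcos)) (acdM hI hI).
apply: (acd_le ab h) => s sI /=.
have ks := k0 sI; have kn : k s != 0 by rewrite gt_eqF.
have cs : 0 < cos (s - e) by rewrite (lt_le_trans cb)// cm.
have r1 := rot (CS s) (cos2Dsin2 (s - e)).
have tr := cos2Dsin2 (s - e).
rewrite -/(C s) -/(S s) -/(z s).
set c1 := cos (s - e) in cs r1 tr *; set s1 := sin (s - e) in r1 tr *.
have r2 : (C s * c1 - S s * s1) ^+ 2 + (- (S s * c1 + C s * s1)) ^+ 2 = 1.
  by rewrite -r1; ring.
have h1 := cauchy2 (zpsi s) r2.
have cn : c1 != 0 by rewrite gt_eqF.
rewrite [X in X <= 0](_ : _ = (cos (psi s) * (C s * c1 - S s * s1) +
  z s * sin (psi s) * - (S s * c1 + C s * s1) - (c1 ^+ 2 + s1 ^+ 2) -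
  2 * k s * S s * (c1 ^+ 2 + s1 ^+ 2) / c1) / c1 ^+ 2); last by field; rewrite cn kn.
rewrite tr mulr1 pmulr_lle0 ?invr_gt0 ?exprn_gt0//.
have : 0 <= 2 * k s * S s / c1.
  apply: divr_ge0 (ltW cs); apply: mulr_ge0; last exact: normr_ge0.
  by apply: mulr_ge0 => //; exact: ltW.
lra.
Qed.

(* [Y] and [X] are [k sin D] and [k cos D], for [D] the angle to the barrier. *)
Lemma barrier_wave m : 1 < m -> (forall s, a <= s <= b -> m <= k s) ->
  let X s := C s * cos (tangent (k s)) + S s * sin (tangent (k s)) -
    tangent (k s) * (S s * cos (tangent (k s)) - C s * sin (tangent (k s))) in
  let Y s := S s * cos (tangent (k s)) - C s * sin (tangent (k s)) +
    tangent (k s) * (C s * cos (tangent (k s)) + S s * sin (tangent (k s))) in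
  (forall s, a <= s <= b -> 0 <= X s) ->
  Y a / k a <= Y b / k b.
Proof.
move=> m1 mk X Y X0.
have m0 : 0 < m by rewrite (lt_trans ltr01).
have ht : acd a b (fun s => tangent (k s)) (fun s => k s * cos (psi s) / tangent (k s)).
  pose M := m ^+ 2 - 1.
  have M0 : 0 < M by rewrite subr_gt0 expr_gt1// ltW.
  have Mk s : a <= s <= b -> M <= k s * k s - 1.
    move=> /mk mks; rewrite -expr2 lerB// ler_pXn2r ?nnegrE ?(ltW m0)//.
    exact: le_trans (ltW m0) mks.
  apply: acd_ext (acd_sqrt M0 Mk (acdB (acdM hk hk) (acd_cst a b 1))) => s sI.
    by rewrite /tangent expr2.
  rewrite -expr2 -/(tangent (k s)).
  have k1 : 1 < k s by rewrite (lt_le_trans m1)// mk.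
  by field; rewrite gt_eqF// tangent_gt0.
have hct := acd_cos ht; have hst := acd_sin ht.
have h := acdM (acdD (acdB (acdM hS hct) (acdM hC hst))
  (acdM ht (acdD (acdM hC hct) (acdM hS hst)))) (acd_inv m0 mk hk).
rewrite -lerN2; apply: (acd_le ab (acdN h)) => s sI /=; rewrite oppr_le0.
have ks := k0 sI; have kn : k s != 0 by rewrite gt_eqF.
have k1 : 1 < k s by rewrite (lt_le_trans m1)// mk.
have t0 := tangent_gt0 k1; have tn : tangent (k s) != 0 by rewrite gt_eqF.
have t2 := sqr_tangent (ltW k1).
have := X0 _ sI; rewrite /X.
rewrite -/(C s) -/(S s) -/(z s).
move: t0 tn t2; set t := tangent (k s) => t0 tn t2.
set c1 := cos t; set s1 := sin t => Xs.
have r2 : (t / k s) ^+ 2 + k s ^- 2 = 1.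
  by rewrite expr_div_n t2; field.
(* Cauchy-Schwarz against the vector (1, -t) of length sqrt (1 + t^2) = k. *)
have h1 : 0 <= k s + z s * sin (psi s) - t * cos (psi s).
  have : (z s * sin (psi s) - t * cos (psi s)) ^+ 2 <= k s ^+ 2.
    have -> : k s ^+ 2 = (1 + t ^+ 2) * (cos (psi s) ^+ 2 + (z s * sin (psi s)) ^+ 2).
      by rewrite zpsi t2; ring.
    rewrite -subr_ge0 [leRHS](_ : _ = (cos (psi s) + t * (z s * sin (psi s))) ^+ 2).
      exact: sqr_ge0.
    by ring.
  rewrite -[leLHS]real_normK ?num_real// ler_pXn2r ?nnegrE ?(ltW ks)//.
  by rewrite ler_norml => /andP[]; lra.
(* The last summand is zero, since t^2 = k^2 - 1. Writing it out makes the identity valid for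
   independent t and k, so that [field] can prove it. *)
rewrite [leRHS](_ : _ = (C s * c1 + S s * s1 - t * (S s * c1 - C s * s1)) *
  (k s + z s * sin (psi s) - t * cos (psi s)) / k s ^+ 2 +
  cos (psi s) * (S s * c1 - C s * s1) * (k s ^+ 2 - 1 - t ^+ 2) / k s ^+ 2); last first.
  by field; rewrite kn tn.
rewrite t2 subrr mulr0 mul0r addr0 divr_ge0 ?sqr_ge0// mulr_ge0//.
Qed.

End Plane.

End Running.

(** * Guarantee of L *)

Section LadyStrategy.
Context {R : realType}.
Implicit Types (w : R -> R) (s t T : R).

Definition asin1 (u : R) : R := asin (clamp (-1) 1 u).

Lemma asin1_bnd u : - (pi / 2) <= asin1 u <= pi / 2.
Proof.
have h : -1 <= clamp (-1) 1 u <= 1 by apply: clamp_in; lra.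
by rewrite asin_geNpi2// asin_lepi2.
Qed.

Lemma asin1_measurable : measurable_fun setT asin1.
Proof.
apply: nondecreasing_measurable => // u v uv; rewrite /asin1.
have hu : -1 <= clamp (-1) 1 u <= 1 by apply: clamp_in; lra.
have hv : -1 <= clamp (-1) 1 v <= 1 by apply: clamp_in; lra.
have ir (x : R) : -1 <= x <= 1 -> asin x \in `[- (pi / 2), pi / 2].
  by move=> xI; rewrite in_itv/= asin_geNpi2// asin_lepi2.
rewrite leNgt -(ltr_sin (ir _ hv) (ir _ hu)) !asinK ?in_itv//.
by rewrite -leNgt clamp_mono.
Qed.

(** [pursuit w k0 t] involves [w] on [k0, t] only, so the answer does not anticipate; the truncation
    inside [asin1] keeps it defined when the solution exceeds 1. *)
Definition lady k0 w t : R :=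
  if t <= k0 then pi else asin1 (pursuit w k0 t * w t).

Lemma M_control_norm w : M_control w -> forall s, `|w s| <= 1.
Proof. by move=> [_ h] s; rewrite ler_norml. Qed.

Lemma lady_control k0 w : M_control w -> L_control (lady k0 w).
Proof.
move=> mw; have [mw1 _] := mw; split.
  apply: measurable_fun_ifT => //.
    exact: measurable_fun_ler.
  apply: measurableT_comp; first exact: asin1_measurable.
  by apply: measurable_funM => //; exact: pursuit_meas mw1 (M_control_norm mw).
move=> t; rewrite /lady; have pi0 := pi_gt0 R; case: ifP => _.
  by apply/andP; split; lra.
have /andP[h1 h2] := asin1_bnd (pursuit w k0 t * w t).
by apply/andP; split; lra.
Qed.

Lemma lady_strategy k0 : 0 <= k0 -> L_strategy (lady k0).
Proof.
move=> k00; split; first exact: lady_control.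
move=> f g t mf mg t0 fg.
have [mf1 _] := mf; have [mg1 _] := mg.
have fg' : {ae @lebesgue_measure R, forall s, k0 <= s <= t -> f s = g s}.
  move: fg; apply: filterS; first exact: (ae_filter_ringOfSetsType (@lebesgue_measure R)).
  by move=> s h /andP[ks st]; apply: h; rewrite st (le_trans k00).
move: fg; apply: filterS; first exact: (ae_filter_ringOfSetsType (@lebesgue_measure R)).
move=> s h /[dup] /h e /andP[_ st]; rewrite /lady e.
by rewrite (pursuit_ae mf1 mg1 (M_control_norm mf) (M_control_norm mg) fg' st).
Qed.

Section Motion.
Variables (mu r0 h : R) (w : R -> R).
Hypotheses (mu0 : 0 < mu) (mw : M_control w) (r00 : 0 <= r0).

Let k0 := r0 / mu.
Let p := pursuit w k0.
Let mw1 : measurable_fun setT w. Proof. by case: mw. Qed.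
Let w1 := M_control_norm mw.
Let k00 : 0 <= k0. Proof. by rewrite divr_ge0// ltW. Qed.

Definition lady_r t : R := if t <= r0 / mu then r0 - mu * t else mu * pursuit w (r0 / mu) t.
Definition lady_th t : R := if t <= r0 / mu then h - intg w 0 t else pi.

Let wbm a b : bmeas a b w.
Proof. by split; [exact: measurable_funTS|exists 1]. Qed.

Let psi := lady k0 w.

Lemma L_control_cos (f : R -> R) : L_control f -> forall a b, bmeas a b (fun s => cos (f s)).
Proof.
move=> [mf _] a b; split.
  apply: measurable_funTS; apply: measurableT_comp => //.
  by apply: continuous_measurable_fun; exact: continuous_cos.
by exists 1 => s _; exact: cos_max.
Qed.

Lemma L_control_sin (f : R -> R) : L_control f -> forall a b, bmeas a b (fun s => sin (f s)).
Proof.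
move=> [mf _] a b; split.
  apply: measurable_funTS; apply: measurableT_comp => //.
  by apply: continuous_measurable_fun; exact: continuous_sin.
by exists 1 => s _; exact: sin_max.
Qed.

Let p_step a b : k0 <= a -> a <= b -> p b - p a = intg (fun s => antirate 0 w s (p s)) a b.
Proof.
move=> ka ab; have [_ ] := pursuit_acd mw1 w1 (le_trans ka ab); exact.
Qed.

Let psi_late s : k0 < s -> 0 <= p s <= 1 ->
  cos (psi s) = antirate 0 w s (p s) /\ sin (psi s) = p s * w s.
Proof.
move=> ks ps; rewrite /psi /lady leNgt ks/= -/(p s) /asin1.
have pw : `|p s * w s| <= 1.
  rewrite normrM mulr_ile1// ger0_norm; by case/andP: ps.
have pw' : -1 <= p s * w s <= 1 by rewrite -ler_norml.
rewrite clampK// cos_asin// asinK ?in_itv//; split => //.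
by rewrite /antirate clampK// addr0 exprMn.
Qed.

Let r_integral t : 0 <= t -> (forall s, k0 <= s <= t -> p s <= 1) ->
  lady_r t = r0 + intg (fun s => mu * cos (psi s)) 0 t.
Proof.
move=> t0 p1.
have hc := L_control_cos (lady_control k0 mw).
have early u : 0 <= u -> u <= k0 -> intg (fun s => mu * cos (psi s)) 0 u = - (mu * u).
  move=> u0 uk; rewrite (@intg_ext _ _ _ _ (fun=> - mu)).
    by rewrite intg_cst// subr0 mulNr.
  move=> s /andP[s0 su]; rewrite /psi /lady (le_trans su uk) cospi; ring.
rewrite /lady_r -/k0; have [tk|/[dup] kt' /ltW kt] := leP t k0.
  by rewrite early.
have hb : bmeas 0 t (fun s => mu * cos (psi s)) by exact: bmeasM (bmeas_cst _ _ _) (hc _ _).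
rewrite (intg_cat k00 kt hb) early// intgZ//.
have -> : intg (fun s => cos (psi s)) k0 t = intg (fun s => antirate 0 w s (p s)) k0 t.
  apply: intg_ext_oo => //; first by have [] := pursuit_acd mw1 w1 kt.
  move=> s /andP[ks st]; have [] := @psi_late s ks _ => //.
  by rewrite (pursuit_ge0 _ mw1 w1) p1// !ltW.
have pk0 : p k0 = 0 by exact: (pursuit0 mw1 w1 (lexx k0)).
rewrite -p_step// pk0 subr0 -/k0 -/p /k0; field.
by rewrite gt_eqF.
Qed.

Lemma lady_r_early t : t <= k0 -> lady_r t = r0 - mu * t.
Proof. by move=> tk; rewrite /lady_r tk. Qed.

(** As long as the pursuit solution is at most 1, the truncation is inactive: sin psi = p w and r =
    mu p make the angular velocity vanish, and th stays at pi. *)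
Lemma lady_trajectory T : 0 <= T -> T <= k0 + pi / 2 ->
  (forall s, k0 <= s <= T -> p s <= 1) ->
  trajectory mu (r0, h) (lady (r0 / mu) w) w T lady_r lady_th.
Proof.
move=> T0 TV p1; have rk0 : r0 - mu * k0 = 0 by rewrite /k0; field; rewrite gt_eqF.
have p_gt0 t : k0 < t -> t <= T -> 0 < p t.
  move=> kt tT; apply: lt_le_trans (pursuit_ge_sin mw1 w1 (ltW kt) _); last by lra.
  apply: sin_gt0_pi; have := pi_gt0 R; move=> pi0; apply/andP; split; lra.
split.
- rewrite /lady_r /lady_th -/k0 k00 intg_empty//=; split; ring.
- move=> t /andP[t0 tT]; rewrite r_integral//.
    by rewrite intg.unlock.
  by move=> s /andP[ks st]; rewrite p1// ks (le_trans st).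
- move=> a b a0 ab bT rpos.
  have hi : bmeas a b (fun s => - w s) by exact: bmeasN.
  have [bk|kb] := ltP b k0.
    rewrite /lady_th -/k0 (ltW bk) (le_trans ab (ltW bk)) (intg_cat a0 ab (wbm _ _)).
    rewrite [X in _ = _ + X](_ : _ = intg (fun s => -1 * w s) a b).
      rewrite intgZ//; ring.
    rewrite intg.unlock; apply: eq_Rintegral => s; rewrite inE/= in_itv/= => /andP[_ sb].
    rewrite /lady -/k0 (le_trans sb (ltW bk)) sinpi; ring.
  (* An interval on which r > 0 cannot contain [k0], so it lies entirely on one side of the passage
     through the center. *)
  have ka : k0 < a.
    rewrite ltNge; apply/negP => ak; have := rpos k0; rewrite ak kb => /(_ isT).
    by rewrite /lady_r -/k0 lexx rk0 ltxx.
  rewrite /lady_th -/k0 !leNgt ka (lt_le_trans ka ab)/=.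
  rewrite [X in _ = _ + X](_ : _ = intg (fun=> 0) a b).
    by rewrite intg_cst// mul0r addr0.
  rewrite intg.unlock; apply: eq_Rintegral => s; rewrite inE/= in_itv/= => /andP[as_ sb].
  have ks : k0 < s by exact: lt_le_trans as_.
  have sT := le_trans sb bT.
  have [|_ ->] := psi_late ks; first by rewrite ltW ?p_gt0// p1// ltW.
  rewrite /lady_r -/k0 leNgt ks/= -/(p s); field.
  by rewrite !gt_eqF// p_gt0.
- move=> t /andP[t0 tT] rt0.
  have tk : t = k0.
    move: rt0; rewrite /lady_r -/k0; case: ifPn => [tk e|].
      apply/eqP; rewrite eq_le tk/=; rewrite /k0 ler_pdivrMr//; lra.
    rewrite -ltNge => kt; have := p_gt0 _ kt (ltW tT); rewrite -/(p t).
    by move=> pt /eqP; rewrite mulf_eq0 !gt_eqF.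
  rewrite tk; split.
    near=> s; have ks : k0 < s by near: s; exact: nbhs_right_gt.
    rewrite /lady_r -/k0 leNgt ks/= mulr_gt0//; apply: p_gt0 => //.
    by near: s; apply: nbhs_right_le; rewrite -tk.
  have e : \forall s \near k0^'+, lady_th s = pi.
    near=> s; have ks : k0 < s by near: s; exact: nbhs_right_gt.
    by rewrite /lady_th -/k0 leNgt ks.
  exact: cvg_near_cst.
Unshelve. all: by end_near. Qed.

End Motion.

End LadyStrategy.

(** * The time that L guarantees *)

Section LadyGuarantee.
Context {R : realType}.
Implicit Types (w : R -> R) (mu rho th s t T : R).

(** For k >= 1 this is k (c - cos B), with B the barrier angle at radius mu k. It tests c = cos th
    against the barrier without [acos], and is continuous along the motion. *)
Definition crossing k c : R := k * c + cos (tangent k) + tangent k * sin (tangent k).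

Lemma acos_cos_bnd th : 0 <= acos (cos th) <= pi.
Proof.
have cI : -1 <= cos th <= 1 by rewrite cos_geN1 cos_le1.
by rewrite acos_ge0// acos_lepi.
Qed.

Lemma cos_acos_cos th : cos (acos (cos th)) = cos th.
Proof. by rewrite acosK// in_itv/= cos_geN1 cos_le1. Qed.

Lemma barrier_le_acos mu rho th : 0 < mu -> mu <= rho -> 0 <= barrier mu rho ->
  (barrier mu rho <= acos (cos th)) = (crossing (rho / mu) (cos th) <= 0).
Proof.
move=> mu0 mr B0.
have k1 : 1 <= rho / mu by rewrite ler_pdivlMr// mul1r.
have kk : 0 < rho / mu by rewrite (lt_le_trans ltr01).
have /andP[A0 A1] := acos_cos_bnd th.
have B1 : barrier mu rho <= pi.
  by rewrite -(barrier_mu mu0); exact: barrier_le.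
have aI : acos (cos th) \in `[0, pi] by rewrite in_itv/= A0.
have bI : barrier mu rho \in `[0, pi] by rewrite in_itv/= B0.
rewrite leNgt -(ltr_cos aI bI) -leNgt cos_acos_cos barrierE//.
have := cos_barrier 0 k1; rewrite !sub0r cosN sinN mulrN opprK => e.
rewrite -[LHS](ler_pM2l kk) cosB cospi sinpi mul0r addr0 mulN1r mulrN.
move: e; rewrite cosN => ->.
by rewrite /crossing; apply/idP/idP; lra.
Qed.

Lemma crossing_continuous (K TH : R -> R) : continuous K -> continuous TH ->
  continuous (fun t => crossing (K t) (cos (TH t))).
Proof.
move=> cK cT t.
have ct : tangent (K s) @[s --> t] --> tangent (K t).
  apply: (@continuous_cvg _ _ _ _ _ _ (@Num.sqrt R)); first exact: sqrt_continuous.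
  apply: cvgB; last exact: cvg_cst.
  by apply: cvgM; exact: cK.
rewrite /crossing; apply: cvgD; first apply: cvgD.
- apply: cvgM; first exact: cK.
  by apply: continuous_cvg; [exact: continuous_cos|exact: cT].
- by apply: continuous_cvg; [exact: continuous_cos|exact: ct].
- by apply: cvgM => //; apply: continuous_cvg; [exact: continuous_sin|exact: ct].
Qed.

Lemma lady_guarantee mu r0 h : 0 < mu -> mu < 1 -> state_space mu (r0, h) ->
  0 < barrier mu 1 ->
  L_guarantees mu (r0, h) (lady (r0 / mu)) (r0 / mu + pi / 2).
Proof.
move=> mu0 mu1 [/= /andP[r00 r01] hI hB] B1 w mw.
have [mw1 _] := mw; have w1 := M_control_norm mw.
set k0 := r0 / mu.
have k00 : 0 <= k0 by rewrite divr_ge0// ltW.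
have r0E : r0 = mu * k0 by rewrite /k0; field; rewrite gt_eqF.
pose r := lady_r mu r0 w; pose th := lady_th mu r0 h w.
have pi0 := pi_gt0 R.
have rE t : t <= k0 -> r t = r0 - mu * t by exact: lady_r_early.
have kE t : t <= k0 -> r t / mu = k0 - t.
  by move=> tk; rewrite rE// /k0; field; rewrite gt_eqF.
have Bpos rho : mu <= rho -> rho <= 1 -> 0 < barrier mu rho.
  by move=> m1 m2; rewrite (lt_le_trans B1)// barrier_le.
have rle1 t : 0 <= t -> t <= k0 -> r t <= 1.
  move=> t0 tk; rewrite rE//; have := mulr_ge0 (ltW mu0) t0; lra.
have rge0 t : 0 <= t -> t <= k0 -> 0 <= r t.
  by move=> t0 tk; rewrite rE// r0E -mulrBr mulr_ge0 ?subr_ge0 ?(ltW mu0).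
have mur t : t <= k0 -> (mu < r t) = (t < k0 - 1).
  move=> tk; rewrite rE// r0E -mulrBr -[ltLHS]mulr1 ltr_pM2l//.
  by apply/idP/idP; lra.
have mur' t : t <= k0 -> (mu <= r t) = (t <= k0 - 1).
  move=> tk; rewrite rE// r0E -mulrBr -[leLHS]mulr1 ler_pM2l//.
  by apply/idP/idP; lra.
pose chi t := crossing (r t / mu) (cos (th t)).
have below t : 0 <= t -> t <= k0 - 1 ->
    (barrier mu (r t) <= acos (cos (th t))) = (chi t <= 0).
  move=> t0 t1; have tk : t <= k0 by lra.
  by rewrite barrier_le_acos// ?mur'// ltW// Bpos ?mur'// rle1.
have inspace t : 0 <= t -> t <= k0 -> (t <= k0 - 1 -> 0 < chi t) ->
    state_space mu (state r th t) /\ state r th t <> E mu.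
  move=> t0 tk ct; split.
    split=> /=; first by rewrite rge0// rle1.
      exact: acos_cos_bnd.
    rewrite mur// => t1; rewrite ltNge below ?(ltW t1)// -ltNge.
    by rewrite ct// ltW.
  move=> [rt tht]; have t1 : t <= k0 - 1 by rewrite -mur'// rt.
  have := ct t1; rewrite ltNge -below// tht rt barrier_mu//.
  by rewrite lexx.
have traj T : 0 <= T -> T <= k0 + pi / 2 ->
    (forall s, k0 <= s <= T -> pursuit w k0 s <= 1) ->
    trajectory mu (r0, h) (lady k0 w) w T r th.
  by move=> T0 TV p1; exact: lady_trajectory.
have p_early s : s <= k0 -> pursuit w k0 s <= 1.
  by move=> sk; rewrite (pursuit0 mw1 w1 sk).
(* On the way in, r >= mu exactly until time k0 - 1. Either M lets L meet the barrier before that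
   time is over, or she reaches the center below the barrier. *)
have [[t tI ct]|nc] := pselect (exists2 t, 0 <= t <= k0 - 1 & chi t <= 0).
- have k1 : 0 <= k0 - 1 by case/andP: tI => h1 h2; exact: le_trans h2.
  have [||T [TI XT bT]] := @first_hit R 0 (k0 - 1)
      (fun t => crossing (r (clamp 0 (k0 - 1) t) / mu) (cos (th (clamp 0 (k0 - 1) t)))) k1.
    have cl s := clamp_in s k1.
    have e : (fun s => crossing (r (clamp 0 (k0 - 1) s) / mu) (cos (th (clamp 0 (k0 - 1) s)))) =
       (fun s => crossing (k0 - clamp 0 (k0 - 1) s) (cos (h - intg w 0 (clamp 0 (k0 - 1) s)))).
      apply/funext => s; have /andP[c0 c1] := cl s.
      have ck : clamp 0 (k0 - 1) s <= k0 by lra.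
      by rewrite kE// /th /lady_th -/k0 ck.
    rewrite e; apply: crossing_continuous.
      exact: (acd_clamp_continuous k1 (acdB (acd_cst 0 (k0 - 1) k0) (acd_id 0 (k0 - 1)))).
    have wb : bmeas 0 (k0 - 1) w by split; [exact: measurable_funTS|exists 1].
    exact: (acd_clamp_continuous k1 (acdB (acd_cst 0 (k0 - 1) h) (acd_primitive wb))).
  + by exists t => //; rewrite clampK.
  move: XT; rewrite clampK// -/(chi T) => XT.
  have /andP[T0 T1] := TI; have Tk : T <= k0 by lra.
  exists T, r, th; split.
    split=> //; first by apply: traj => //; [lra|move=> s /andP[_ sT]; apply: p_early; lra].
    move=> s /andP[s0 sT]; apply: inspace => //; first by lra.
    by move=> s1; have := bT _ s0 sT; rewrite clampK// s0.
  have BT : barrier mu (r T) <= acos (cos (th T)) by rewrite below.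
  (* Before k0 - 1 the radius exceeds mu and the barrier has been crossed. At k0 - 1 the radius is
     mu, where the barrier is pi, so the state is E itself. *)
  have [T2|T2] := ltP T (k0 - 1); first by right; split=> //; rewrite mur.
  have TE : T = k0 - 1 by apply/eqP; rewrite eq_le T1.
  have rT : r T = mu by rewrite rE// TE r0E; ring.
  left; split; last by lra.
  rewrite /state /E rT; congr (_, _); apply/eqP; rewrite eq_le.
  have /andP[_ ->] := acos_cos_bnd (th T).
  by rewrite /= -[X in X <= _](barrier_mu mu0) -{2}rT BT.
(* L passes through the center and stays antipodal; E is reached when the pursuit solution first
   attains 1, at the latest when the sine does. *)
- have V0 : k0 <= k0 + pi / 2 by lra.
  have hacd := pursuit_acd mw1 w1 V0.
  have [||T [TI XT bT]] := @first_hit R k0 (k0 + pi / 2)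
      (fun t => 1 - pursuit w k0 (clamp k0 (k0 + pi / 2) t)) V0.
    move=> t; apply: cvgB; first exact: cvg_cst.
    exact: (acd_clamp_continuous V0 hacd).
  + exists (k0 + pi / 2); first by rewrite V0 lexx.
    rewrite clampK ?V0 ?lexx// subr_le0.
    have := pursuit_ge_sin mw1 w1 V0.
    by rewrite addrC addKr addrC sin_pihalf; apply.
  move: XT; rewrite clampK// subr_le0 => pT1.
  have /andP[kT TV] := TI.
  have p1 s : k0 <= s -> s < T -> pursuit w k0 s < 1.
    by move=> ks sT; have := bT _ ks sT; rewrite clampK ?subr_gt0// ks; lra.
  have Tk : k0 < T.
    rewrite lt_neqAle kT andbT; apply/negP => /eqP kTe.
    by move: pT1; rewrite -kTe (pursuit0 mw1 w1 (lexx _)) ler10.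
  have pT : pursuit w k0 T = 1.
    apply/eqP; rewrite eq_le pT1 andbT.
    have ca := @acd_clamp_continuous _ _ _ _ _ V0 hacd T.
    rewrite -[X in pursuit w k0 X](clampK TI).
    apply: (cvgr_to_le (cvg_at_left_filter ca)).
    near=> s; have sT : s < T by near: s; exact: nbhs_left_lt.
    have ks : k0 <= s by near: s; exact: nbhs_left_ge.
    by rewrite clampK ?ks/=; [apply/ltW/p1|lra].
  have chipos t : 0 <= t -> t <= k0 - 1 -> 0 < chi t.
    by move=> t0 t1; rewrite ltNge; apply/negP => c; apply: nc; exists t => //; rewrite t0.
  exists T, r, th; split.
    split; first by lra.
      apply: traj => //; first by lra.
      move=> s /andP[ks]; rewrite le_eqVlt => /predU1P[->|sT]; first by rewrite pT.
      exact/ltW/p1.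
    move=> t /andP[t0 tT]; have [tk|kt] := leP t k0.
      by apply: inspace => //; exact: chipos.
    have rt : r t = mu * pursuit w k0 t by rewrite /r /lady_r -/k0 leNgt kt.
    have rmu : r t < mu by rewrite rt gtr_pMr// p1// ltW.
    split; last by move=> [e _]; move: rmu; rewrite e ltxx.
    split=> /=.
    - rewrite rt mulr_ge0 ?(ltW mu0) ?(pursuit_ge0 _ mw1 w1)//=.
      by rewrite -rt (le_trans (ltW rmu))// ltW.
    - exact: acos_cos_bnd.
    - by move=> e; have := lt_trans rmu e; rewrite ltxx.
  left; split; last by [].
  rewrite /state /E /r /th /lady_r /lady_th -/k0 leNgt Tk/= pT mulr1.
  by rewrite cosK// in_itv/= lexx ltW.
Unshelve. all: by end_near. Qed.

End LadyGuarantee.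

(** * Guarantee of M *)

Section Law.
Context {R : realType}.
Implicit Types (kap y z d : R).

(* The Man's velocity in terms of [y = th - pi], up to sign: run away from the
   antipodal line [y = 0], except near [th = 0] where the law is Lipschitz. *)
Definition law kap y : R :=
  if 0 < cos y then sgr (sin y) else clamp (-1) 1 (sin y / kap).

Lemma sgr_cases (z : R) : sgr z = 1 \/ sgr z = -1.
Proof. by rewrite /sgr; case: ifP; [left|right]. Qed.

Lemma norm_sgr (z : R) : `|sgr z| = 1.
Proof. by have [] := sgr_cases z => ->; rewrite ?normrN normr1. Qed.

Lemma law_bnd kap y : `|law kap y| <= 1.
Proof.
rewrite /law; case: ifP => _; first by rewrite norm_sgr.
by rewrite ler_norml; apply: clamp_in; lra.
Qed.

Lemma law_run kap y : 0 < kap -> 0 < cos y \/ kap <= `|sin y| ->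
  law kap y = sgr (sin y).
Proof.
move=> k0 run; rewrite /law; case: ifPn => // cy; case: run => [cy'|].
  by rewrite cy' in cy.
have N1 : -1 <= 1 :> R by lra.
rewrite /sgr; case: ifPn => [sy|]; last rewrite -ltNge => sy.
- rewrite ger0_norm// => ks; have h : 1 <= sin y / kap by rewrite ler_pdivlMr// mul1r.
  by rewrite /clamp (min_l h) max_r.
- rewrite ltr0_norm// => ks; have h : sin y / kap <= -1.
    by rewrite ler_pdivrMr// mulN1r lerNr.
  by rewrite /clamp (min_r (le_trans h N1)) max_l.
Qed.

Lemma sin_lip y z : `|sin z - sin y| <= `|z - y|.
Proof.
rewrite -[leRHS]mul1r; apply: (@derive_lip R (Num.min y z) (Num.max y z) 1 (@sin R) (@cos R)).
- by move=> p _; exact: cos_max.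
- by rewrite ge_min le_max lexx.
- by rewrite ge_min le_max lexx !orbT.
Qed.

Lemma cos_lip y z : `|cos z - cos y| <= `|z - y|.
Proof.
rewrite -[leRHS]mul1r; apply: (@derive_lip R (Num.min y z) (Num.max y z) 1 (@cos R) (fun p => - sin p)).
- by move=> p _; rewrite normrN; exact: sin_max.
- by rewrite ge_min le_max lexx.
- by rewrite ge_min le_max lexx !orbT.
Qed.

(** The law has slope at least -1 / kap, its jumps at y = 0 modulo 2 pi go upward, and its two
    branches agree at cos y = 0, where |sin y| = 1 >= kap. *)
Lemma law_mono kap y z : 0 < kap -> kap <= 1 / 4 -> y <= z ->
  law kap y + kap^-1 * y <= law kap z + kap^-1 * z.
Proof.
move=> k0 k4 yz; pose d := z - y.
have d0 : 0 <= d by rewrite subr_ge0.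
suff : law kap y - law kap z <= d / kap.
  by rewrite mulrC /d mulrBr; lra.
have := law_bnd kap y; have := law_bnd kap z; rewrite !ler_norml => /andP[z1 z2] /andP[y1 y2].
have dk0 : 0 <= d / kap by rewrite divr_ge0// ltW.
(* The law varies by at most 2, so only increments below 2 kap <= 1/2 matter. *)
have [d2|d2] := leP (2 * kap) d.
  have : 2 <= d / kap by rewrite ler_pdivlMr.
  lra.
have d12 : d < 1 / 2 by lra.
have := sin_lip y z; rewrite -/d (ger0_norm d0) ler_norml => /andP[s1 s2].
have := cos_lip y z; rewrite -/d (ger0_norm d0) ler_norml => /andP[c1 c2].
have zd : z = y + d by rewrite /d; ring.
have pi2 := pi_ge2 R.
have sd : 0 <= sin d by apply: sin_ge0_pi; rewrite d0/=; lra.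
have [cy|cy] := ltP 0 (cos y); have [cz|cz] := ltP 0 (cos z).
- have -> : law kap y = sgr (sin y) by apply: law_run => //; left.
  have -> : law kap z = sgr (sin z) by apply: law_run => //; left.
  rewrite /sgr; case: ifPn => [sy|_]; case: ifPn => [_|]; try lra.
  rewrite -ltNge => sz; exfalso.
  have : sin d = sin z * cos y - cos z * sin y.
    by rewrite zd -{1}(addrK y d) (addrC d) sinB.
  have : sin z * cos y < 0 by rewrite nmulr_rlt0.
  have : 0 <= cos z * sin y by rewrite mulr_ge0// ltW.
  lra.
- have -> : law kap y = sgr (sin y) by apply: law_run => //; left.
  (* Between y and z the cosine changes sign within a distance 1/2, so |sin y| is close to 1, and
     sin z is still at least 1/4 >= kap: both values of the law are those of full running. *)
  rewrite {1}/sgr; case: ifPn => [sy|_]; last by lra.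
  have sz : 1 / 4 <= sin z.
    have := cos2Dsin2 y; have : cos y <= 1 / 2 by lra.
    by nra.
  have -> : law kap z = sgr (sin z).
    by apply: law_run => //; right; rewrite ger0_norm; lra.
  by rewrite /sgr (_ : 0 <= sin z) ?subrr//; lra.
- have -> : law kap z = sgr (sin z) by apply: law_run => //; left.
  rewrite {1}/sgr; case: ifPn => [_|]; first by lra.
  rewrite -ltNge => sz.
  have sy : sin y <= - (1 / 4).
    have := cos2Dsin2 z; have : cos z <= 1 / 2 by lra.
    by nra.
  have -> : law kap y = sgr (sin y).
    by apply: law_run => //; right; rewrite ler0_norm; lra.
  have sy0 : (0 <= sin y) = false by apply/negbTE; rewrite -ltNge; lra.
  by rewrite /sgr sy0 subrr.
- rewrite /law !ltNge cy cz/=.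
  have N1 : -1 <= 1 :> R by lra.
  have := clamp_lip (sin z / kap) (sin y / kap) N1.
  have ki : 0 <= kap^-1 by rewrite invr_ge0 ltW.
  rewrite -mulrBl normrM (ger0_norm ki) => h.
  have : `|sin z - sin y| * kap^-1 <= d / kap.
    by rewrite ler_wpM2r// -(ger0_norm d0); exact: sin_lip.
  move=> /(le_trans h); rewrite ler_norml => /andP[]; lra.
Qed.

(** Continuity can fail only where sin y = 0 < cos y; from the right the sine is nonnegative there,
    and the law already has the value 1 at the point itself. *)
Lemma law_rc kap y (u : nat -> R) : 0 < kap -> kap <= 1 / 4 ->
  (forall n, y <= u n) -> u n @[n --> \oo] --> y ->
  law kap (u n) @[n --> \oo] --> law kap y.
Proof.
move=> k0 k4 yu uy.
have cc : cos (u n) @[n --> \oo] --> cos y.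
  by apply: continuous_cvg uy; exact: continuous_cos.
have cs : sin (u n) @[n --> \oo] --> sin y.
  by apply: continuous_cvg uy; exact: continuous_sin.
have [cy|cy] := ltP (cos y) 0.
  have -> : law kap y = clamp (-1) 1 (sin y / kap) by rewrite /law ltNge (ltW cy).
  have N1 : -1 <= 1 :> R by lra.
  have ccl : continuous (clamp (-1) 1 : R -> R).
    by apply: (@lip_continuous _ _ 1) => p q; rewrite mul1r; exact: clamp_lip.
  have c1 : clamp (-1) 1 (sin (u n) / kap) @[n --> \oo] --> clamp (-1) 1 (sin y / kap).
    by apply: continuous_cvg; [exact: ccl|apply: cvgMl].
  apply: cvg_trans c1; apply: near_eq_cvg; near=> n.
  by rewrite /law ltNge (_ : cos (u n) <= 0)//; near: n; exact: cvgr_le cc _ cy.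
have runy : 0 < cos y \/ kap <= `|sin y|.
  move: cy; rewrite le_eqVlt => /predU1P[cy|]; [right|by left].
  by rewrite (eqP (_ : `|sin y| == 1)) ?norm_sin_eq1 -?cy//; lra.
have runu : \forall n \near \oo, 0 < cos (u n) \/ kap <= `|sin (u n)|.
  move: cy; rewrite le_eqVlt => /predU1P[cy|cy]; last first.
    by move: (cc) => /cvgr_gt /(_ _ cy); apply: filterS => n; left.
  have e : `|sin y| = 1 by apply/eqP; rewrite norm_sin_eq1 -cy.
  have k1 : kap < `|sin y| by rewrite e; lra.
  have cn : `|sin (u n)| @[n --> \oo] --> `|sin y| by exact: cvg_norm.
  move: cn => /cvgr_ge /(_ _ k1); apply: filterS => n h.
  by right.
have sg : \forall n \near \oo, sgr (sin (u n)) = sgr (sin y).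
  have [sy|sy|sy] := ltgtP (sin y) 0.
  - move: (cs) => /cvgr_lt /(_ _ sy); apply: filterS => n su.
    by rewrite /sgr !leNgt su sy.
  - move: (cs) => /cvgr_gt /(_ _ sy); apply: filterS => n su.
    by rewrite /sgr !ltW.
  - have y1 : y < y + 1 by rewrite ltrDl.
    move: (uy) => /cvgr_lt /(_ _ y1); apply: filterS => n un.
    rewrite /sgr sy lexx -[u n](subrK y) addrC sinD sy mul0r add0r mulr_ge0//.
    by apply: sin_ge0_pi; rewrite subr_ge0 yu/=; have := pi_ge2 R; lra.
rewrite (law_run k0 runy).
apply: cvg_near_cst; near=> n.
rewrite law_run//; first by near: n.
by near: n.
Unshelve. all: by end_near. Qed.

(** After truncation from below the inverse is a nonincreasing function of X, hence measurable; at
    each point the truncations are eventually exact. *)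
Lemma measurable_funV (D : set R) (X : R -> R) : measurable D -> measurable_fun D X ->
  (forall s, D s -> 0 < X s) -> measurable_fun D (fun s => (X s)^-1).
Proof.
move=> mD mX X0; pose e n : R := n.+1%:R^-1.
have e0 n : 0 < e n by rewrite invr_gt0.
apply: (@measurable_fun_cvg _ _ _ _ (fun n s => (Num.max (X s) (e n))^-1)).
  move=> n; pose f (p : R) : R := (Num.max p (e n))^-1.
  suff mf : measurable_fun setT f by exact: (measurableT_comp mf mX).
  apply: nonincreasing_measurable => // p q pq; rewrite /f.
  rewrite lef_pV2 ?posrE ?lt_max ?e0 ?orbT//.
  by rewrite ge_max !le_max pq lexx orbT.
move=> s Ds; have Xs := X0 _ Ds.
have ce : e n @[n --> \oo] --> (0 : R) by exact: cvg_harmonic.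
apply: cvg_near_cst; near=> n; rewrite max_l//.
by near: n; exact: cvgr_le ce _ Xs.
Unshelve. all: by end_near. Qed.

Lemma law_measurable (D : set R) (K Y : R -> R) : measurable D ->
  measurable_fun D K -> (forall s, D s -> 0 < K s) -> measurable_fun D Y ->
  measurable_fun D (fun s => law (K s) (Y s)).
Proof.
move=> mD mK K0 mY.
have mc : measurable_fun D (fun s => cos (Y s)).
  apply: measurableT_comp => //; apply: continuous_measurable_fun; exact: continuous_cos.
have ms : measurable_fun D (fun s => sin (Y s)).
  apply: measurableT_comp => //; apply: continuous_measurable_fun; exact: continuous_sin.
have DI (B : set R) : D `&` B `<=` D by move=> x [].
have msg : measurable_fun setT (@sgr R).
  by apply: measurable_fun_ifT => //; exact: measurable_fun_ler.
have mcl : measurable_fun setT (clamp (-1) 1 : R -> R).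
  apply: continuous_measurable_fun; apply: (@lip_continuous _ _ 1) => p q.
  by rewrite mul1r; apply: clamp_lip; lra.
have mq : measurable_fun D (fun s => sin (Y s) / K s).
  by apply: measurable_funM => //; exact: measurable_funV.
apply: measurable_fun_if => //.
- exact: measurable_fun_ltr.
- by apply: measurable_funS (measurableT_comp msg ms).
- by apply: measurable_funS (measurableT_comp mcl mq).
Qed.

End Law.

(** * M's strategy: construction, measurability, nonanticipation *)

Section ManStrategy.
Context {R : realType}.
Variables (mu r0 h c : R).
Implicit Types (psi r th : R -> R) (a b l s t T v : R).

(** A function of L's control alone, defined even for controls that admit no play, for which it may
    become negative. During a play it is the radius. *)
Definition dist0 psi t : R := r0 + intg (fun s => mu * cos (psi s)) 0 t.

Definition spin psi s : R := mu / dist0 psi s * sin (psi s).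

(** If L has not been at the center, the set is empty and its [sup] is 0, which is the start of
    play, as intended. *)
Definition last_center psi t : R :=
  sup [set s | 0 <= s <= t /\ dist0 psi s <= 0].

(* [l] is the start of play or the last time at the center. *)
Definition excursion psi l t : Prop :=
  [/\ 0 <= l, l <= t, forall s, l < s -> s <= t -> 0 < dist0 psi s &
    (l = 0 /\ 0 < dist0 psi l) \/ dist0 psi l <= 0].

(* [th - pi] for a motionless Man; L leaves the center along [th = pi].  When
   the limit does not exist, no motion continues from the center. *)
Definition free_angle psi l t : R :=
  if 0 < dist0 psi l then h - pi + intg (spin psi) l t
  else if t <= l then 0 else lim (intg (spin psi) a t @[a --> l^'+]).

(* Before the first visit to the center the width vanishes with the radius, so
   that M runs as soon as |th| >= r / mu. *)
Definition width psi l s : R :=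
  if 0 < dist0 psi l then c * clamp 0 1 (dist0 psi s) else c.

(** The phase before time [h] brings M face to face with an L who swims straight inward from angle
    [h]; it makes the corner of the tributary, and is empty when [h = 0]. *)
Definition run psi l s v : R :=
  if s < h then -1 else law (width psi l s) (free_angle psi l s + v).

(* M's own contribution to the angle.  The law being discontinuous, it has to be
   selected among several solutions, by a rule that does not anticipate. *)
Definition dodge psi l : R -> R :=
  maxsol 1 (fun s => (width psi l s)^-1) (run psi l) l.

(** The sign is reversed because omega enters the angular velocity negatively. At the center the
    angle has no meaning, and the value 0 is a convention. *)
Definition man psi t : R :=
  if (0 <= t) && (0 < dist0 psi t) then
    - run psi (last_center psi t) t (dodge psi (last_center psi t) t)
  else 0.

Hypotheses (mu0 : 0 < mu) (r00 : 0 <= r0) (c0 : 0 < c) (c4 : c <= 1 / 4).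

Section FixedControl.
Variable psi : R -> R.
Hypothesis Lpsi : L_control psi.

Let rate_bm a b : bmeas a b (fun s => mu * cos (psi s)).
Proof. exact: bmeasM (bmeas_cst _ _ _) (L_control_cos Lpsi _ _). Qed.

Lemma dist0_acd a b : 0 <= a -> acd a b (dist0 psi) (fun s => mu * cos (psi s)).
Proof.
move=> a0; apply: (acdS a0 (lexx b)).
apply: acd_ext (acdD (acd_cst 0 b r0) (acd_primitive (rate_bm 0 b))) => // t _.
by rewrite add0r.
Qed.

Lemma dist0_neg t : t <= 0 -> dist0 psi t = r0.
Proof. by move=> t0; rewrite /dist0 intg_empty// addr0. Qed.

Lemma dist0_lip s t : `|dist0 psi t - dist0 psi s| <= mu * `|t - s|.
Proof.
wlog st : s t / s <= t.
  by move=> H; case/orP: (le_total s t) => /H//; rewrite distrC (distrC t).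
have key a b : 0 <= a -> a <= b -> `|dist0 psi b - dist0 psi a| <= mu * `|b - a|.
  move=> a0 ab; have [[mx _] ->//] := dist0_acd b a0.
  rewrite (ger0_norm (_ : 0 <= b - a)) ?subr_ge0//; apply: intg_norm => //.
  by move=> u _; rewrite normrM (gtr0_norm mu0) ger_pMr// cos_max.
have [s0|s0] := leP 0 s; first exact: key.
have [t0|t0] := leP 0 t; last first.
  rewrite (dist0_neg (ltW s0)) (dist0_neg (ltW t0)) subrr normr0.
  exact: mulr_ge0 (ltW mu0) (normr_ge0 _).
rewrite (dist0_neg (ltW s0)) -(dist0_neg (lexx 0)) (le_trans (key _ _ (lexx 0) t0))//.
by rewrite ler_wpM2l ?(ltW mu0)// !ger0_norm ?subr_ge0//; lra.
Qed.

Lemma dist0_continuous : continuous (dist0 psi).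
Proof. exact: lip_continuous dist0_lip. Qed.

Lemma dist0_lower a b : a <= b -> (forall s, a <= s <= b -> 0 < dist0 psi s) ->
  exists2 m, 0 < m & forall s, a <= s <= b -> m <= dist0 psi s.
Proof.
move=> ab pos; have [] := @EVT_min R (dist0 psi) a b ab.
  by apply: continuous_subspaceT; exact: dist0_continuous.
move=> m; rewrite in_itv/= => mI hm; exists (dist0 psi m); first exact: pos.
by move=> s sI; apply: hm; rewrite in_itv.
Qed.

Lemma dist0_measurable (D : set R) : measurable_fun D (dist0 psi).
Proof.
apply: measurable_funTS; apply: continuous_measurable_fun; exact: dist0_continuous.
Qed.

Lemma spin_bmeas a b : (forall s, a <= s <= b -> 0 < dist0 psi s) ->
  bmeas a b (spin psi).
Proof.
move=> pos; have [ab|ba] := leP a b; last first.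
  split; last by exists 0 => s /andP[s1 s2]; have := le_trans s1 s2; lra.
  by rewrite set_itv_ge; [exact: measurable_fun_set0|rewrite bnd_simp -ltNge].
have [m m0 hm] := dist0_lower ab pos.
apply: bmeasM (L_control_sin Lpsi a b); apply: bmeasM; first exact: bmeas_cst.
split.
  apply: (measurable_funV (measurable_itv _) (@dist0_measurable _)) => s.
  by rewrite /= in_itv/=; exact: pos.
exists m^-1 => s sI; have rs := pos _ sI.
by rewrite gtr0_norm ?invr_gt0// lef_pV2 ?posrE//; exact: hm.
Qed.

Lemma excursionS l s t : excursion psi l t -> l <= s -> s <= t -> excursion psi l s.
Proof.
move=> [l0 lt pos st] ls st'; split=> // u lu us; apply: pos => //.
exact: le_trans st'.
Qed.

Lemma last_center_excursion t : 0 <= t -> 0 < dist0 psi t ->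
  excursion psi (last_center psi t) t.
Proof.
move=> t0 rt; rewrite /last_center; set S := [set s | _].
have [[s0 Ss0]|S0] := pselect (S !=set0); last first.
  have -> : S = set0 by apply/seteqP; split => // s Ss; apply: S0; exists s.
  (* No visit to the center so far: the excursion begins at time 0, with positive radius. *)
  rewrite sup0; split=> //.
    move=> s s0 st; rewrite ltNge; apply/negP => rs; apply: S0; exists s.
    by split=> //; rewrite (ltW s0).
  by left; split=> //; rewrite ltNge; apply/negP => rs; apply: S0; exists 0; rewrite /S/= lexx t0.
have hS : has_sup S by split; [exists s0|exists t => s [/andP[]]].
have subS := ub_le_sup hS.2.
split.
- by case: (Ss0) => /andP[h1 _] _; exact: le_trans (subS _ Ss0).
- by apply: ge_sup => //; [exists s0|move=> s [/andP[]]].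
- move=> s ls st; rewrite ltNge; apply/negP => rs.
  have : S s.
    split=> //; rewrite st andbT (le_trans _ (ltW ls))//.
    by case: (Ss0) => /andP[h1 _] _; exact: le_trans (subS _ Ss0).
  by move/subS; lra.
- right; rewrite leNgt; apply/negP => rl.
  have := @dist0_continuous (sup S) => /cvgr_gt /(_ _ rl) /nbhs_ballP[e /= e0 he].
  have [s Ss sl] := sup_adherent e0 hS.
  have := subS _ Ss => sl'.
  have : 0 < dist0 psi s by apply: he; rewrite /ball/= ger0_norm ?subr_ge0//; lra.
  by case: Ss => _ ? ?; lra.
Qed.

Lemma excursion_last_center l t : excursion psi l t -> 0 < dist0 psi t ->
  last_center psi t = l.
Proof.
move=> [l0 lt pos [[lE rl]|rl]] rt; rewrite /last_center.
  rewrite (_ : [set s | _] = set0) ?sup0//; apply/seteqP; split => // s.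
  move=> [/andP[s0 st] rs]; have : 0 < dist0 psi s.
    have : l <= s by rewrite lE.
    by rewrite le_eqVlt => /predU1P[<-//|ls]; exact: pos.
  by rewrite ltNge rs.
have ubl : ubound [set s | 0 <= s <= t /\ dist0 psi s <= 0] l.
  move=> s [/andP[s0 st] rs]; rewrite leNgt; apply/negP => ls.
  by have := pos _ ls st; lra.
apply/eqP; rewrite eq_le; apply/andP; split.
  by apply: ge_sup => //; exists l; rewrite /= l0 lt.
by apply: ub_le_sup; [exists l|rewrite /= l0 lt].
Qed.

Lemma excursion_pos l b : excursion psi l b -> 0 < dist0 psi l ->
  forall s, l <= s <= b -> 0 < dist0 psi s.
Proof.
move=> [_ _ pos _] rl s /andP[]; rewrite le_eqVlt => /predU1P[<-//|]; exact: pos.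
Qed.

Let lim_split l s t : l < s -> s <= t -> (forall u, l < u -> u <= t -> 0 < dist0 psi u) ->
  \forall a \near l^'+, intg (spin psi) a t = intg (spin psi) a s + intg (spin psi) s t.
Proof.
move=> ls st pos; near=> a.
have la : l < a by near: a; exact: nbhs_right_gt.
have as_ : a <= s by near: a; exact: nbhs_right_le.
apply: intg_cat => //; apply: spin_bmeas => u /andP[au ut]; apply: pos => //.
exact: lt_le_trans au.
Unshelve. all: by end_near. Qed.

(** The integrals from a to s and from a to t differ by a constant independent of a, so their limits
    as a tends to l exist for all end times or for none. In the second case [lim] takes its default
    value 0 throughout. *)
Lemma free_angle_step l b : excursion psi l b -> dist0 psi l <= 0 ->
  (forall s t, l < s -> s <= t -> t <= b ->
    free_angle psi l t - free_angle psi l s = intg (spin psi) s t) \/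
  (forall s, l < s -> s <= b -> free_angle psi l s = 0).
Proof.
move=> [l0 lb pos _] rl.
have faE s : l < s -> free_angle psi l s = lim (intg (spin psi) a s @[a --> l^'+]).
  by move=> ls; rewrite /free_angle ltNge rl/= leNgt ls.
have sh s t : l < s -> s <= t -> t <= b ->
    \forall a \near l^'+, intg (spin psi) a t = intg (spin psi) a s + intg (spin psi) s t.
  by move=> ls st tb; apply: lim_split => // u lu ut; apply: pos => //; exact: le_trans tb.
have up s t : l < s -> s <= t -> t <= b ->
    forall z : R, intg (spin psi) a s @[a --> l^'+] --> z ->
    intg (spin psi) a t @[a --> l^'+] --> z + intg (spin psi) s t.
  move=> ls st tb z cz.
  have : intg (spin psi) a s + intg (spin psi) s t @[a --> l^'+] --> z + intg (spin psi) s t.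
    by apply: cvgD => //; exact: cvg_cst.
  apply: cvg_trans; apply: near_eq_cvg; apply: filterS (sh _ _ ls st tb) => a ->.
  by [].
have down s t : l < s -> s <= t -> t <= b ->
    forall z : R, intg (spin psi) a t @[a --> l^'+] --> z ->
    intg (spin psi) a s @[a --> l^'+] --> z - intg (spin psi) s t.
  move=> ls st tb z cz.
  have : intg (spin psi) a t - intg (spin psi) s t @[a --> l^'+] --> z - intg (spin psi) s t.
    by apply: cvgB => //; exact: cvg_cst.
  apply: cvg_trans; apply: near_eq_cvg; apply: filterS (sh _ _ ls st tb) => a ->.
  by rewrite addrK.
have [[z cz]|nc] := pselect (exists z : R, intg (spin psi) a b @[a --> l^'+] --> z).
  left=> s t ls st tb; have lt := lt_le_trans ls st.
  have cs := down _ _ ls (le_trans st tb) (lexx b) z cz.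
  have ct := up _ _ ls st tb _ cs.
  rewrite !faE// (cvg_lim (@Rhausdorff R) cs) (cvg_lim (@Rhausdorff R) ct); ring.
right=> s ls sb; rewrite faE// dvgP//= => cs.
by apply: nc; exists (lim (intg (spin psi) a s @[a --> l^'+]) + intg (spin psi) s b);
  exact: up cs.
Qed.

Lemma free_angle_start l b : excursion psi l b -> 0 < dist0 psi l ->
  acd l b (free_angle psi l) (spin psi).
Proof.
move=> ex rl; have sb := spin_bmeas (excursion_pos ex rl).
apply: acd_ext (acdD (acd_cst l b (h - pi)) (acd_primitive sb)) => t _.
  by rewrite /free_angle rl.
by rewrite add0r.
Qed.

Lemma free_angle_acd l a b : excursion psi l b -> l < a ->
  acd a b (free_angle psi l) (spin psi) \/ acd a b (free_angle psi l) (fun=> 0).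
Proof.
move=> ex la; have [rl|rl] := ltP 0 (dist0 psi l).
  by left; exact: (acdS (ltW la) (lexx b) (free_angle_start ex rl)).
have [l0 lb pos _] := ex.
have sb : bmeas a b (spin psi).
  by apply: spin_bmeas => s /andP[as_ sb]; apply: pos => //; exact: lt_le_trans as_.
case: (free_angle_step ex rl) => H; [left|right].
  by split=> // s t as_ st tb; apply: H => //; exact: lt_le_trans as_.
split; first exact: bmeas_cst.
move=> s t as_ st tb; rewrite intg_cst// mul0r !H ?subrr//.
- exact: lt_le_trans as_.
- exact: le_trans tb.
- by rewrite (lt_le_trans la)// (le_trans as_).
Qed.

Lemma free_angle_measurable l b : excursion psi l b ->
  measurable_fun `[l, b] (free_angle psi l).
Proof.
move=> ex; have [rl|rl] := ltP 0 (dist0 psi l).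
  by have [] := acd_bmeas (free_angle_start ex rl).
have [l0 lb pos _] := ex.
have [->|lb'] := eqVneq l b; first by rewrite set_itv1; exact: measurable_fun_set1.
have {}lb' : l < b by rewrite lt_neqAle lb'.
pose e n : R := n.+1%:R^-1.
have e0 n : 0 < e n by rewrite invr_gt0.
have e1 n : e n <= 1 by rewrite invf_le1 ?ltr0n// ler1n.
pose a n := l + (b - l) * e n.
have la n : l < a n by rewrite ltrDl mulr_gt0// subr_gt0.
have ab n : a n <= b.
  by rewrite /a -lerBrDl -[leRHS]mulr1 ler_wpM2l// subr_ge0 ltW.
pose F n t := if t <= l then 0 else free_angle psi l (clamp (a n) b t).
apply: (@measurable_fun_cvg _ _ _ _ F) => [n|t].
  apply: measurable_funTS; apply: measurable_fun_ifT => //.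
    exact: measurable_fun_ler.
  apply: continuous_measurable_fun.
  by case: (free_angle_acd ex (la n)) => /(acd_clamp_continuous (ab n)).
rewrite /= in_itv/= => /andP[lt tb].
have [tl|tl] := leP t l.
  rewrite (_ : (fun n => F n t) = fun=> 0); last first.
    by apply/funext => n; rewrite /F tl.
  by rewrite /free_angle ltNge rl/= tl; exact: cvg_cst.
have ca : a n @[n --> \oo] --> l.
  rewrite -[X in _ --> X]addr0 -(mulr0 (b - l)).
  apply: cvgD; first exact: cvg_cst.
  by apply: cvgMr; exact: cvg_harmonic.
apply: cvg_near_cst; near=> n; rewrite /F leNgt tl/= clampK// tb andbT.
by near: n; exact: cvgr_le ca _ tl.
Unshelve. all: by end_near. Qed.

Lemma width_gt0 l b s : excursion psi l b -> l <= s <= b -> 0 < width psi l s.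
Proof.
move=> ex sI; rewrite /width; case: ifP => // rl.
by rewrite mulr_gt0// lt_max lt_min ltr01 (excursion_pos ex rl) ?orbT.
Qed.

Lemma width_le l s : width psi l s <= c.
Proof.
rewrite /width; case: ifP => // _.
rewrite -[X in _ <= X](mulr1 c) ler_wpM2l ?(ltW c0)//.
by have /andP[] := clamp01 (dist0 psi s).
Qed.

Lemma width_measurable (D : set R) l : measurable_fun D (width psi l).
Proof.
rewrite /width; case: (0 < dist0 psi l) => //; apply: measurable_funM => //.
apply: (measurableT_comp _ (@dist0_measurable D)).
apply: continuous_measurable_fun; apply: (@lip_continuous _ _ 1) => p q.
by rewrite mul1r; apply: clamp_lip.
Qed.

Lemma width_inv_bmeas l b : excursion psi l b -> bmeas l b (fun s => (width psi l s)^-1).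
Proof.
move=> ex; have [l0 lb pos _] := ex; split.
  apply: (measurable_funV (measurable_itv _) (@width_measurable _ _)) => s.
  by rewrite /= in_itv/=; exact: width_gt0.
have [rl|rl] := ltP 0 (dist0 psi l); last first.
  exists c^-1 => s _; rewrite /width ltNge rl/= ger0_norm// invr_ge0; exact: ltW.
have [m m0 hm] := dist0_lower lb (excursion_pos ex rl).
exists (c * clamp 0 1 m)^-1 => s sI; have w0 := width_gt0 ex sI.
have cm : 0 < c * clamp 0 1 m by rewrite mulr_gt0// lt_max lt_min m0 ltr01 orbT.
rewrite gtr0_norm ?invr_gt0// lef_pV2 ?posrE//.
by rewrite /width rl ler_wpM2l ?(ltW c0)//; apply: clamp_mono; exact: hm.
Qed.

Lemma run_hyp l b : excursion psi l b ->
  picard_hyp 1 (fun s => (width psi l s)^-1) (run psi l) l b.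
Proof.
move=> ex; have [l0 lb pos _] := ex; split=> //.
- exact: width_inv_bmeas.
- by move=> s sI; rewrite invr_ge0 ltW// (width_gt0 ex).
- move=> s y _; rewrite /run; case: ifP => _; last exact: law_bnd.
  by rewrite normrN normr1.
- move=> s y z sI yz; have w0 := width_gt0 ex sI.
  have w4 := le_trans (width_le l s) c4.
  rewrite /run; case: ifP => _; first by rewrite lerD2l ler_wpM2l// invr_ge0 ltW.
  have := law_mono w0 w4 (_ : free_angle psi l s + y <= free_angle psi l s + z).
  rewrite lerD2l => /(_ yz); rewrite !mulrDr; lra.
- move=> s y u sI yu cu; rewrite /run; case: ifP => _; first exact: cvg_cst.
  apply: law_rc => //.
  + exact: width_gt0 ex sI.
  + exact: le_trans (width_le l s) c4.
  + by move=> n; rewrite lerD2l.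
  + by apply: cvgD => //; exact: cvg_cst.
- move=> v mv.
  have ml : measurable_fun `[l, b] (fun s => law (width psi l s) (free_angle psi l s + v s)).
    apply: law_measurable => //; first exact: width_measurable.
      by move=> s; rewrite /= in_itv/=; exact: width_gt0.
    by apply: measurable_funD => //; exact: free_angle_measurable.
  rewrite /run; apply: measurable_fun_if => //.
    exact: measurable_fun_ltr.
  by apply: measurable_funS ml => // x [].
Qed.

Lemma dodge_acd l b : excursion psi l b ->
  acd l b (dodge psi l) (fun s => run psi l s (dodge psi l s)).
Proof. by move=> /run_hyp; exact: maxsol_acd. Qed.

Lemma dodge0 l b : excursion psi l b -> dodge psi l l = 0.
Proof. by move=> /run_hyp; exact: maxsol0. Qed.

Lemma man_excursion l t : excursion psi l t -> 0 < dist0 psi t ->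
  man psi t = - run psi l t (dodge psi l t).
Proof.
move=> ex rt; have [l0 lt _ _] := ex.
by rewrite /man rt (le_trans l0 lt) (excursion_last_center ex rt).
Qed.

Let away := [set t | 0 < t /\ 0 < dist0 psi t].

Let away_open : open away.
Proof.
rewrite (_ : away = [set t | 0 < t] `&` dist0 psi @^-1` [set x | 0 < x])//.
apply: openI; first exact: open_gt.
by apply: open_comp; [move=> x _; exact: dist0_continuous|exact: open_gt].
Qed.

(** Near a time when L is away from the center, all times share one excursion; local continuity of
    M's data follows although [last_center] jumps. *)
Lemma excursion_around t : 0 < t -> 0 < dist0 psi t -> exists l a b,
  [/\ a < t < b, l < a, excursion psi l b &
     forall s, a <= s <= b -> last_center psi s = l].
Proof.
move=> t0 rt; have ex := last_center_excursion (ltW t0) rt.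
set l := last_center psi t in ex *; have [l0 lt pos st] := ex.
have lt' : l < t.
  rewrite lt_neqAle lt andbT; apply/eqP => lE; case: st => [[l00 _]|rl].
    by move: t0; rewrite -lE l00 ltxx.
  by move: rt; rewrite -lE ltNge rl.
have := @dist0_continuous t => /cvgr_gt /(_ _ rt) /nbhs_ballP[e /= e0 he].
have posb s : l < s -> s <= t + e / 2 -> 0 < dist0 psi s.
  move=> ls sb; have [st'|ts] := leP s t; first exact: pos.
  by apply: he; rewrite /ball/= ltr0_norm ?subr_lt0//; lra.
have exb : excursion psi l (t + e / 2) by split=> //; lra.
exists l, ((l + t) / 2), (t + e / 2); split=> //.
- by apply/andP; split; lra.
- lra.
- move=> s /andP[as_ sb]; apply: excursion_last_center; last by apply: posb => //; lra.
  by apply: excursionS exb _ _ => //; lra.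
Qed.

(** On the open set of positive times with L away from the center, width and angle are continuous,
    and the law is a measurable function of them; elsewhere the control is 0, except possibly at
    time 0. *)
Lemma man_measurable : measurable_fun setT (man psi).
Proof.
pose W t := width psi (last_center psi t) t.
pose Y t := free_angle psi (last_center psi t) t + dodge psi (last_center psi t) t.
have near_eq t (f : R -> R) (g : R -> R -> R) l a b : a < t < b ->
    (forall s, a <= s <= b -> f s = g l s) -> {for t, continuous (g l)} ->
    {for t, continuous f}.
  move=> tI fg cg; have /andP[at_ tb] := tI.
  rewrite /prop_for /continuous_at fg ?(ltW at_) ?(ltW tb)//.
  apply: cvg_trans cg; apply: near_eq_cvg; near=> s; apply/esym/fg.
  by apply/andP; split; apply: ltW; near: s; [exact: lt_nbhsr|exact: lt_nbhsl].
have cW : {in away, continuous W}.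
  move=> t; rewrite inE => -[t0 rt].
  have [l [a [b [tI la ex lc]]]] := excursion_around t0 rt.
  apply: (near_eq t W (width psi) l a b tI) => [s sI|]; first by rewrite /W lc.
  rewrite /width; case: (0 < dist0 psi l); last exact: cvg_cst.
  apply: cvgM; first exact: cvg_cst.
  have ccl : continuous (clamp 0 1 : R -> R).
    by apply: (@lip_continuous _ _ 1) => p q; rewrite mul1r; apply: clamp_lip.
  by apply: continuous_cvg; [exact: ccl|exact: dist0_continuous].
have cY : {in away, continuous Y}.
  move=> t; rewrite inE => -[t0 rt].
  have [l [a [b [tI la ex lc]]]] := excursion_around t0 rt.
  have /andP[at_ tb] := tI; have ab := ltW (lt_trans at_ tb).
  pose Z l s := free_angle psi l (clamp a b s) + dodge psi l (clamp a b s).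
  apply: (near_eq t Y Z l a b tI) => [s sI|]; first by rewrite /Y /Z lc// clampK.
  have sa : acd a b (dodge psi l) (fun s => run psi l s (dodge psi l s)).
    exact: (acdS (ltW la) (lexx b) (dodge_acd ex)).
  apply: cvgD; last exact: (acd_clamp_continuous ab sa).
  by case: (free_angle_acd ex la) => /(acd_clamp_continuous ab)/(_ t).
have mW := open_continuous_measurable_fun away_open cW.
have mY := open_continuous_measurable_fun away_open cY.
have mA : measurable away by exact: open_measurable.
have W0 t : away t -> 0 < W t.
  move=> [t0 rt]; have ex := last_center_excursion (ltW t0) rt.
  by apply: (width_gt0 ex); have [_ -> _ _] := ex; rewrite lexx.
pose F t := - (if t < h then -1 else law (W t) (Y t)).
have mF : measurable_fun away F.
  apply: measurableT_comp => //; apply: measurable_fun_if => //.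
    exact: measurable_fun_ltr.
  have ml := law_measurable mA mW W0 mY.
  by apply: measurable_funS ml => // x [].
have -> : man psi = (fun t => if t <= 0 then (if t < 0 then 0 else man psi 0) else
    (F \_ away) t).
  apply/funext => t; have [t0|t0] := leP t 0.
    have [t0'|t0'] := ltP t 0; first by rewrite /man leNgt t0'.
    by rewrite (_ : t = 0)//; apply/eqP; rewrite eq_le t0.
  rewrite patchE; case: ifPn => [|].
    by rewrite inE => -[_ rt]; rewrite /man (ltW t0) rt.
  rewrite notin_setE /man => nA; case: ifPn => // /andP[_ rt].
  by exfalso; apply: nA.
apply: measurable_fun_ifT.
- exact: measurable_fun_ler.
- by apply: measurable_fun_ifT => //; exact: measurable_fun_ltr.
- exact: (measurable_restrictT F mA).1 mF.
Unshelve. all: by end_near. Qed.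

Lemma man_control : M_control (man psi).
Proof.
split; first exact: man_measurable.
move=> t; rewrite -ler_norml /man; case: ifP => _; last by rewrite normr0.
rewrite normrN /run; case: ifP => _; first by rewrite normrN normr1.
exact: law_bnd.
Qed.

End FixedControl.

Section Nonanticipation.
Variables (psi psi' : R -> R) (t : R).
Hypotheses (Lpsi : L_control psi) (Lpsi' : L_control psi').
Hypothesis eqpsi : ae_eq_on t psi psi'.

Let eq_intg (F : R -> R -> R) a b : 0 <= a -> b <= t ->
  measurable_fun `[a, b] (fun s => F s (psi s)) ->
  measurable_fun `[a, b] (fun s => F s (psi' s)) ->
  intg (fun s => F s (psi s)) a b = intg (fun s => F s (psi' s)) a b.
Proof.
move=> a0 bt m1 m2; apply: intg_ae => //.
move: eqpsi; apply: filterS; first exact: (ae_filter_ringOfSetsType (@lebesgue_measure R)).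
by move=> s H /andP[as_ sb]; rewrite H// (le_trans a0 as_) (le_trans sb).
Qed.

Lemma dist0_ae s : s <= t -> dist0 psi s = dist0 psi' s.
Proof.
move=> st; congr (r0 + _); apply: (eq_intg (F := fun _ p => mu * cos p)) => //.
- by apply: measurable_funM => //; have [] := L_control_cos Lpsi 0 s.
- by apply: measurable_funM => //; have [] := L_control_cos Lpsi' 0 s.
Qed.

Lemma spin_ae a b : 0 <= a -> b <= t -> (forall s, a <= s <= b -> 0 < dist0 psi s) ->
  intg (spin psi) a b = intg (spin psi') a b.
Proof.
move=> a0 bt pos.
have pos' s : a <= s <= b -> 0 < dist0 psi' s.
  by move=> sI; rewrite -dist0_ae ?pos//; case/andP: sI => _ sb; exact: le_trans bt.
apply: intg_ae; first by have [] := spin_bmeas Lpsi pos.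
  by have [] := spin_bmeas Lpsi' pos'.
move: eqpsi; apply: filterS; first exact: (ae_filter_ringOfSetsType (@lebesgue_measure R)).
move=> s H /andP[as_ sb]; have st := le_trans sb bt.
by rewrite /spin dist0_ae// H// (le_trans a0 as_).
Qed.

Lemma last_center_ae s : s <= t -> last_center psi s = last_center psi' s.
Proof.
move=> st; rewrite /last_center; congr sup; apply/seteqP; split => u [/andP[u0 us] ru].
  by split; [rewrite u0|rewrite -dist0_ae// (le_trans us)].
by split; [rewrite u0|rewrite dist0_ae// (le_trans us)].
Qed.

Lemma free_angle_ae l s : s <= t -> excursion psi l s ->
  free_angle psi l s = free_angle psi' l s.
Proof.
move=> st ex; have [l0 ls pos rl] := ex; have lt := le_trans ls st.
rewrite /free_angle -dist0_ae//; case: ifPn => [rl0|_].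
  by rewrite spin_ae//; exact: (excursion_pos ex).
case: ifPn => //; rewrite -ltNge => ls'.
have e : \forall a \near l^'+, intg (spin psi) a s = intg (spin psi') a s.
  near=> a; have la : l < a by near: a; exact: nbhs_right_gt.
  apply: spin_ae => //; first exact: le_trans (ltW la).
  by move=> u /andP[au us]; apply: pos => //; exact: lt_le_trans au.
congr lim; apply/seteqP; split; apply: near_eq_cvg => //.
by apply: filterS e => a ->.
Unshelve. all: by end_near. Qed.

(** Every ingredient of the control at time s is an integral of the past of psi, or a limit or a
    selected solution built from such integrals; hence equality holds at every s and not only almost
    everywhere. *)
Lemma man_ae s : s <= t -> man psi s = man psi' s.
Proof.
move=> st; rewrite /man -(dist0_ae st).
have [/andP[s0 rs]|//] := boolP ((0 <= s) && (0 < dist0 psi s)).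
have ex := last_center_excursion Lpsi s0 rs.
rewrite -(last_center_ae st).
move: ex; set l := last_center psi s => ex.
have [l0 ls _ _] := ex.
have ew u : l <= u <= s -> width psi l u = width psi' l u.
  move=> /andP[lu us]; have ut := le_trans us st.
  by rewrite /width (dist0_ae ut) (dist0_ae (le_trans ls st)).
have er u v : l <= u <= s -> run psi l u v = run psi' l u v.
  move=> /[dup] uI /andP[lu us]; rewrite /run ew//.
  by rewrite (free_angle_ae (le_trans us st) (excursionS ex lu us)).
have sI : l <= s <= s by rewrite ls lexx.
have es : dodge psi l s = dodge psi' l s.
  apply: (maxsol_ext 1 _ er sI) => u uI; by rewrite ew.
by rewrite es (er _ _ sI).
Qed.

End Nonanticipation.

Lemma man_strategy : M_strategy man.
Proof.
split; first exact: man_control.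
move=> f g t mf mg t0 fg; apply: aeW => s /andP[s0 st]; exact: man_ae fg _ st.
Qed.

End ManStrategy.

(** * Motions in which M uses his strategy *)

Section ManMotion.
Context {R : realType}.
Variables (mu r0 h c : R).
Hypotheses (mu0 : 0 < mu) (r00 : 0 <= r0) (c0 : 0 < c) (c4 : c <= 1 / 4).
Variables (psi r th : R -> R) (T : R).
Hypothesis Lpsi : L_control psi.

Local Notation dist0 := (dist0 mu r0 psi).
Local Notation spin := (spin mu r0 psi).
Local Notation excursion := (excursion mu r0 psi).
Local Notation dodge := (dodge mu r0 h c psi).
Local Notation run := (run mu r0 h c psi).
Local Notation width := (width mu r0 c psi).
Local Notation man := (man mu r0 h c psi).

Hypothesis traj : trajectory mu (r0, h) psi man T r th.
Hypothesis rge0 : forall t, 0 <= t < T -> 0 <= r t.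

Lemma motion_dist0 t : 0 <= t <= T -> r t = dist0 t.
Proof.
by have [_ rE _ _] := traj; move=> /rE ->; rewrite /dist0 intg.unlock.
Qed.

Let th_step l a b : excursion l b -> b <= T -> l <= a -> a <= b ->
  (0 < dist0 l \/ l < a) ->
  th b - th a = intg spin a b + (dodge l b - dodge l a).
Proof.
move=> ex bT la ab st; have [l0 lb pos _] := ex.
have pos' s : a <= s <= b -> 0 < dist0 s.
  move=> /andP[as_ sb]; case: st => [rl|la'].
    by apply: (excursion_pos ex rl); rewrite (le_trans la as_).
  by apply: pos => //; exact: lt_le_trans as_.
have a0 := le_trans l0 la.
have [_ _ thE _] := traj.
rewrite (thE a b a0 ab bT); last first.
  move=> s /[dup] sI /pos'; rewrite motion_dist0//.
  by case/andP: sI => as_ sb; rewrite (le_trans a0 as_) (le_trans sb bT).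
have [hb hE] := dodge_acd h mu0 c0 c4 Lpsi ex.
rewrite (hE a b la ab (lexx b)) addrC addKr.
rewrite -intgD; [|exact: (spin_bmeas mu0 Lpsi pos')|exact: (bmeasS la (lexx b) hb)].
rewrite intg.unlock; apply: eq_Rintegral => s; rewrite inE/= in_itv/= => sI.
have /andP[as_ sb] := sI; have ls := le_trans la as_.
rewrite motion_dist0 ?(le_trans a0 as_) ?(le_trans sb bT)//.
by rewrite (man_excursion _ _ (excursionS ex ls sb) (pos' _ sI)) opprK.
Qed.

(** M's control is fixed by psi, so th is obtained by integration from the start of the excursion,
    without a uniqueness argument. After the center the starting value is the limit pi that the
    dynamics prescribe, which also shows that the limit in [free_angle] exists. *)
Lemma motion_angle l b s : excursion l b -> b <= T -> l <= s -> s <= b ->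
  (0 < dist0 l \/ l < s) ->
  th s - pi = free_angle mu r0 h psi l s + dodge l s.
Proof.
move=> ex bT ls sb st; have exs := excursionS ex ls sb.
have [l0 lb pos start] := ex; have sT := le_trans sb bT.
have [[thr0 th0] _ _ tc] := traj; move: th0 => /= th0.
have [rl|rl] := ltP 0 (dist0 l).
  case: start => [[lE _]|]; last by rewrite leNgt rl.
  subst l; have := th_step exs sT (lexx 0) ls (or_introl rl).
  rewrite (dodge0 h mu0 c0 c4 Lpsi ex) subr0 th0 => e.
  by rewrite /free_angle rl -(subrK h (th s)) e; ring.
case: st => [|ls']; first by rewrite ltNge rl.
have lT : l < T by exact: lt_le_trans sT.
have rl0 : r l = 0.
  apply/eqP; rewrite eq_le rge0 ?l0// andbT motion_dist0//.
  by rewrite l0 ltW.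
have lI : 0 <= l < T by rewrite l0.
have [_ thpi] := tc l lI rl0.
rewrite /free_angle ltNge rl/= leNgt ls'/=.
have ch : dodge l a @[a --> l^'+] --> (0 : R).
  have ca := acd_clamp_continuous lb (dodge_acd h mu0 c0 c4 Lpsi ex).
  have ls'' : l <= l <= b by rewrite lexx.
  have := @cvg_at_right_filter _ _ _ _ _ (ca l).
  rewrite clampK// (dodge0 h mu0 c0 c4 Lpsi ex).
  apply: cvg_trans; apply: near_eq_cvg; near=> a; rewrite clampK//.
  have la : l < a by near: a; exact: nbhs_right_gt.
  by rewrite (ltW la)/= (le_trans _ sb)//; near: a; exact: nbhs_right_le.
have cl : intg spin a s @[a --> l^'+] --> th s - pi - dodge l s + 0.
  have : th s - th a - dodge l s + dodge l a @[a --> l^'+] --> th s - pi - dodge l s + 0.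
    apply: cvgD => //; apply: cvgB; last exact: cvg_cst.
    by apply: cvgB => //; exact: cvg_cst.
  apply: cvg_trans; apply: near_eq_cvg; near=> a.
  have la : l < a by near: a; exact: nbhs_right_gt.
  have as_ : a <= s by near: a; exact: nbhs_right_le.
  by rewrite (th_step exs sT (ltW la) as_ (or_intror la)); ring.
by rewrite (cvg_lim (@Rhausdorff R) cl) addr0 subrK.
Unshelve. all: by end_near. Qed.

(** The feedback form of M's law: the precomputed angle is the actual one, so he does react to the
    true state. *)
Lemma motion_acd l a b : excursion l b -> b <= T -> l <= a ->
  (0 < dist0 l \/ l < a) ->
  acd a b (fun s => th s - pi)
    (fun s => spin s + (if s < h then -1 else law (width l s) (th s - pi))).
Proof.
move=> ex bT la st; have [l0 lb pos _] := ex.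
have pos' s : a <= s <= b -> 0 < dist0 s.
  move=> /andP[as_ sb]; case: st => [rl|la'].
    by apply: (excursion_pos ex rl); rewrite (le_trans la as_).
  by apply: pos => //; exact: lt_le_trans as_.
have hs := acdS la (lexx b) (dodge_acd h mu0 c0 c4 Lpsi ex).
have sb := spin_bmeas mu0 Lpsi pos'.
have : acd a b (fun s => th s - pi) (fun s => spin s + run l s (dodge l s)).
  split; first by apply: bmeasD => //; case: hs.
  move=> s t as_ stt tb; have ls := le_trans la as_.
  have st' : 0 < dist0 l \/ l < s.
    by case: st => [?|la']; [left|right; exact: lt_le_trans as_].
  have tT := le_trans tb bT.
  have := th_step (excursionS ex (le_trans ls stt) tb) tT ls stt st'.
  rewrite intgD; last 2 first.
  - exact: (bmeasS as_ tb sb).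
  - by apply: (bmeasS as_ tb); case: hs.
  by have [_ <-//] := hs => <-; ring.
apply: acd_ext => // s sI; have /andP[as_ sb'] := sI.
rewrite /run (motion_angle ex bT (le_trans la as_) sb')//.
by case: st => [?|la']; [left|right; exact: lt_le_trans as_].
Qed.

Lemma motion_run l a b : excursion l b -> b <= T -> l <= a ->
  (0 < dist0 l \/ l < a) -> h <= a ->
  (forall s, a <= s <= b -> 0 < cos (th s - pi) \/ width l s <= `|sin (th s - pi)|) ->
  acd a b (fun s => th s - pi)
    (fun s => sin (psi s) / (dist0 s / mu) + sgr (sin (th s - pi))).
Proof.
move=> ex bT la st ha H; apply: acd_ext (motion_acd ex bT la st) => // s sI.
have /andP[as_ sb] := sI.
rewrite ltNge (le_trans ha as_)/= law_run//; last exact: H.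
  congr (_ + _); rewrite /spin invf_div; ring.
by apply: (width_gt0 c0 ex); rewrite (le_trans la as_).
Qed.

Lemma scaled_dist0_acd a b : 0 <= a ->
  acd a b (fun s => dist0 s / mu) (fun s => cos (psi s)).
Proof.
move=> a0; apply: acd_ext (acdZ mu^-1 (dist0_acd mu r0 Lpsi b a0)) => s _.
  by rewrite mulrC.
by rewrite mulrA mulVf ?mul1r// gt_eqF.
Qed.

End ManMotion.

(** * The time that M guarantees, and why L cannot cross the barrier *)

Section ManGuarantee.
Context {R : realType}.
Implicit Types (a b e l s t x z : R).

Lemma ler_cos (x y : R) : 0 <= x -> x <= y -> y <= pi -> cos y <= cos x.
Proof.
move=> x0 xy yp; rewrite leNgt ltr_cos ?in_itv/= ?x0 ?yp ?(le_trans xy yp) ?(le_trans x0 xy)//.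
by rewrite -leNgt.
Qed.

Lemma right_ge0 (X : R -> R) t b : continuous X -> t < b ->
  (forall s, t < s -> s <= b -> 0 < X s) -> 0 <= X t.
Proof.
move=> cX tb pos; rewrite leNgt; apply/negP => Xt.
move: (cX t) => /cvgr_lt /(_ _ Xt) /nbhs_ballP[e /= e0 He].
have ts : t < Num.min b (t + e / 2) by rewrite lt_min tb ltrDl divr_gt0.
have sb : Num.min b (t + e / 2) <= b by rewrite ge_min lexx.
have se : Num.min b (t + e / 2) <= t + e / 2 by rewrite ge_min lexx orbT.
have := pos _ ts sb; rewrite ltNge ltW//; apply: He.
by rewrite /ball/= ltr0_norm; lra.
Qed.

Lemma cosBpi (x : R) : cos (x - pi) = - cos x.
Proof. by rewrite cosB cospi sinpi mulr0 addr0 mulrN1. Qed.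

Lemma sinBpi (x : R) : sin (x - pi) = - sin x.
Proof. by rewrite sinB cospi sinpi mulr0 subr0 mulrN1. Qed.

Lemma cos_ge_sub (x : R) : 0 <= x -> 1 - x <= cos x.
Proof.
move=> x0; have := cos_lip 0 x; rewrite cos0 subr0 (ger0_norm x0) ler_norml.
by move=> /andP[]; lra.
Qed.

(** A crude bound: sin z >= z / 2 up to 1/2, because the cosine is at least 1/2 there; beyond, the
    sine is increasing and exceeds sin (1/2) >= 1/4. *)
Lemma sin_ge_min (x : R) : 0 < x -> x <= pi / 2 -> Num.min x 1 / 4 <= sin x.
Proof.
move=> x0 xp; have small (z : R) : 0 < z -> z <= 1 / 2 -> z / 2 <= sin z.
  move=> z0 z2; have [] := @MVT R (@sin R) (@cos R) 0 z z0.
    by apply: continuous_subspaceT => p; exact: continuous_sin.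
  move=> p; rewrite in_itv/= sin0 !subr0 => /andP[p0 pz] ->.
  have := cos_ge_sub (ltW p0); nra.
have [x2|x2] := leP x (1 / 2).
  by rewrite (le_trans _ (small _ x0 x2))// minEle; case: ifP => ?; lra.
have s2 : 1 / 4 <= sin (1 / 2 : R).
  by have := small (1 / 2) _ (lexx _); rewrite (_ : 1 / 2 / 2 = 1 / 4 :> R); [apply; lra|field].
have : sin (1 / 2 : R) < sin x.
  have pi0 := pi_ge2 R.
  rewrite ltr_sin// in_itv/=; apply/andP; split; lra.
by rewrite minEle; case: ifP => ?; lra.
Qed.

Variables (mu r0 h c : R).
Hypotheses (mu0 : 0 < mu) (mu1 : mu < 1) (c0 : 0 < c) (c4 : c <= 1 / 4).
Hypothesis start : state_space mu (r0, h).
Hypothesis bar0 : 0 < barrier mu 1.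
(** Keeps the zone |sin th| <= c, in which M's law is softened, away from the barrier. *)
Hypothesis hc : forall x : R, barrier mu 1 <= x -> x <= pi / 2 -> c < sin x.
(** r0 - mu h is the least radius L can have at time h. In h (2 + mu / (r0 - mu h)), the 2 counts
    the initial angle and M's own travel, and the fraction bounds L's angular speed. *)
Hypothesis opening : h = 0 \/ [/\ 0 < h, 0 < r0 - mu * h,
  h * (2 + mu / (r0 - mu * h)) <= (r0 - mu * h) / mu,
  h * (2 + mu / (r0 - mu * h)) < barrier mu 1 & h * (2 + mu / (r0 - mu * h)) <= 1].

Variables (psi r th : R -> R) (T : R).
Hypothesis Lpsi : L_control psi.
Hypothesis playing : play mu (r0, h) psi (man mu r0 h c psi) T r th.

Local Notation dist0 := (dist0 mu r0 psi).
Local Notation spin := (spin mu r0 psi).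
Local Notation excursion := (excursion mu r0 psi).
Local Notation width := (width mu r0 c psi).
Local Notation k s := (dist0 s / mu).
Local Notation y s := (th s - pi).

Let r00 : 0 <= r0. Proof. by have [/andP[]] := start. Qed.
Let h0 : 0 <= h. Proof. by have [_ /andP[]] := start. Qed.
Let T0 : 0 <= T. Proof. by have [] := playing. Qed.
Let traj : trajectory mu (r0, h) psi (man mu r0 h c psi) T r th.
Proof. by have [] := playing. Qed.
Let inspace t : 0 <= t < T -> state_space mu (state r th t).
Proof. by have [_ _ H] := playing; move=> /H[]. Qed.
Let rge0 t : 0 <= t < T -> 0 <= r t.
Proof. by move=> /inspace[/andP[]]. Qed.
Let rE t : 0 <= t <= T -> r t = dist0 t.
Proof. exact: motion_dist0 traj _. Qed.
Let th0 : th 0 = h. Proof. by have [[]] := traj. Qed.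
Let d0 : dist0 0 = r0. Proof. exact: dist0_neg. Qed.

Let slow s t : s <= t -> dist0 s - mu * (t - s) <= dist0 t.
Proof.
move=> st; have := dist0_lip r0 mu0 Lpsi s t.
by rewrite (ger0_norm (_ : 0 <= t - s)) ?subr_ge0// ler_norml => /andP[]; lra.
Qed.

Let dist0_open s : 0 < h -> 0 < r0 - mu * h -> 0 <= s -> s <= h -> r0 - mu * h <= dist0 s.
Proof.
move=> hpos rpos s0 sh; have := slow s0; rewrite d0 subr0.
have : mu * s <= mu * h by rewrite ler_wpM2l// ltW.
lra.
Qed.

Lemma opening_angle t : 0 <= t -> t <= h -> t <= T ->
  [/\ `|th t| <= k t, `|th t| < barrier mu 1 & `|th t| <= 1].
Proof.
move=> t0 t_h tT; case: opening => [hE|[hpos rpos e1 e2 e3]].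
  have -> : t = 0 by apply/eqP; rewrite eq_le t0 -hE t_h.
  by rewrite th0 hE normr0 d0 divr_ge0// ltW.
have dpos s : 0 <= s -> s <= h -> 0 < dist0 s.
  by move=> s0 sh; rewrite (lt_le_trans rpos)// dist0_open.
have ex : excursion 0 t.
  split=> //; last by left; rewrite dpos// ltW.
  by move=> s s0 st; apply: dpos; [exact: ltW|exact: le_trans t_h].
have m1 := motion_acd mu0 c0 c4 Lpsi traj rge0 ex tT (lexx 0) (or_introl (dpos _ (lexx 0) h0)).
set e := h * _ in e1 e2 e3.
suff : `|th t| <= e.
  move=> te; split; [|exact: le_lt_trans e2|exact: le_trans e3].
  by rewrite (le_trans te)// (le_trans e1)// ler_pM2r ?invr_gt0// dist0_open.
have [[mx _] e4] := m1.
have := e4 0 t (lexx 0) t0 (lexx t); rewrite th0.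
rewrite (_ : th t - pi - (h - pi) = th t - h); last by ring.
move=> e5; rewrite -(subrK h (th t)) (le_trans (ler_normD _ _))// e5 (ger0_norm h0).
have := @intg_norm _ 0 t _ (mu / (r0 - mu * h) + 1) t0 mx; rewrite subr0 => H.
rewrite (le_trans (lerD (H _) (lexx h)))//.
  move=> s /andP[s0 st]; have sh := le_trans st t_h.
  rewrite (le_trans (ler_normD _ _))// lerD//; last first.
    by case: ifP => _; rewrite ?normrN ?normr1 ?law_bnd.
  have ds := dist0_open hpos rpos s0 sh.
  rewrite /spin normrM -[leRHS]mulr1 ler_pM// ?sin_max// normrM (gtr0_norm mu0).
  have dp := lt_le_trans rpos ds.
  by rewrite ler_wpM2l ?(ltW mu0)// gtr0_norm ?invr_gt0// lef_pV2 ?posrE.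
have q0 : 0 <= mu / (r0 - mu * h) + 1 by rewrite addr_ge0// divr_ge0// ltW.
have : (mu / (r0 - mu * h) + 1) * t <= (mu / (r0 - mu * h) + 1) * h by rewrite ler_wpM2l.
rewrite /e; lra.
Qed.

(** The last premise says that the angle from th = 0 is at least min (k, pi). If L is not on the
    antipodal side of the lake, then |sin th| >= sin k >= min (k, 1) / 4, and the width has been
    chosen below this bound. *)
Let run_zone l s : 0 < dist0 l -> 0 < k s -> cos (th s) <= cos (clamp 0 pi (k s)) ->
  0 < cos (y s) \/ width l s <= `|sin (y s)|.
Proof.
move=> dl ks; rewrite cosBpi sinBpi normrN.
have [kp|kp] := leP (k s) pi; last first.
  by rewrite /clamp (min_l (ltW kp)) (max_r (pi_ge0 R)) cospi => ?; left; lra.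
rewrite clampK ?kp ?(ltW ks)// => cc.
have [ct|ct] := ltP (cos (th s)) 0; [by left; rewrite oppr_gt0|right].
have pi0 := pi_gt0 R.
have kp2 : k s <= pi / 2.
  rewrite leNgt; apply/negP => k2.
  have : cos (k s) < cos (pi / 2).
    by rewrite ltr_cos ?in_itv/=//; apply/andP; split; lra.
  by rewrite cos_pihalf; lra.
have sk : sin (k s) <= `|sin (th s)|.
  have s0 : 0 <= sin (k s) by apply: sin_ge0_pi; rewrite ltW.
  rewrite -(ger0_norm s0) -!sqrtr_sqr ler_wsqrtr// !sin2cos2 lerD2l lerN2.
  by rewrite ler_pXn2r// nnegrE (le_trans ct).
rewrite (le_trans _ sk)// (le_trans _ (sin_ge_min ks kp2))//.
rewrite /width dl.
have ds : 0 < dist0 s by move: ks; rewrite pmulr_lgt0 ?invr_gt0.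
have /andP[q0 q1] := clamp01 (dist0 s).
have qd : clamp 0 1 (dist0 s) <= dist0 s.
  by rewrite /clamp ge_max (ltW ds)/= ge_min lexx orbT.
have dk : dist0 s <= k s by rewrite ler_pdivlMr// ger_pMr// ltW.
rewrite (le_trans (ler_wpM2r q0 c4))// mul1r mulrC ler_pM2r; last by lra.
by rewrite le_min q1 (le_trans qd).
Qed.

Section Reaching.
Hypothesis atE : state r th T = E mu.

Let kT : k T = 1.
Proof. by have [rT _] := atE; rewrite -rE ?T0 ?lexx// rT divff// gt_eqF. Qed.

Let cT : cos (th T) = -1.
Proof. by have [_ e] := atE; rewrite -cos_acos_cos e cospi. Qed.

Let sT : sin (th T) = 0.
Proof. by apply: cos1sin0; rewrite cT normrN normr1. Qed.

(** At E the quantity of [rotating_wave] equals (1 - sin u) / cos u with u = T - e < pi / 2, which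
    is positive; so it must have been positive at [a] already. *)
Let finish l a e : excursion l T -> l <= a -> (0 < dist0 l \/ l < a) -> h <= a -> a <= T ->
  0 <= a - e -> T - e < pi / 2 ->
  (forall s, a <= s <= T -> 0 < cos (y s) \/ width l s <= `|sin (y s)|) ->
  let q := (cos (T - e) - sin (T - e) * cos (T - e)) * ((cos (T - e))^-1 * (cos (T - e))^-1) in
  0 < q /\ q <=
    (k a * (cos (y a) * cos (a - e) - `|sin (y a)| * sin (a - e)) - sin (a - e) * cos (a - e))
    * ((cos (a - e))^-1 * (cos (a - e))^-1).
Proof.
move=> ex la st ha aT ae Te zone q.
have pi0 := pi_gt0 R.
have cpos : 0 < cos (T - e) by apply: cos_gt0_pihalf; apply/andP; split; lra.
have s1 : sin (T - e) < 1.
  rewrite lt_neqAle sin_le1 andbT; apply/eqP => s1.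
  by have := cos2Dsin2 (T - e); rewrite s1; have := exprn_gt0 2 cpos; lra.
split.
  apply: mulr_gt0; last by rewrite mulr_gt0// invr_gt0.
  by rewrite -[X in X - _]mul1r -mulrBl mulr_gt0// subr_gt0.
have kpos s : a <= s <= T -> 0 < k s.
  move=> /andP[as_ sT']; rewrite divr_gt0//.
  have [l0 lT pos _] := ex.
  case: st => [rl|la']; first by apply: (excursion_pos ex rl); rewrite (le_trans la as_).
  by apply: pos => //; exact: lt_le_trans as_.
have hk := scaled_dist0_acd r0 mu0 Lpsi T (le_trans (let: And4 l0 _ _ _ := ex in l0) la).
have hy := motion_run mu0 c0 c4 Lpsi traj rge0 ex (lexx T) la st ha zone.
have := rotating_wave aT kpos hk hy ae Te.
by rewrite kT cosBpi sinBpi cT sT opprK oppr0 normr0 !mul1r mul0r subr0.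
Qed.

(** Take e = a in [finish]: the quantity at [a] is k cos y <= 0, a contradiction. From such a state
    L needs time pi / 2 at least. *)
Let quarter l a : excursion l T -> l <= a -> (0 < dist0 l \/ l < a) -> h <= a -> a <= T ->
  cos (y a) <= 0 -> T - a < pi / 2 ->
  (forall s, a <= s <= T -> 0 < cos (y s) \/ width l s <= `|sin (y s)|) -> False.
Proof.
move=> ex la st ha aT ca Ta zone.
have ka : 0 < k a.
  rewrite divr_gt0//; have [_ _ pos _] := ex; case: st => [rl|/pos]; last exact.
  by apply: (excursion_pos ex rl); rewrite la.
have aa : 0 <= a - a by rewrite subrr.
have [] := finish ex la st ha aT aa Ta zone; set q := (_ - _) * _ => q0.
rewrite subrr cos0 sin0 invr1 !mulr0 mul0r !subr0 !mulr1.
have : k a * cos (y a) <= 0 by rewrite pmulr_rle0.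
by move: q0; lra.
Qed.

Lemma reaching_time : r0 / mu + pi / 2 <= T.
Proof.
rewrite leNgt; apply/negP => TV.
have pi0 := pi_ge2 R.
have dT : 0 < dist0 T by have := kT; have [//|] := ltP 0 (dist0 T); rewrite -(ler_pM2r (_ : 0 < mu^-1)) ?invr_gt0// mul0r; lra.
set l := last_center mu r0 psi T.
have ex : excursion l T by exact: last_center_excursion.
have [l0 lT pos _] := ex.
have kslow s t : s <= t -> k s - (t - s) <= k t.
  by move=> /slow; rewrite -(ler_pM2r (_ : 0 < mu^-1)) ?invr_gt0// mulrBl mulrAC divff ?mul1r// gt_eqF.
have kstart s : 0 <= s -> r0 / mu - s <= k s.
  by move=> /kslow; rewrite d0 subr0.
have hT : h <= T.
  rewrite leNgt; apply/negP => /ltW Th; have [_ _ th1] := opening_angle T0 Th (lexx T).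
  have := cos_ge_sub (normr_ge0 (th T)); have -> : cos `|th T| = cos (th T).
    by case: (ger0P (th T)) => _; rewrite ?cosN.
  rewrite cT; lra.
have yT : cos (y T) = 1 by rewrite cosBpi cT opprK.
have [dl|dl] := ltP 0 (dist0 l).
  have lE : l = 0 by case: ex => _ _ _ [[]//|]; rewrite leNgt dl.
  have dpos s : 0 <= s <= T -> 0 < dist0 s by have := excursion_pos ex dl (s := s); rewrite lE.
  (* [G s <= 0] expresses |th| <= k through cosines, which ignore the choice of lift and are
     continuous. *)
  pose G s := cos (clamp 0 pi (k s)) + cos (y (clamp 0 T s)).
  have cG : continuous G.
    move=> s; apply: cvgD.
      apply: continuous_cvg; first exact: continuous_cos.
      apply: continuous_cvg; last first.
        by apply: cvgM; [exact: dist0_continuous|exact: cvg_cst].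
      by apply: (@lip_continuous _ _ 1) => p q; rewrite mul1r; apply: clamp_lip; lra.
    apply: continuous_cvg; first exact: continuous_cos.
    have m1 := motion_acd mu0 c0 c4 Lpsi traj rge0 ex (lexx T) (lexx l) (or_introl dl).
    move: m1; rewrite lE => m1; exact: (acd_clamp_continuous T0 m1).
  have Gh : exists2 t, h <= t <= T & G t <= 0.
    exists h; first by rewrite lexx.
    have [th1 _ th2] := opening_angle h0 (lexx h) hT.
    rewrite /G (@clampK _ 0 T h) ?h0// cosBpi subr_le0.
    have -> : cos (th h) = cos `|th h|.
      by case: (ger0P (th h)) => _; rewrite ?cosN.
    apply: ler_cos => //; last by have /andP[] := @clamp_in _ 0 pi (k h) (pi_ge0 R).
    by rewrite /clamp le_max le_min th1 andbT; apply/orP; right; lra.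
  have [t1 [/andP[ht1 t1T] Gt1 after]] := last_hit hT cG Gh.
  have t10 := le_trans h0 ht1.
  have {}t1T : t1 < T.
    rewrite lt_neqAle t1T andbT; apply/eqP => t1E; move: Gt1.
    rewrite t1E /G (@clampK _ 0 T T) ?T0 ?lexx// yT kT clampK; last by apply/andP; split; lra.
    have := @cos_ge_sub 1; lra.
  have G0 : G t1 = 0 by apply/eqP; rewrite eq_le Gt1 (right_ge0 cG t1T after).
  (* Otherwise k would remain above pi for a while after [t1], where G cannot be positive. *)
  have k1p : k t1 <= pi.
    rewrite leNgt; apply/negP => k1p.
    pose s := Num.min T (t1 + (k t1 - pi)).
    have ts : t1 < s by rewrite lt_min t1T ltrDl subr_gt0.
    have sT' : s <= T by rewrite ge_min lexx.
    have ks : pi <= k s.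
      have := kslow _ _ (ltW ts); have : s <= t1 + (k t1 - pi) by rewrite ge_min lexx orbT.
      lra.
    have := after s ts sT'; rewrite /G /clamp (min_l ks) (max_r (pi_ge0 R)) cospi.
    have := cos_le1 (y (Num.max 0 (Num.min T s))); lra.
  have kpos s : t1 <= s <= T -> 0 < k s.
    by move=> /andP[ts sT']; rewrite divr_gt0// dpos// sT' (le_trans t10).
  have k10 : 0 < k t1 by apply: kpos; rewrite lexx ltW.
  have tI : 0 <= t1 <= T by rewrite t10 ltW.
  have c1 : cos (y t1) = - cos (k t1).
    by move: G0; rewrite /G (clampK tI) clampK ?k1p ?(ltW k10)//; lra.
  have s1 : `|sin (y t1)| = sin (k t1).
    have s0 : 0 <= sin (k t1) by apply: sin_ge0_pi; rewrite k1p ltW.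
    by rewrite -(ger0_norm s0) -!sqrtr_sqr !sin2cos2 c1 sqrrN.
  have zone s : t1 <= s <= T -> 0 < cos (y s) \/ width l s <= `|sin (y s)|.
    move=> /[dup] sI /andP[ts sT']; apply: run_zone => //; first exact: kpos.
    have : 0 <= G s.
      by move: ts; rewrite le_eqVlt => /predU1P[<-|/after/(_ sT')/ltW//]; rewrite G0.
    by rewrite /G (@clampK _ 0 T s) ?sT' ?andbT ?(le_trans t10 ts)// cosBpi subr_ge0.
  have lt1 : l <= t1 by rewrite lE.
  have hk := scaled_dist0_acd r0 mu0 Lpsi T t10.
  have hy := motion_run mu0 c0 c4 Lpsi traj rge0 ex (lexx T) lt1 (or_introl dl) ht1 zone.
  (* The arrival time at the center of a straight swim from the state at [t1], at least r0 / mu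
     since k loses at most 1 per unit of time. With this e the quantity of [plane_wave] starts from
     0. *)
  set e := t1 + k t1.
  have wave b : t1 <= b -> b <= T ->
      k b * (cos (y b) * cos (e - b) - `|sin (y b)| * sin (e - b)) + (e - b) <= 0.
    move=> tb bT; have kp s : t1 <= s <= b -> 0 < k s.
      by move=> /andP[ts sb]; apply: kpos; rewrite ts (le_trans sb).
    have := plane_wave tb kp (acdS (lexx _) bT hk) (acdS (lexx _) bT hy) e.
    rewrite [e - t1]addrAC subrr add0r c1 s1 => /le_trans; apply.
    rewrite (_ : _ + _ = k t1 * (1 - (cos (k t1) ^+ 2 + sin (k t1) ^+ 2))); last by ring.
    by rewrite cos2Dsin2 subrr mulr0.
  (* If E came before e, the quantity there would be cos (e - T) + (e - T) >= 1. Otherwise at time e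
     it reads k cos y <= 0. *)
  have [Te|eT] := leP T e.
    have := wave T (ltW t1T) (lexx T).
    rewrite kT yT sinBpi sT oppr0 normr0 !mul1r mul0r subr0.
    have := @cos_ge_sub (e - T); rewrite subr_ge0 => /(_ Te); lra.
  have t1e : t1 <= e by rewrite lerDl ltW.
  apply: (@quarter l e) => //.
  - exact: le_trans t1e.
  - by left.
  - exact: le_trans t1e.
  - exact: ltW.
  - have := wave e t1e (ltW eT); rewrite subrr cos0 sin0 mulr1 mulr0 subr0 addr0.
    by rewrite pmulr_rle0// kpos// t1e ltW.
  - have := kstart t1 t10; rewrite /e; lra.
  - by move=> s /andP[es sT']; apply: zone; rewrite sT' (le_trans t1e).
have {}lT : l < T.
  by rewrite lt_neqAle lT andbT; apply/eqP => lE; move: dl; rewrite lE leNgt dT.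
have kl : k l <= 0 by rewrite pmulr_lle0 ?invr_gt0.
have k0l : r0 / mu <= l by have := kstart l l0; lra.
have hl : h <= l.
  case: opening => [->//|[hpos rpos _ _ _]]; rewrite leNgt; apply/negP => /ltW lh.
  by have := dist0_open hpos rpos l0 lh; lra.
(* L has been at the center, at a time l >= r0 / mu. The count of pi / 2 starts at the last later
   time with cos y <= 0 if there is one, and at l if there is none. *)
have [[s [ls sT' cs]]|nos] := pselect (exists s, [/\ l < s, s <= T & cos (y s) <= 0]).
  pose X t := cos (y (clamp s T t)).
  have cX : continuous X.
    move=> t; apply: (@continuous_cvg _ _ _ _ _ _ (@cos R)); first exact: continuous_cos.
    have m1 := motion_acd mu0 c0 c4 Lpsi traj rge0 ex (lexx T) (ltW ls) (or_intror ls).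
    exact: (acd_clamp_continuous sT' m1).
  have XE t : s <= t <= T -> X t = cos (y t) by move=> tI; rewrite /X clampK.
  have [|t1 [/andP[st1 t1T] Xt1 after]] := last_hit sT' cX.
    by exists s; rewrite ?lexx// XE ?lexx.
  have {}t1T : t1 < T.
    rewrite lt_neqAle t1T andbT; apply/eqP => t1E; move: Xt1.
    by rewrite t1E XE ?sT' ?lexx// yT; lra.
  have X0 : X t1 = 0 by apply/eqP; rewrite eq_le Xt1 (right_ge0 cX t1T after).
  have lt1 : l < t1 by exact: lt_le_trans st1.
  move: X0; rewrite XE ?st1 ?ltW// => X0.
  apply: (@quarter l t1) => //.
  - exact: ltW.
  - by right.
  - by rewrite (le_trans hl)// ltW.
  - exact: ltW.
  - by rewrite X0.
  - by move: k0l; lra.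
  - move=> t /andP[tt tT]; move: tt; rewrite le_eqVlt => /predU1P[<-|tt].
      right; rewrite (le_trans (width_le mu r0 c0 psi l t1))//.
      have -> : `|sin (y t1)| = 1.
        apply/eqP; rewrite -(@eqrXn2 _ 2)// expr1n real_normK ?num_real//.
        by rewrite sin2cos2 X0 expr0n subr0.
      by rewrite (le_trans c4)//; lra.
    by left; rewrite -XE ?after// tT (le_trans st1)// ltW.
have zone s : l < s -> s <= T -> 0 < cos (y s).
  by move=> ls sT'; rewrite ltNge; apply/negP => cs; apply: nos; exists s.
have Tl : T - l < pi / 2 by lra.
set q := (cos (T - l) - sin (T - l) * cos (T - l)) * ((cos (T - l))^-1 * (cos (T - l))^-1).
have fin a : l < a -> a <= T -> 0 < q /\ q <=
    (k a * (cos (y a) * cos (a - l) - `|sin (y a)| * sin (a - l)) - sin (a - l) * cos (a - l))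
    * ((cos (a - l))^-1 * (cos (a - l))^-1).
  move=> la aT; apply: (@finish l a l) => //.
  - exact: ltW.
  - by right.
  - by rewrite (le_trans hl)// ltW.
  - by rewrite subr_ge0 ltW.
  - by move=> s /andP[as_ sT']; left; apply: zone => //; exact: lt_le_trans as_.
have [q0 _] := fin T lT (lexx T).
(* The angle is undefined at l, so the quantity is evaluated at l + d. There k <= d and cos d >= 1/2
   bound it by 4 d <= q / 2, below the value q required. *)
pose d := Num.min (T - l) (Num.min (1 / 2) (q / 8)).
have d0' : 0 < d by rewrite !lt_min subr_gt0 lT divr_gt0//=; lra.
have dT' : l + d <= T by rewrite -lerBrDl ge_min lexx.
have d2 : d <= 1 / 2 by rewrite !ge_min lexx orbT.
have dq : d <= q / 8 by rewrite !ge_min lexx !orbT.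
have ld : l < l + d by rewrite ltrDl.
have ldl : l + d - l = d by ring.
have [_] := fin (l + d) ld dT'; rewrite ldl.
have kd : k (l + d) <= d.
  have := dist0_lip r0 mu0 Lpsi l (l + d); rewrite ldl (gtr0_norm d0').
  rewrite ler_norml => /andP[_ H]; rewrite ler_pdivrMr//; lra.
have kp : 0 < k (l + d) by rewrite divr_gt0// pos.
have cd := cos_ge_sub (ltW d0').
have c2 : 1 / 2 <= cos d by lra.
have sd : 0 <= sin d by apply: sin_ge0_pi; apply/andP; split; lra.
have ci : (cos d)^-1 <= 2.
  by rewrite -[leRHS]invrK lef_pV2 ?posrE ?invr_gt0//; lra.
have ci0 : 0 <= (cos d)^-1 by rewrite invr_ge0; lra.
have num : k (l + d) * (cos (y (l + d)) * cos d - `|sin (y (l + d))| * sin d) - sin d * cos d <= d.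
  have H1 : cos (y (l + d)) * cos d <= 1.
    have := cos_le1 (y (l + d)); have := cos_le1 d; nra.
  have H2 : 0 <= `|sin (y (l + d))| * sin d by rewrite mulr_ge0.
  have H3 : 0 <= sin d * cos d by rewrite mulr_ge0//; lra.
  nra.
have sq : (cos d)^-1 * (cos d)^-1 <= 4 by nra.
have sq0 : 0 <= (cos d)^-1 * (cos d)^-1 by rewrite mulr_ge0.
move=> H; have := le_trans H (ler_wpM2r sq0 num).
have := ler_wpM2l (ltW d0') sq; lra.
Qed.

End Reaching.

Section Crossing.

Let K s := tangent (k s).
Let X0 (C S K : R) := C * cos K + S * sin K - K * (S * cos K - C * sin K).
Let Y0 (C S K : R) := S * cos K - C * sin K + K * (C * cos K + S * sin K).
Let gap s := barrier mu (dist0 s) - acos (cos (th s)).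

Let wave_gap s : mu <= dist0 s ->
  X0 (cos (y s)) `|sin (y s)| (K s) = k s * cos (gap s) /\
  Y0 (cos (y s)) `|sin (y s)| (K s) = k s * sin (gap s).
Proof.
move=> ds; have k1 : 1 <= k s by rewrite ler_pdivlMr// mul1r.
have -> : gap s = pi - acos (cos (th s)) - (tangent (k s) - atan (tangent (k s))).
  by rewrite /gap barrierE//; ring.
rewrite sin_barrier// cos_barrier// (sinB (pi - _)) (cosB (pi - _)).
have -> : cos (pi - acos (cos (th s))) = cos (y s).
  by rewrite cosB cospi sinpi mul0r addr0 mulN1r cos_acos_cos cosBpi.
have -> : sin (pi - acos (cos (th s))) = `|sin (y s)|.
  rewrite sinB cospi sinpi mul0r sub0r mulN1r opprK sinBpi normrN.
  rewrite sin_acos ?cos_geN1 ?cos_le1// -sqrtr_sqr; congr Num.sqrt.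
  by rewrite sin2cos2.
by rewrite /X0 /Y0 -/(K s).
Qed.

Let wave_continuous (F C S G : R -> R) : continuous C -> continuous S -> continuous G ->
  F = (fun s => X0 (C s) (S s) (G s)) \/ F = (fun s => Y0 (C s) (S s) (G s)) ->
  continuous F.
Proof.
move=> cC cS cG FE t.
have c1 : cos (G s) @[s --> t] --> cos (G t).
  by apply: (@continuous_cvg _ _ _ _ _ _ (@cos R)); [exact: continuous_cos|exact: cG].
have s1 : sin (G s) @[s --> t] --> sin (G t).
  by apply: (@continuous_cvg _ _ _ _ _ _ (@sin R)); [exact: continuous_sin|exact: cG].
have p : C s * cos (G s) + S s * sin (G s) @[s --> t] --> C t * cos (G t) + S t * sin (G t).
  by apply: cvgD; apply: cvgM => //; [exact: cC|exact: cS].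
have q : S s * cos (G s) - C s * sin (G s) @[s --> t] --> S t * cos (G t) - C t * sin (G t).
  by apply: cvgB; apply: cvgM => //; [exact: cS|exact: cC].
by case: FE => ->; [apply: cvgB => //|apply: cvgD => //]; apply: cvgM => //; exact: cG.
Qed.

(** At a crossing D = 0, while D > 0 just before; but M is running there, so [barrier_wave] makes
    sin D nondecreasing. *)
Lemma no_crossing : ~ crosses_barrier mu T r th.
Proof.
move=> [rT]; rewrite /state/= => crossed.
have pi0 := pi_ge2 R.
have TT : 0 <= T <= T by rewrite T0 lexx.
rewrite rE// in rT crossed.
have dT : 0 < dist0 T by exact: lt_trans rT.
(* A play constrains the state before T only; the bound at T follows from the Lipschitz continuity
   of the radius. *)
have dT1 : dist0 T <= 1.
  have [TE|T0'] := eqVneq T 0; first by rewrite TE d0; have [/andP[]] := start.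
  rewrite leNgt; apply/negP => d1.
  have Tpos : 0 < T by rewrite lt_neqAle eq_sym T0' T0.
  pose s := Num.max 0 (T - (dist0 T - 1) / 2).
  have sT' : s < T by rewrite gt_max Tpos; lra.
  have s0 : 0 <= s by rewrite le_max lexx.
  have sI : 0 <= s < T by rewrite s0.
  have [/andP[_ r1] _ _] := inspace sI.
  have := dist0_lip r0 mu0 Lpsi s T; rewrite ler_norml => /andP[_].
  rewrite (ger0_norm (_ : 0 <= T - s)); last by lra.
  have : T - (dist0 T - 1) / 2 <= s by rewrite le_max lexx orbT.
  have : dist0 s <= 1 by move: r1; rewrite /= rE// s0 ltW.
  have : mu * (T - s) <= T - s by rewrite ger_pMl ?subr_gt0// ltW.
  lra.
have B1 : barrier mu 1 <= barrier mu (dist0 T) by apply: barrier_le => //; exact: ltW.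
have /andP[A0 A1] := acos_cos_bnd (th T).
have hT : h < T.
  rewrite ltNge; apply/negP => Th; have [_ th1 th2] := opening_angle T0 Th (lexx T).
  have aE : acos (cos (th T)) = `|th T|.
    have nI : `|th T| \in `[0, pi] by rewrite in_itv/= normr_ge0 (le_trans th2)//; lra.
    rewrite -[RHS](cosK nI).
    by case: (ger0P (th T)) => _; rewrite ?cosN.
  move: crossed; rewrite aE; lra.
set l := last_center mu r0 psi T.
have ex : excursion l T by exact: last_center_excursion.
have [l0 lT pos st] := ex.
have {}lT : l < T.
  rewrite lt_neqAle lT andbT; apply/eqP => lE; move: st; rewrite lE => -[[TE _]|].
    by move: hT; rewrite TE ltNge h0.
  by rewrite leNgt dT.
set kT := k T.
have kT1 : 1 < kT by rewrite ltr_pdivlMr// mul1r.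
(* Late enough for the opening to be over, for the excursion to have begun, and for k to stay above
   (1 + kT) / 2 > 1, where [tangent] is smooth. *)
pose a0 := Num.max (Num.max h ((l + T) / 2)) (T - (kT - 1) / 2).
have a0T : a0 < T by rewrite !gt_max hT; apply/andP; split; lra.
have ha0 : h <= a0 by rewrite !le_max lexx.
have la0 : l < a0 by rewrite !lt_max; apply/orP; left; apply/orP; right; lra.
have a0k : T - (kT - 1) / 2 <= a0 by rewrite le_max lexx orbT.
have ak s : a0 <= s <= T -> (1 + kT) / 2 <= k s.
  move=> /andP[as_ sT']; have := dist0_lip r0 mu0 Lpsi s T.
  rewrite ler_norml => /andP[_].
  rewrite (ger0_norm (_ : 0 <= T - s)); last by lra.
  have : dist0 T = kT * mu by rewrite divfK// gt_eqF.
  move=> -> H; rewrite ler_pdivlMr//.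
  have : mu * (T - s) <= mu * ((kT - 1) / 2) by rewrite ler_pM2l//; lra.
  lra.
have dmu s : a0 <= s <= T -> mu < dist0 s.
  by move=> /ak; rewrite ler_pdivlMr//; apply: lt_le_trans; rewrite ltr_pMl//; lra.
have m1 := motion_acd mu0 c0 c4 Lpsi traj rge0 ex (lexx T) (ltW la0) (or_intror la0).
pose Yc s := y (clamp a0 T s).
have cY : continuous Yc by exact: acd_clamp_continuous (ltW a0T) m1.
have YcE s : a0 <= s <= T -> Yc s = y s by move=> sI; rewrite /Yc clampK.
have cC : continuous (fun s => cos (Yc s)).
  by move=> s; apply: (@continuous_cvg _ _ _ _ _ _ (@cos R)); [exact: continuous_cos|exact: cY].
have cS : continuous (fun s => `|sin (Yc s)|).
  move=> s; apply: cvg_norm.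
  by apply: (@continuous_cvg _ _ _ _ _ _ (@sin R)); [exact: continuous_sin|exact: cY].
have cK : continuous K.
  move=> s; apply: (@continuous_cvg _ _ _ _ _ _ (@Num.sqrt R)); first exact: sqrt_continuous.
  apply: cvgB; last exact: cvg_cst.
  have ck : k u @[u --> s] --> k s by apply: cvgM; [exact: dist0_continuous|exact: cvg_cst].
  exact: (cvgM ck ck).
pose XX s := X0 (cos (Yc s)) `|sin (Yc s)| (K s).
pose YY s := Y0 (cos (Yc s)) `|sin (Yc s)| (K s).
have cXX : continuous XX by apply: (wave_continuous cC cS cK); left.
have cYY : continuous YY by apply: (wave_continuous cC cS cK); right.
have wg s : a0 <= s <= T -> XX s = k s * cos (gap s) /\ YY s = k s * sin (gap s).
  by move=> sI; rewrite /XX /YY YcE//; apply: wave_gap; rewrite ltW// dmu.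
have TI : a0 <= T <= T by rewrite lexx ltW.
have kpos s : a0 <= s <= T -> 0 < k s.
  by move=> /dmu ds; rewrite divr_gt0// (lt_trans mu0).
have YYpos s : a0 <= s -> s < T -> 0 < YY s.
  move=> as_ sT'; have sI : a0 <= s <= T by rewrite as_ ltW.
  have [_ ->] := wg s sI; apply: mulr_gt0; first exact: kpos.
  have s0 : 0 <= s by rewrite (le_trans h0)// (le_trans ha0).
  have sI' : 0 <= s < T by rewrite s0.
  have [_ _] := inspace sI'.
  rewrite /= rE ?s0 ?ltW// => /(_ (dmu _ sI)) H.
  apply: sin_gt0_pi; rewrite subr_gt0 H/= ltrBlDr.
  have := barrier_lt mu0 (lexx mu) (dmu _ sI); rewrite barrier_mu//.
  by have /andP[] := acos_cos_bnd (th s); lra.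
have near_end (P : R -> Prop) : (\forall s \near T, P s) ->
    exists a, [/\ a0 <= a, a < T & forall s, a <= s <= T -> P s].
  move=> /nbhs_ballP[e /= e0 He]; exists (Num.max a0 (T - e / 2)).
  split; first by rewrite le_max lexx.
    by rewrite gt_max a0T; lra.
  move=> s /andP[]; rewrite ge_max => /andP[_ es] sT'; apply: He.
  by rewrite /ball/= ger0_norm; lra.
have [XT YT] := wg T TI.
(* The crossing gives D <= 0 at T; by continuity the positivity of k sin D before T excludes D <
   0. *)
have gap0 : gap T = 0.
  apply/eqP; rewrite eq_le subr_le0 crossed/= leNgt; apply/negP => g0.
  have : YY T < 0.
    rewrite YT pmulr_rlt0 ?kpos// -oppr_gt0 -sinN; apply: sin_gt0_pi.
    by rewrite oppr_gt0 g0 /gap/=; have := bar0; lra.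
  move/(cvgr_lt _ (cYY T)) => /near_end[a [aa aT /(_ a)]].
  by rewrite lexx ltW// => /(_ isT); rewrite ltNge ltW// YYpos.
have XT0 : 0 < XX T by rewrite XT gap0 cos0 mulr1 kpos.
(* On the barrier either L is on the antipodal side, or th lies between the barrier at radius 1 and
   pi / 2, where [hc] applies. Both inequalities are strict, so they persist shortly before T. *)
have zoneT : 0 < cos (Yc T) \/ c < `|sin (Yc T)|.
  rewrite YcE// cosBpi sinBpi normrN.
  have [ct|ct] := ltP (cos (th T)) 0; [by left; rewrite oppr_gt0|right].
  have aE : acos (cos (th T)) = barrier mu (dist0 T) by move/eqP: gap0; rewrite subr_eq0 => /eqP.
  have : c < sin (acos (cos (th T))).
    apply: hc; first by rewrite aE.
    rewrite leNgt; apply/negP => H.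
    have : cos (acos (cos (th T))) < cos (pi / 2).
      by rewrite ltr_cos ?in_itv/= ?A0 ?A1//; apply/andP; split; lra.
    by rewrite cos_acos_cos cos_pihalf; lra.
  by rewrite sin_acos ?cos_geN1 ?cos_le1// -sin2cos2 sqrtr_sqr.
have nz : \forall s \near T, 0 < cos (Yc s) \/ c < `|sin (Yc s)|.
  case: zoneT => z.
    by apply: filterS (cvgr_gt _ (cC T) _ z) => s; left.
  by apply: filterS (cvgr_gt _ (cS T) _ z) => s; right.
have : \forall s \near T, 0 < XX s /\ (0 < cos (Yc s) \/ c < `|sin (Yc s)|).
  by apply: filterS2 (cvgr_gt _ (cXX T) _ XT0) nz => s; split.
move/near_end => [a [aa aT H]].
have la : l < a by exact: lt_le_trans aa.
have inI s : a <= s <= T -> a0 <= s <= T.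
  by move=> /andP[as_ ->]; rewrite (le_trans aa).
have zone s : a <= s <= T -> 0 < cos (y s) \/ width l s <= `|sin (y s)|.
  move=> sI; have [_] := H s sI; rewrite YcE ?inI// => -[?|cs]; [by left|right].
  exact: le_trans (width_le mu r0 c0 psi l s) (ltW cs).
have a_0 : 0 <= a by rewrite (le_trans l0)// ltW.
have hk := scaled_dist0_acd r0 mu0 Lpsi T a_0.
have hy := motion_run mu0 c0 c4 Lpsi traj rge0 ex (lexx T) (ltW la) (or_intror la)
  (le_trans ha0 aa) zone.
have m1' : 1 < (1 + kT) / 2 by lra.
have := barrier_wave (ltW aT) (fun s sI => kpos s (inI s sI)) hk hy m1'
  (fun s sI => ak s (inI s sI)).
have XX0 s : a <= s <= T -> 0 <= X0 (cos (y s)) `|sin (y s)| (K s).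
  by move=> sI; have [] := H s sI; rewrite /XX YcE ?inI// => /ltW.
move=> /(_ XX0); rewrite -/(Y0 _ _ (K a)) -/(Y0 _ _ (K T)).
have aI : a <= a <= T by rewrite lexx ltW.
have := YT; rewrite /YY YcE// => ->; rewrite gap0 sin0 mulr0 mul0r.
rewrite leNgt divr_gt0// ?kpos ?inI//.
by have := YYpos a aa aT; rewrite /YY YcE ?inI.
Qed.

End Crossing.

End ManGuarantee.

Lemma man_guarantee {R : realType} (mu r0 h c : R) : 0 < mu -> mu < 1 -> 0 < c -> c <= 1 / 4 ->
  state_space mu (r0, h) -> 0 < barrier mu 1 ->
  (forall x : R, barrier mu 1 <= x -> x <= pi / 2 -> c < sin x) ->
  h = 0 \/ [/\ 0 < h, 0 < r0 - mu * h,
    h * (2 + mu / (r0 - mu * h)) <= (r0 - mu * h) / mu,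
    h * (2 + mu / (r0 - mu * h)) < barrier mu 1 & h * (2 + mu / (r0 - mu * h)) <= 1] ->
  M_guarantees mu (r0, h) (man mu r0 h c) (r0 / mu + pi / 2).
Proof.
move=> mu0 mu1 c0 c4 st b0 hc op psi Lpsi T r th pl; split.
  exact: (no_crossing mu0 mu1 c0 c4 st b0 hc op Lpsi pl).
exact: (reaching_time mu0 mu1 c0 c4 st b0 op Lpsi pl).
Qed.

(** * Equilibrium *)

Section Equilibrium.
Context {R : realType}.
Implicit Types (a b s t x : R).

(** After the last zero of u, the bound on the rate keeps |u| <= 1 for a unit of time; there u^2 is
    nonincreasing, so u cannot leave 0. Only the sign of the feedback counts. *)
Lemma stays_zero a b (u f : R -> R) : a <= b -> acd a b u f -> u a = 0 ->
  (forall s, a <= s <= b -> `|f s| <= 1) ->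
  (forall s, a <= s <= b -> `|u s| <= 1 -> u s * f s <= 0) -> u b = 0.
Proof.
move=> ab hu ua f1 uf; apply/eqP; apply: contraT => ub.
have cu : continuous (fun s => `|u (clamp a b s)|).
  by move=> s; apply: cvg_norm; exact: (acd_clamp_continuous ab hu).
have [|t1 [/andP[at1 t1b] ut1 after]] := last_hit ab cu.
  by exists a; rewrite ?lexx ?ab// clampK ?lexx ?ab// ua normr0.
have ut0 : u t1 = 0 by apply/eqP; rewrite -normr_le0 -(@clampK _ a b t1)// at1.
have {}t1b : t1 < b.
  by rewrite lt_neqAle t1b andbT; apply: contra_neq ub => <-.
pose d := Num.min b (t1 + 1).
have td : t1 < d by rewrite lt_min t1b ltrDl ltr01.
have db : d <= b by rewrite ge_min lexx.
have d1 : d <= t1 + 1 by rewrite ge_min lexx orbT.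
have hu' := acdS at1 db hu.
have small s : t1 <= s <= d -> `|u s| <= 1.
  move=> /andP[ts sd]; have [[mf _] e] := hu'.
  rewrite -[u s]subr0 -ut0 e//.
  have fs : measurable_fun `[t1, s] f.
    by apply: measurable_funS mf => // z /=; rewrite !in_itv/= => /andP[-> /le_trans]; apply.
  rewrite (le_trans (intg_norm ts fs (_ : forall z, t1 <= z <= s -> `|f z| <= 1)))//; last lra.
  by move=> z /andP[tz zs]; apply: f1; rewrite (le_trans at1 tz) (le_trans zs)// (le_trans sd).
have := acd_le (ltW td) (acdM hu' hu') _; rewrite ut0 mul0r => H.
have := after d td db; rewrite clampK ?db ?(le_trans at1 (ltW td))// normr_gt0.
have : u d * u d <= 0.
  apply: H => s /[dup] sI /andP[ts sd]; rewrite (mulrC (f s)).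
  have : u s * f s <= 0 by apply: uf (small _ sI); rewrite (le_trans at1 ts) (le_trans sd).
  lra.
by rewrite -expr2 => ud /negP; rewrite -sqrf_eq0 eq_le ud sqr_ge0.
Qed.

(* M turns to meet L at [th = 0], waits there until L is at the center, and
   then runs. *)
Definition stroll h k0 t : R := if t < h then 1 else if t < k0 then 0 else -1.

Lemma stroll_control h k0 : M_control (stroll h k0).
Proof.
split.
  apply: measurable_fun_ifT => //; first exact: measurable_fun_ltr.
  by apply: measurable_fun_ifT => //; exact: measurable_fun_ltr.
by move=> t; rewrite /stroll; do 2?case: ifP => _; lra.
Qed.

Lemma sweepE h k0 t : 0 <= h -> 0 <= t -> t <= k0 ->
  h - intg (stroll h k0) 0 t = Num.max (h - t) 0.
Proof.
move=> h0 t0 tk; have [mw w1] := stroll_control h k0.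
have bw a b : bmeas a b (stroll h k0).
  by split; [exact: measurable_funTS|exists 1 => s _; rewrite ler_norml].
have early s : 0 <= s -> s <= h -> intg (stroll h k0) 0 s = s.
  move=> s0 sh; rewrite (@intg_ext_oo _ _ _ _ (fun=> 1))//.
  - by rewrite intg_cst// mul1r subr0.
  - exact: bmeas_cst.
  - by move=> z /andP[_ zs]; rewrite /stroll (lt_le_trans zs).
have [th|ht] := leP t h; first by rewrite early// max_l// subr_ge0.
rewrite (intg_cat h0 (ltW ht) (bw _ _)) early// (@intg_ext_oo _ h t _ (fun=> 0))//.
- by rewrite intg_cst ?ltW// mul0r addr0 subrr max_r// subr_le0 ltW.
- exact: bmeas_cst.
- by move=> z /andP[hz zt]; rewrite /stroll ltNge (ltW hz)/= (lt_le_trans zt).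
Qed.

Variables (mu r0 h c : R).
Hypotheses (mu0 : 0 < mu) (r00 : 0 <= r0) (c0 : 0 < c) (c4 : c <= 1 / 4).
Hypotheses (h0 : 0 <= h) (hk : h <= r0 / mu).

Let k0 := r0 / mu.
Let V := k0 + pi / 2.
Let w := stroll h k0.
Let psi := lady k0 w.
Let mw : M_control w. Proof. exact: stroll_control. Qed.
Let k00 : 0 <= k0. Proof. by rewrite divr_ge0// ltW. Qed.
Let V0 : 0 <= V. Proof. by rewrite addr_ge0// divr_ge0// pi_ge0. Qed.
Let muk0 : mu * k0 = r0. Proof. by rewrite /k0 mulrC divfK// gt_eqF. Qed.
Let Lpsi : L_control psi. Proof. exact: lady_control. Qed.

Lemma stroll_pursuit t : k0 <= t -> t <= V -> pursuit w k0 t = sin (t - k0).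
Proof.
move=> kt tV; apply: (pursuit_max mw.1 (M_control_norm mw)) => //; last by rewrite /V in tV; lra.
move=> s /andP[ks _]; rewrite /w /stroll ltNge (le_trans hk ks)/= ltNge ks/=.
by rewrite sqrrN expr1n.
Qed.

Lemma lady_stroll t : k0 < t -> t <= V -> psi t = - (t - k0).
Proof.
move=> kt tV; rewrite /psi /lady leNgt kt/= stroll_pursuit// ?ltW//.
rewrite /w /stroll ltNge (le_trans hk (ltW kt))/= ltNge (ltW kt)/= mulrN1 -sinN /asin1.
rewrite clampK ?sin_geN1 ?sin_le1//.
apply: sinK; rewrite in_itv/=; move: tV; rewrite /V; have := pi_ge0 R.
by move=> *; apply/andP; split; lra.
Qed.

Lemma lady_stroll_r t : lady_r mu r0 w t =
  if t <= k0 then r0 - mu * t else mu * pursuit w k0 t.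
Proof. by []. Qed.

Lemma lady_stroll_th t : 0 <= t -> lady_th mu r0 h w t =
  if t <= k0 then Num.max (h - t) 0 else pi.
Proof. by move=> t0; rewrite /lady_th -/k0; case: ifP => // tk; rewrite sweepE. Qed.

Lemma stroll_trajectory :
  trajectory mu (r0, h) psi w V (lady_r mu r0 w) (lady_th mu r0 h w).
Proof.
apply: lady_trajectory => // s /andP[ks sV].
by rewrite stroll_pursuit// sin_le1.
Qed.

Let D := dist0 mu r0 psi.

Let D_r t : 0 <= t <= V -> D t = lady_r mu r0 w t.
Proof.
by move=> tI; have [_ rE _ _] := stroll_trajectory; rewrite rE// /D /dist0 intg.unlock.
Qed.

Let D_early t : 0 <= t <= k0 -> D t = r0 - mu * t.
Proof.
move=> /andP[t0 tk]; rewrite D_r ?t0 ?lady_stroll_r ?tk//=.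
by rewrite (le_trans tk)// lerDl divr_ge0// pi_ge0.
Qed.

Let D_late t : k0 < t -> t <= V -> D t = mu * sin (t - k0).
Proof.
move=> kt tV; rewrite D_r ?(le_trans k00 (ltW kt))// lady_stroll_r leNgt kt/=.
by rewrite stroll_pursuit// ltW.
Qed.

Let D_late_gt0 t : k0 < t -> t <= V -> 0 < D t.
Proof.
move=> kt tV; rewrite D_late// mulr_gt0//; apply: sin_gt0_pi; rewrite subr_gt0 kt/=.
move: tV; rewrite /V; have := pi_gt0 R; lra.
Qed.

(** L swims radially and contributes nothing to the angle, so th = 0 at time h; from then on the
    softened law pushes back towards th = 0 and M stands still. *)
Lemma man_stroll_early t : 0 <= t -> t < k0 -> man mu r0 h c psi t = w t.
Proof.
move=> t0 tk.
have Dpos s : 0 <= s -> s <= t -> 0 < D s.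
  move=> s0 st; have sk := le_lt_trans st tk.
  by rewrite D_early ?s0 ?ltW// subr_gt0 -muk0 ltr_pM2l.
have ex : excursion mu r0 psi 0 t.
  split=> //; last by left; split=> //; exact: Dpos.
  by move=> s s0 st; apply: Dpos => //; exact: ltW.
rewrite (man_excursion h c ex (Dpos t t0 (lexx t))) /run.
have [th|ht] := ltP t h; first by rewrite /w /stroll th opprK.
have hd := dodge_acd h mu0 c0 c4 Lpsi ex.
have d0 := dodge0 h mu0 c0 c4 Lpsi ex.
set v := dodge mu r0 h c psi 0 in hd d0 *.
have vh : v h = - h.
  have [bd e] := hd; have := e 0 h (lexx _) h0 ht; rewrite d0 subr0 => ->.
  rewrite (@intg_ext_oo _ _ _ _ (fun=> -1)).
  - by rewrite intg_cst// subr0 mulN1r.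
  - exact: bmeasS (lexx _) ht bd.
  - exact: bmeas_cst.
  - by move=> s /andP[_ sh]; rewrite /run sh.
have fa s : 0 <= s -> s <= t -> free_angle mu r0 h psi 0 s = h - pi.
  move=> s0 st; rewrite /free_angle (Dpos 0 (lexx _) t0).
  rewrite (@intg_ext _ _ _ _ (fun=> 0)) ?intg_cst// ?mul0r ?addr0// => z /andP[z0 zs].
  by rewrite /spin /psi /lady (le_trans zs (le_trans st (ltW tk))) sinpi mulr0.
have hu : acd h t (fun s => v s + h)
    (fun s => law (width mu r0 c psi 0 s) (v s + h - pi)).
  apply: acd_ext (acdD (acdS h0 (lexx t) hd) (acd_cst h t h)) => // s /andP[hs st].
  rewrite /run ltNge hs/= addr0 fa ?(le_trans h0 hs)//; congr law; ring.
(* [v + h] is th itself up to time t, and the law is evaluated at th - pi. *)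
have vt : v t + h = 0.
  apply: (stays_zero ht hu); first by rewrite vh addNr.
    by move=> s _; exact: law_bnd.
  move=> s /andP[hs st] u1; have kap : 0 < width mu r0 c psi 0 s.
    by apply: (width_gt0 c0 ex); rewrite (le_trans h0 hs).
  set u := v s + h in u1 *; set kp := width _ _ _ _ _ _ in kap *.
  have /andP[u2 u3] : -1 <= u <= 1 by rewrite -ler_norml.
  have pi2 := pi_ge2 R.
  have cu : 0 <= cos u by apply: cos_ge0_pihalf; apply/andP; split; lra.
  rewrite /law cosBpi oppr_gt0 ltNge cu/= sinBpi mulNr.
  have [u0|u0] := leP 0 u.
    have su : 0 <= sin u / kp.
      by rewrite divr_ge0 ?(ltW kap)//; apply: sin_ge0_pi; rewrite u0; lra.
    apply: mulr_ge0_le0 => //.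
    by rewrite /clamp ge_max lerN10 ge_min oppr_le0 su orbT.
  have su : 0 <= - (sin u / kp).
    rewrite -mulNr divr_ge0 ?(ltW kap)// -sinN; apply: sin_ge0_pi.
    by apply/andP; split; lra.
  apply: mulr_le0_ge0; first exact: ltW.
  by rewrite /clamp le_max le_min ler01 su orbT.
have ang : h - pi + v t = - pi by move: vt; lra.
rewrite fa// ang /law cosN cospi sinN sinpi ltr0N1 oppr0 mul0r clampK ?lerN10 ?ler01// oppr0.
by rewrite /w /stroll ltNge ht/= tk.
Qed.

(** L's share of the angle is -(t - k0); the maximal solution t - k0 restores y = 0, where the law
    has the value 1. *)
Lemma man_stroll_late t : k0 < t -> t <= V -> man mu r0 h c psi t = w t.
Proof.
move=> kt tV; have pi0 := pi_gt0 R.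
have Dk : D k0 = 0 by rewrite D_early ?lexx ?k00// muk0 subrr.
have ex : excursion mu r0 psi k0 t.
  split=> //; [exact: ltW| |by right; rewrite -/D Dk].
  by move=> s ks st; apply: D_late_gt0 => //; exact: le_trans tV.
have fa s : k0 < s -> s <= t -> free_angle mu r0 h psi k0 s = - (s - k0).
  move=> ks st; have sV := le_trans st tV.
  rewrite /free_angle -/D Dk ltxx leNgt ks/=.
  apply: (cvg_lim (@Rhausdorff R)).
  have H : - (s - a) @[a --> k0^'+] --> - (s - k0).
    apply: cvgN; apply: cvgB; first exact: cvg_cst.
    exact: cvg_at_right_filter (@cvg_id _ _).
  apply: cvg_trans H; apply: near_eq_cvg; near=> a.
  have ka : k0 < a by near: a; exact: nbhs_right_gt.
  have as_ : a <= s by near: a; exact: nbhs_right_le.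
  rewrite (@intg_ext _ _ _ _ (fun=> -1)) ?intg_cst ?mulN1r// => z /andP[az zs].
  have kz : k0 < z by exact: lt_le_trans az.
  have zV := le_trans zs sV.
  have Dz := D_late_gt0 kz zV; rewrite /spin -/D lady_stroll// sinN.
  move: Dz; rewrite D_late// => Dz; rewrite mulrN; congr (- _).
  have : sin (z - k0) != 0 by move: Dz; rewrite pmulr_rgt0// => /gt_eqF ->.
  by move=> sz; field; rewrite sz gt_eqF.
have fk : free_angle mu r0 h psi k0 k0 = 0 by rewrite /free_angle -/D Dk ltxx lexx.
have fa' s : k0 <= s -> s <= t -> free_angle mu r0 h psi k0 s = - (s - k0).
  by rewrite le_eqVlt => /predU1P[<- _|/fa//]; rewrite fk subrr oppr0.
have law0 : law c 0 = 1 :> R by rewrite /law cos0 ltr01 sin0 /sgr lexx.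
have wc s : width mu r0 c psi k0 s = c by rewrite /width -/D Dk ltxx.
have tI : k0 <= t <= t by rewrite lexx ltW.
have dt : dodge mu r0 h c psi k0 t = 1 * (t - k0).
  (* The line of slope 1 keeps y at 0 and has the rate [law c 0 = 1], so it is a solution, and the
     largest one. *)
  apply: (maxsol_top (run_hyp h mu0 c0 c4 Lpsi ex)) tI => s /andP[ks st].
  by rewrite /run ltNge (le_trans hk ks)/= wc fa'// mul1r addNr.
rewrite (man_excursion h c ex (D_late_gt0 kt tV)) /run dt mul1r fa' ?(ltW kt)// addNr wc law0.
by rewrite /w /stroll ltNge (le_trans hk (ltW kt))/= ltNge (ltW kt).
Unshelve. all: by end_near. Qed.

Lemma man_stroll : ae_eq_on V (man mu r0 h c psi) w.
Proof.
(* At the instant of the center M's strategy has its conventional value 0, while [stroll] is -1. *)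
exists [set k0]; split; [exact: measurable_set1|exact: lebesgue_measure_set1|].
move=> t /= nt; apply/eqP; apply: contraT => tk; exfalso; apply: nt => /andP[t0 tV].
by move: tk; rewrite neq_lt => /orP[tk|kt]; [exact: man_stroll_early|exact: man_stroll_late].
Qed.

End Equilibrium.

(** * The two strategies form a saddle point and produce this play *)

Section StrollEquilibrium.
Context {R : realType}.
Implicit Types (s t x : R).
Variables (mu r0 h : R).
Hypotheses (mu0 : 0 < mu) (mu1 : mu < 1) (bar0 : 0 < barrier mu 1).
Hypothesis start : state_space mu (r0, h).
Hypothesis opening : h = 0 \/ [/\ 0 < h, 0 < r0 - mu * h,
  h * (2 + mu / (r0 - mu * h)) <= (r0 - mu * h) / mu,
  h * (2 + mu / (r0 - mu * h)) < barrier mu 1 & h * (2 + mu / (r0 - mu * h)) <= 1].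

Let k0 := r0 / mu.
Let w := stroll h k0.
Let r := lady_r mu r0 w.
Let th := lady_th mu r0 h w.

Let r00 : 0 <= r0. Proof. by have [/andP[]] := start. Qed.
Let r01 : r0 <= 1. Proof. by have [/andP[]] := start. Qed.
Let h0 : 0 <= h. Proof. by have [_ /andP[]] := start. Qed.
Let k00 : 0 <= k0. Proof. by rewrite divr_ge0// ltW. Qed.
Let muk0 : mu * k0 = r0. Proof. by rewrite /k0 mulrC divfK// gt_eqF. Qed.

Let h1 : h <= 1.
Proof.
case: opening => [->|[hpos rpos _ _ e]]; first by rewrite ler01.
rewrite (le_trans _ e)// ler_peMr//.
by have : 0 <= mu / (r0 - mu * h); [rewrite divr_ge0// ltW|lra].
Qed.

Let hpi : h < pi.
Proof. by rewrite (le_lt_trans h1)// (lt_le_trans _ (pi_ge2 R))// ltr1n. Qed.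

Let hk : h <= k0.
Proof.
case: opening => [->//|[_ rpos _ _ _]].
by rewrite /k0 ler_pdivlMr// mulrC -subr_ge0 ltW.
Qed.

Lemma stroll_state t : 0 <= t -> t <= k0 ->
  state r th t = (r0 - mu * t, Num.max (h - t) 0).
Proof.
move=> t0 tk; rewrite /state /r /th lady_stroll_r (lady_stroll_th _ _ h0 t0) -/k0 tk cosK//.
rewrite in_itv/= le_max lexx orbT/= ge_max pi_ge0 andbT.
by rewrite (le_trans _ (ltW hpi))// gerBl.
Qed.

Lemma stroll_state_late t : k0 < t -> t <= k0 + pi / 2 ->
  state r th t = (mu * sin (t - k0), pi).
Proof.
move=> kt tV; have t0 := le_trans k00 (ltW kt).
rewrite /state /r /th lady_stroll_r (lady_stroll_th _ _ h0 t0) -/k0 leNgt kt/= (stroll_pursuit hk (ltW kt) tV) cosK//.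
by rewrite in_itv/= pi_ge0 lexx.
Qed.

Let stroll_play : play mu (r0, h) (lady k0 w) w (k0 + pi / 2) r th.
Proof.
have pi0 := pi_gt0 R.
split; [by rewrite addr_ge0// divr_ge0// pi_ge0|exact: stroll_trajectory|].
move=> t /andP[t0 tV]; have [tk|kt] := leP t k0; last first.
  rewrite stroll_state_late// ?ltW//.
  have s0 : 0 <= sin (t - k0) by apply: sin_ge0_pi; apply/andP; split; lra.
  have s1 : sin (t - k0) < 1.
    by rewrite -(sin_pihalf R) ltr_sin ?in_itv/=; [lra|apply/andP; split; lra..].
  have rlt : mu * sin (t - k0) < mu by rewrite gtr_pMr.
  split; last by case=> e; move: rlt; rewrite e ltxx.
  split=> /=; first by rewrite mulr_ge0 ?(ltW mu0)//= (le_trans (ltW rlt))// ltW.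
    by rewrite pi_ge0 lexx.
  by move=> /(lt_trans rlt); rewrite ltxx.
have rt : 0 <= r0 - mu * t by rewrite subr_ge0 -muk0 ler_pM2l.
have rt0 : r0 - mu * t <= r0 by rewrite gerBl mulr_ge0// ltW.
have ht : Num.max (h - t) 0 <= h by rewrite ge_max h0 andbT gerBl.
rewrite stroll_state//; split; last by case=> _ e; move: hpi; rewrite -e ltNge ht.
split=> /=; first by rewrite rt (le_trans rt0).
  by rewrite le_max lexx orbT (le_trans ht)// ltW.
move=> mr; rewrite (le_lt_trans ht)//.
have [_ _ /= /(_ (lt_le_trans mr rt0)) hb] := start.
by rewrite (lt_le_trans hb)// barrier_le// ltW.
Qed.

Lemma stroll_equilibrium :
  equilibrium_play mu (r0, h) (lady k0 w) w (k0 + pi / 2) r th.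
Proof.
have pi0 := pi_gt0 R.
have mw : M_control w by exact: stroll_control.
have b1 : 0 < Num.min (barrier mu 1) 1 by rewrite lt_min bar0 ltr01.
(* Half of the lower bound given by [sin_ge_min], so that [hc] holds with strict inequality. *)
pose c := Num.min (barrier mu 1) 1 / 8.
have c0 : 0 < c by rewrite divr_gt0.
have c4 : c <= 1 / 4.
  by have : Num.min (barrier mu 1) 1 <= 1; [rewrite ge_min lexx orbT|rewrite /c; lra].
have hc (x : R) : barrier mu 1 <= x -> x <= pi / 2 -> c < sin x.
  move=> bx xp; apply: lt_le_trans (sin_ge_min (lt_le_trans bar0 bx) xp).
  have : Num.min (barrier mu 1) 1 <= Num.min x 1.
    by rewrite le_min !ge_min bx lexx orbT.
  rewrite /c; lra.
split=> //.
- by split=> //; exact: lady_control.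
- exists (lady k0), (man mu r0 h c); split.
  + split; [exact: lady_strategy|exact: man_strategy|exact: lady_guarantee|].
    exact: man_guarantee.
  + exact: aeW.
  + exact: man_stroll.
- split; first exact: stroll_play.
  rewrite stroll_state_late ?lexx ?ltrDl ?divr_gt0//.
  by rewrite addrAC subrr add0r sin_pihalf mulr1.
- move=> t0 t t00 tt tV rt0; have kt : k0 < t.
    rewrite (le_lt_trans _ tt)// leNgt; apply/negP => tk.
    have [] := congr1 fst (stroll_state t00 (ltW tk)); rewrite /= rt0 => e.
    by have : mu * t0 < r0; [rewrite -muk0 ltr_pM2l|lra].
  by rewrite /th (lady_stroll_th _ _ h0 (le_trans k00 (ltW kt))) -/k0 leNgt kt.
Qed.

End StrollEquilibrium.

(** * The axis th = 0 and its tributaries *)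

Section UniversalLine.
Context {R : realType}.
Implicit Types (h p s t x : R).
Variable mu : R.
Hypotheses (mu0 : 0 < mu) (mu1 : mu < 1) (bar0 : 0 < barrier mu 1).

Lemma axis_state_space x : 0 <= x <= 1 -> state_space mu (x, 0).
Proof.
move=> xI; split=> //=; first by rewrite lexx pi_ge0.
by case/andP: xI => _ x1 /ltW mx; rewrite (lt_le_trans bar0)// barrier_le.
Qed.

(** The start is found backwards from the point (p, 0): during time h L covers mu h radially and M
    closes the angle h. A small h meets all requirements of the opening. *)
Lemma tributary_start p : 0 < p < 1 -> exists h, [/\ 0 < h, state_space mu (p + mu * h, h) &
  [/\ h * (2 + mu / p) <= p / mu, h * (2 + mu / p) < barrier mu 1 & h * (2 + mu / p) <= 1]].
Proof.
move=> /andP[p0 p1]; pose q := 2 + mu / p.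
have q0 : 0 < q by rewrite addr_gt0// divr_gt0.
pose m := Num.min (p / mu) (Num.min (barrier mu 1 / 2) 1).
have m0 : 0 < m by rewrite !lt_min !divr_gt0// ltr01.
(* The first bound keeps the start inside the lake; the second makes the bound on the angle during
   the opening small enough. *)
pose h := Num.min ((1 - p) / mu) (m / q).
have h0 : 0 < h by rewrite lt_min !divr_gt0// subr_gt0.
have hq : h * q <= m by rewrite -ler_pdivlMr// ge_min lexx orbT.
have hmu : mu * h <= 1 - p by rewrite mulrC -ler_pdivlMr// ge_min lexx.
have e1 : h * q <= p / mu by rewrite (le_trans hq)// ge_min lexx.
have e2 : h * q <= barrier mu 1 / 2 by rewrite (le_trans hq)// !ge_min lexx orbT.
have e3 : h * q <= 1 by rewrite (le_trans hq)// !ge_min lexx !orbT.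
have hh : h <= h * q.
  by rewrite ler_peMr ?(ltW h0)// /q; have : 0 <= mu / p; [rewrite divr_ge0 ?ltW|lra].
have hb : h < barrier mu 1 by have := bar0; lra.
exists h; split=> //; last by split=> //; have := bar0; rewrite -/q; lra.
have r1 : p + mu * h <= 1 by lra.
split=> /=.
- by rewrite r1 andbT addr_ge0 ?(ltW p0)// mulr_ge0 ?(ltW mu0)// ltW.
- by rewrite (ltW h0)/=; have := pi_ge2 R; lra.
- by move=> /ltW mr; rewrite (lt_le_trans hb)// barrier_le.
Qed.

Lemma axis_tributary p : 0 < p < 1 -> tributary_at mu UL (p, 0).
Proof.
move=> pI; have [p0 p1] := andP pI; have [h [h0 st op]] := tributary_start pI.
set r0 := p + mu * h in st.
have r0h : r0 - mu * h = p by rewrite /r0 addrK.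
have opening : h = 0 \/ [/\ 0 < h, 0 < r0 - mu * h,
    h * (2 + mu / (r0 - mu * h)) <= (r0 - mu * h) / mu,
    h * (2 + mu / (r0 - mu * h)) < barrier mu 1 & h * (2 + mu / (r0 - mu * h)) <= 1].
  by right; rewrite r0h; have [? ? ?] := op.
have eq := stroll_equilibrium mu0 mu1 bar0 st opening.
have hk : h < r0 / mu by rewrite ltr_pdivlMr// mulrC -subr_gt0 r0h.
have stE t := stroll_state mu0 st opening (t := t).
exists (r0, h); do 5!eexists; split; first exact: eq.
have k00 : 0 <= r0 / mu by rewrite (le_trans (ltW h0))// ltW.
exists h, (r0 / mu); split.
- by rewrite h0 hk lerDl divr_ge0// pi_ge0.
- move=> t /andP[t0 th]; rewrite stE// ?(le_trans (ltW th) (ltW hk))// => -[_ /= e].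
  by have : 0 < h - t; [rewrite subr_gt0|move=> /[dup] ht /ltW ht'; move: ht; rewrite -[X in _ < X](max_l ht') e ltxx].
- by rewrite stE ?ltW// r0h subrr max_l.
- move=> t /andP[ht tk]; have t0 := le_trans (ltW h0) ht.
  rewrite stE//; split=> /=; last by rewrite max_r// subr_le0.
  have [/andP[_ r1] _ _] := st; rewrite subr_ge0 mulrC -ler_pdivlMr// tk/=.
  by rewrite (le_trans _ r1)// gerBl mulr_ge0// ltW.
have [hI hS] : 0 <= h /\ h <= r0 / mu by rewrite !ltW.
(* Before time h the angle closes at unit rate; afterwards L continues inward along the axis. *)
exists (- mu), (-1), (- mu), 0; split.
- apply: cvg_near_cst; near=> e; have e0 : e < 0 by near: e; exact: nbhs_left_lt.
  have eh : - h <= e by near: e; apply: nbhs_left_ge; rewrite oppr_lt0.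
  by rewrite !stE//=; [field; rewrite lt_eqF|lra..].
- apply: cvg_near_cst; near=> e; have e0 : e < 0 by near: e; exact: nbhs_left_lt.
  have eh : - h <= e by near: e; apply: nbhs_left_ge; rewrite oppr_lt0.
  rewrite !stE//=; [|lra..].
  by rewrite max_l ?subrr ?max_l//; [field; rewrite lt_eqF|lra..].
- apply: cvg_near_cst; near=> e; have e0 : 0 < e by near: e; exact: nbhs_right_gt.
  have eh : e <= r0 / mu - h by near: e; apply: nbhs_right_le; rewrite subr_gt0.
  by rewrite !stE//=; [field; rewrite gt_eqF|lra..].
- apply: cvg_near_cst; near=> e; have e0 : 0 < e by near: e; exact: nbhs_right_gt.
  have eh : e <= r0 / mu - h by near: e; apply: nbhs_right_le; rewrite subr_gt0.
  rewrite !stE//=; [|lra..].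
  by rewrite max_r ?subrr ?max_l ?subr0 ?mulr0//; lra.
- by rewrite mulr0 eq_sym mulN1r opprK gt_eqF.
Unshelve. all: by end_near. Qed.

Lemma axis_universal : universal_line mu UL.
Proof.
have I1 : 0 <= (1 : R) <= 1 by rewrite ler01 lexx.
have st := axis_state_space I1.
have opening : (0 : R) = 0 \/ [/\ 0 < (0 : R), 0 < 1 - mu * 0,
    0 * (2 + mu / (1 - mu * 0)) <= (1 - mu * 0) / mu,
    0 * (2 + mu / (1 - mu * 0)) < barrier mu 1 & 0 * (2 + mu / (1 - mu * 0)) <= 1] by left.
have stE t := stroll_state mu0 st opening (t := t).
have {}stE t : 0 <= t -> t <= 1 / mu -> state (lady_r mu 1 (stroll 0 (1 / mu)))
    (lady_th mu 1 0 (stroll 0 (1 / mu))) t = (1 - mu * t, 0).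
  by move=> t0 tk; rewrite stE// sub0r max_r// oppr_le0.
have muk : mu * (1 / mu) = 1 by rewrite mulrC divfK// gt_eqF.
have k0 : 0 < 1 / mu by rewrite divr_gt0.
exists (1, 0); do 5!eexists; split; first exact: (stroll_equilibrium mu0 mu1 bar0 st opening).
exists (1 / mu); split.
- by rewrite k0 lerDl divr_ge0// pi_ge0.
- split.
    apply: (@subspace_eq_continuous _ _ _ (fun t => 1 - mu * t)).
      move=> t; rewrite inE/= in_itv/= => /andP[_ tk].
      by rewrite /from_subspace lady_stroll_r tk.
    apply: continuous_subspaceT => t; apply: cvgB; first exact: cvg_cst.
    by apply: cvgMr; exact: cvg_id.
  apply: (@subspace_eq_continuous _ _ _ (fun=> 0)).
    move=> t; rewrite inE/= in_itv/= => /andP[t0 tk].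
    by rewrite /from_subspace (lady_stroll_th _ _ (lexx 0) t0) tk sub0r max_r// oppr_le0.
  by apply: continuous_subspaceT => t; exact: cvg_cst.
- apply/seteqP; split=> [q [t /=]|[x z] [/= /andP[x0 x1] ->]].
    rewrite in_itv/= => /andP[t0 tk] <-; rewrite stE//; split=> //=.
    by rewrite subr_ge0 -[X in _ <= X]muk ler_pM2l// tk gerBl mulr_ge0// ltW.
  have e0 : 0 <= (1 - x) / mu by rewrite divr_ge0 ?subr_ge0// ltW.
  have e1 : (1 - x) / mu <= 1 / mu by rewrite ler_pM2r ?invr_gt0// gerBl.
  exists ((1 - x) / mu); first by rewrite /= in_itv/= e0.
  by rewrite stE// mulrC divfK ?gt_eqF// opprB addrC subrK.
- move=> t /andP[t0 tk]; rewrite stE ?ltW//; apply: axis_tributary.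
  by rewrite subr_gt0 -[X in _ < X]muk ltr_pM2l// tk/= gtrBl mulr_gt0.
Qed.

Lemma axis_play x : 0 <= x <= 1 ->
  exists (psi omega : R -> R) (T : R) (r th : R -> R),
    equilibrium_play mu (x, 0) psi omega T r th /\
    (forall t : R, 0 <= t <= T -> (forall s : R, 0 <= s <= t -> 0 < r s) ->
       [/\ UL (state r th t), cos (psi t) = -1 & omega t = 0]).
Proof.
move=> xI; have st := axis_state_space xI; have [x0 x1] := andP xI.
have opening : (0 : R) = 0 \/ [/\ 0 < (0 : R), 0 < x - mu * 0,
    0 * (2 + mu / (x - mu * 0)) <= (x - mu * 0) / mu,
    0 * (2 + mu / (x - mu * 0)) < barrier mu 1 & 0 * (2 + mu / (x - mu * 0)) <= 1] by left.
do 5!eexists; split; first exact: (stroll_equilibrium mu0 mu1 bar0 st opening).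
have muk : mu * (x / mu) = x by rewrite mulrC divfK// gt_eqF.
have k0 : 0 <= x / mu by rewrite divr_ge0// ltW.
(* Positivity of the radius on [0, t] confines t to the time before the center; if L starts there,
   nothing is claimed about the controls. *)
move=> t /andP[t0 tT] rpos; have tk : t < x / mu.
  rewrite ltNge; apply/negP => kt; have := rpos (x / mu); rewrite k0 kt => /(_ isT).
  by rewrite lady_stroll_r lexx muk subrr ltxx.
split.
- rewrite (stroll_state mu0 st opening t0 (ltW tk)); split=> /=.
    by rewrite subr_ge0 -[X in _ <= X]muk ler_pM2l// ltW//= (le_trans _ x1)// gerBl mulr_ge0// ltW.
  by rewrite sub0r max_r// oppr_le0.
- by rewrite /lady (ltW tk) cospi.
- by rewrite /stroll ltNge t0/= tk.
Qed.

End UniversalLine.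

Theorem proposition2 (R : realType) (mu_crit mu : R)
    (hcrit : is_mu_crit mu_crit) (hmu : mu_crit < mu < 1) :
  universal_line mu UL /\
  (forall x : R * R, UL x ->
    exists (psi omega : R -> R) (T : R) (r th : R -> R),
      equilibrium_play mu x psi omega T r th /\
      (forall t : R, 0 <= t <= T -> (forall s : R, 0 <= s <= t -> 0 < r s) ->
         [/\ UL (state r th t), cos (psi t) = -1 & omega t = 0])).
Proof.
have bar0 := barrier1_gt0 hcrit hmu.
have [/andP[m0 _] _] := hcrit; have [mm mu1] := andP hmu.
have mu0 := lt_trans m0 mm.
split; first exact: axis_universal.
by move=> [x z] [/= xI ->]; exact: axis_play.
Qed.
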